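(* Let $\alpha,\beta$ be complex with $\Re(\alpha)>0$, $\Re(\beta)>0$, and let $a,c$ be real numbers such that $c-a(a+t)>0$, $c-(a+1)(a+t)>0$ and $c-(a+t)^2>0$ for all $t\in[0,1]$. Then \[ \frac{\Gamma(\alpha)\Gamma(\beta)}{\Gamma(\alpha+\beta)}=(c-(a+1)^2)\int_0^1 \frac{(c-a(a+t))^{\beta}\,(c-(a+1)(a+t))^{\beta-1}}{(c-(a+t)^2)^{2\beta}}\; {}_2F_1\!\left[\begin{matrix}\alpha-\beta-1,\ -\beta\\ \alpha\end{matrix};\frac{(a+t)t}{c-a(a+t)}\right]t^{\alpha-1}(1-t)^{\beta-1}\,dt . \]
   Context: Powers of positive reals are principal powers. ${}_2F_1\!\left[\begin{matrix}a_1,a_2\\ b_1\end{matrix};x\right]=\sum_{n\ge0}\frac{(a_1)_n(a_2)_n}{n!\,(b_1)_n}x^n$ with $(x)_n=x(x+1)\cdots(x+n-1)$, understood as its analytic continuation to $\mathbb C\setminus[1,\infty)$ (under the hypotheses the argument is a real number $<1$). *)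

(* Defs.v *)
From Stdlib Require Import Reals Factorial.
From Coquelicot Require Import Coquelicot.

Open Scope R_scope.

Definition cexp (z : C) : C :=
  (exp (Re z) * cos (Im z), exp (Re z) * sin (Im z)).

Definition cpow (x : R) (w : C) : C := cexp (Cmult w (RtoC (ln x))).

Definition is_Gamma (z : C) (g : C) : Prop :=
  is_RInt_gen (V := C_R_NormedModule)
    (fun t : R => Cmult (cpow t (Cminus z (RtoC 1))) (RtoC (exp (- t))))
    (at_right 0) (Rbar_locally p_infty) g.

Fixpoint poch (x : C) (n : nat) : C :=
  match n with
  | O => RtoC 1
  | S m => Cmult (poch x m) (Cplus x (RtoC (INR m)))
  end.

Definition F21_term (a1 a2 b1 : C) (z : C) (n : nat) : C :=
  Cdiv (Cmult (Cmult (poch a1 n) (poch a2 n)) (pow_n z n))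
       (Cmult (RtoC (INR (fact n))) (poch b1 n)).

Definition cut_plane (z : C) : Prop := ~ (Im z = 0 /\ 1 <= Re z).

Definition is_F21_continuation (a1 a2 b1 : C) (G : C -> C) : Prop :=
  (forall z : C, cut_plane z ->
     ex_derive (K := C_AbsRing) (V := C_NormedModule) G z) /\
  (forall z : C, Cmod z < 1 ->
     is_series (K := C_AbsRing) (V := C_NormedModule) (F21_term a1 a2 b1 z) (G z)).

(* Main.v *)
(* Put w = a + 1 and deform the lower parameter: for s in [0, 1] let J(s) be the
   integral with a replaced by w - s and x = w - s (1 - t) in place of a + t.
   For s = 1 this is the integral of the theorem, for s = 0 it is B(alpha, beta) / (c - w^2).
   Let E(s) be the corresponding integral of the contiguous difference in which
   F is replaced by F - t G, with
     G = (alpha + beta) / alpha * 2F1(alpha - beta, - beta; alpha + 1; .).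
   Two rational certificates (telescopers in the style of Wilf and Zeilberger) show that
     J' = k E   and   E' = (k - (alpha + beta) / s) E,
   with k = (alpha + beta - 1) w / (c - (w - s) w), up to boundary terms that vanish.
   Since E is bounded while the nonzero solutions of the second equation blow up like
   s^(- alpha - beta) at s = 0, E vanishes, hence J is constant.  The argument of the
   hypergeometric function has modulus < 1 throughout, so only the power series matters. *)

Require Import Defs.
From Stdlib Require Import Reals Factorial Lra Lia Psatz.
From Coquelicot Require Import Coquelicot.

Open Scope R_scope.

(** * Complex-valued functions of a real variable *)

(** Why the companion [G]: (1 - z) F' is a multiple of F - G, and z (1 - z) G' is a combination of F
    and G, so the pair closes under differentiation. A certificate can then be sought as a rational
    combination of F and G, and checking it is a [field] computation modulo these two relations.

    The obstacle is analytic. The integrands may be singular at both ends of (0, 1), so nothing is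
    differentiated under an improper integral. All differentiation takes place on [d, 1 - d] with
    [d] fixed. Each improper integral comes with an explicit truncation error, a bound of the
    regular factor times a function of [d] alone, hence uniform in the parameter s. Boundary terms
    carry t^alpha (1 - t)^beta and are small with [d]. Limits are taken only in inequalities.

    The Gamma values are given as integrals. Hence the identity Gamma(alpha) Gamma(beta) =
    Gamma(alpha + beta) B(alpha, beta) is proved along the way, by differentiating in the upper
    limit of an incomplete Gamma integral. The quotient in the theorem moreover requires Gamma(alpha
    + beta) to be nonzero, which has its own proof by the recurrence and an estimate for large real
    part. *)

Section RealContinuity.
Context {U : UniformSpace}.
Variables (f g : U -> R) (x : U).
Lemma rcont_plus : continuous f x -> continuous g x -> continuous (fun u => f u + g u) x.
Proof. exact (continuous_plus (V := R_NormedModule) f g x). Qed.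
Lemma rcont_minus : continuous f x -> continuous g x -> continuous (fun u => f u - g u) x.
Proof. exact (continuous_minus (V := R_NormedModule) f g x). Qed.
Lemma rcont_opp : continuous f x -> continuous (fun u => - f u) x.
Proof. exact (continuous_opp (V := R_NormedModule) f x). Qed.
Lemma rcont_mult : continuous f x -> continuous g x -> continuous (fun u => f u * g u) x.
Proof. exact (continuous_mult (K := R_AbsRing) f g x). Qed.
Lemma rcont_inv : continuous f x -> f x <> 0 -> continuous (fun u => / f u) x.
Proof. intros H H0. apply (continuous_comp f Rinv); [exact H | now apply continuous_Rinv]. Qed.
End RealContinuity.

(** Continuity, derivative and integral are taken componentwise: the real lemmas and [auto_derive]
    then apply directly, and no choice among the normed structures on C is involved. *)
Definition Ccont {U : UniformSpace} (f : U -> C) (x : U) : Prop :=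
  continuous (fun u => Re (f u)) x /\ continuous (fun u => Im (f u)) x.

Definition Cderive (f : R -> C) (x : R) (l : C) : Prop :=
  is_derive (fun u => Re (f u)) x (Re l) /\ is_derive (fun u => Im (f u)) x (Im l).

Definition CRInt (f : R -> C) (a b : R) : C :=
  (RInt (fun t => Re (f t)) a b, RInt (fun t => Im (f t)) a b).

Lemma Ccont_const {U : UniformSpace} (c : C) (x : U) : Ccont (fun _ => c) x.
Proof. split; apply continuous_const. Qed.

Lemma Ccont_RtoC {U : UniformSpace} (g : U -> R) (x : U) :
  continuous g x -> Ccont (fun u => RtoC (g u)) x.
Proof. intros H; split; [exact H | apply continuous_const]. Qed.

Lemma Ccont_plus {U : UniformSpace} (f g : U -> C) (x : U) :
  Ccont f x -> Ccont g x -> Ccont (fun u => Cplus (f u) (g u)) x.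
Proof.
  intros [H1 H2] [H3 H4]; split.
  - apply (continuous_plus (V := R_NormedModule) (fun u => Re (f u)) (fun u => Re (g u))); assumption.
  - apply (continuous_plus (V := R_NormedModule) (fun u => Im (f u)) (fun u => Im (g u))); assumption.
Qed.

Lemma Ccont_opp {U : UniformSpace} (f : U -> C) (x : U) :
  Ccont f x -> Ccont (fun u => Copp (f u)) x.
Proof.
  intros [H1 H2]; split.
  - apply (continuous_opp (V := R_NormedModule) (fun u => Re (f u))); assumption.
  - apply (continuous_opp (V := R_NormedModule) (fun u => Im (f u))); assumption.
Qed.

Lemma Ccont_minus {U : UniformSpace} (f g : U -> C) (x : U) :
  Ccont f x -> Ccont g x -> Ccont (fun u => Cminus (f u) (g u)) x.
Proof. intros H1 H2; apply (Ccont_plus f (fun u => Copp (g u))); [exact H1 | now apply Ccont_opp]. Qed.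

Lemma Ccont_mult {U : UniformSpace} (f g : U -> C) (x : U) :
  Ccont f x -> Ccont g x -> Ccont (fun u => Cmult (f u) (g u)) x.
Proof.
  intros [H1 H2] [H3 H4]; split.
  - apply (continuous_minus (V := R_NormedModule) (fun u => Re (f u) * Re (g u)) (fun u => Im (f u) * Im (g u)));
      apply (continuous_mult (K := R_AbsRing)); assumption.
  - apply (continuous_plus (V := R_NormedModule) (fun u => Re (f u) * Im (g u)) (fun u => Im (f u) * Re (g u)));
      apply (continuous_mult (K := R_AbsRing)); assumption.
Qed.

Lemma Ccont_comp {U : UniformSpace} (f : R -> C) (g : U -> R) (x : U) :
  continuous g x -> Ccont f (g x) -> Ccont (fun u => f (g u)) x.
Proof.
  intros H [H1 H2]; split.
  - apply (continuous_comp g (fun v => Re (f v))); assumption.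
  - apply (continuous_comp g (fun v => Im (f v))); assumption.
Qed.

Lemma Cderive_Ccont (f : R -> C) (x : R) (l : C) : Cderive f x l -> Ccont f x.
Proof.
  intros [H1 H2]; split; apply (ex_derive_continuous (V := R_NormedModule)).
  - now exists (Re l).
  - now exists (Im l).
Qed.

Lemma Cderive_const (c : C) (x : R) : Cderive (fun _ => c) x (RtoC 0).
Proof. split; simpl; [apply (is_derive_const (V := R_NormedModule)) | apply (is_derive_const (V := R_NormedModule))]. Qed.

Lemma Cderive_RtoC (g : R -> R) (x l : R) :
  is_derive g x l -> Cderive (fun u => RtoC (g u)) x (RtoC l).
Proof. intros H; split; [exact H | exact (is_derive_const (V := R_NormedModule) 0 x)]. Qed.

Lemma Cderive_eq (f : R -> C) (x : R) (l l' : C) : Cderive f x l -> l = l' -> Cderive f x l'.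
Proof. intros H <-; exact H. Qed.

Lemma Cderive_plus (f g : R -> C) (x : R) (lf lg : C) :
  Cderive f x lf -> Cderive g x lg -> Cderive (fun u => Cplus (f u) (g u)) x (Cplus lf lg).
Proof.
  intros [H1 H2] [H3 H4]; split.
  - apply (is_derive_plus (V := R_NormedModule) (fun u => Re (f u)) (fun u => Re (g u))); assumption.
  - apply (is_derive_plus (V := R_NormedModule) (fun u => Im (f u)) (fun u => Im (g u))); assumption.
Qed.

Lemma Cderive_opp (f : R -> C) (x : R) (lf : C) :
  Cderive f x lf -> Cderive (fun u => Copp (f u)) x (Copp lf).
Proof.
  intros [H1 H2]; split.
  - apply (is_derive_opp (V := R_NormedModule) (fun u => Re (f u))); assumption.
  - apply (is_derive_opp (V := R_NormedModule) (fun u => Im (f u))); assumption.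
Qed.

Lemma Cderive_minus (f g : R -> C) (x : R) (lf lg : C) :
  Cderive f x lf -> Cderive g x lg -> Cderive (fun u => Cminus (f u) (g u)) x (Cminus lf lg).
Proof. intros H1 H2; apply (Cderive_plus f (fun u => Copp (g u))); [exact H1 | now apply Cderive_opp]. Qed.

Lemma Cderive_mult (f g : R -> C) (x : R) (lf lg : C) :
  Cderive f x lf -> Cderive g x lg ->
  Cderive (fun u => Cmult (f u) (g u)) x (Cplus (Cmult lf (g x)) (Cmult (f x) lg)).
Proof.
  intros [H1 H2] [H3 H4].
  assert (M : forall a b : R -> R, forall la lb : R, is_derive a x la -> is_derive b x lb ->
     is_derive (fun u => a u * b u) x (la * b x + a x * lb)).
  { intros a b la lb Ha Hb. apply (is_derive_mult (K := R_AbsRing) a b x la lb Ha Hb).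
    intros; apply Rmult_comm. }
  split.
  - replace (Re _) with ((Re lf * Re (g x) + Re (f x) * Re lg) - (Im lf * Im (g x) + Im (f x) * Im lg))
      by (unfold Re, Im; simpl; ring).
    apply (is_derive_minus (V := R_NormedModule) (fun u => Re (f u) * Re (g u)) (fun u => Im (f u) * Im (g u)));
      apply M; assumption.
  - replace (Im _) with ((Re lf * Im (g x) + Re (f x) * Im lg) + (Im lf * Re (g x) + Im (f x) * Re lg))
      by (unfold Re, Im; simpl; ring).
    apply (is_derive_plus (V := R_NormedModule) (fun u => Re (f u) * Im (g u)) (fun u => Im (f u) * Re (g u)));
      apply M; assumption.
Qed.

Lemma Cderive_comp (f : R -> C) (g : R -> R) (x dg : R) (l : C) :
  Cderive f (g x) l -> is_derive g x dg -> Cderive (fun u => f (g u)) x (Cmult (RtoC dg) l).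
Proof.
  intros [H1 H2] H; split.
  - replace (Re _) with (scal dg (Re l)) by (unfold scal, Re, Im; simpl; unfold mult; simpl; ring).
    apply (is_derive_comp (fun v => Re (f v)) g x _ _ H1 H).
  - replace (Im _) with (scal dg (Im l)) by (unfold scal, Re, Im; simpl; unfold mult; simpl; ring).
    apply (is_derive_comp (fun v => Im (f v)) g x _ _ H2 H).
Qed.

(** * Complex powers of positive reals *)

Lemma cpow_derive (w : C) (x : R) (Hx : 0 < x) :
  Cderive (fun u => cpow u w) x (Cmult (Cdiv w (RtoC x)) (cpow x w)).
Proof.
  destruct w as [p q].
  split; unfold cpow, cexp, Re, Im; simpl.
  - auto_derive; [lra |]. replace (p * ln x - q * 0) with (p * ln x + - (q * 0)) by ring. field; nra.
  - auto_derive; [lra |]. replace (p * ln x - q * 0) with (p * ln x + - (q * 0)) by ring. field; nra.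
Qed.

Lemma cpow_cont {U : UniformSpace} (g : U -> R) (w : C) (x : U) :
  continuous g x -> 0 < g x -> Ccont (fun u => cpow (g u) w) x.
Proof.
  intros H H0. apply (Ccont_comp (fun v => cpow v w) g); [exact H|].
  eapply Cderive_Ccont, cpow_derive, H0.
Qed.

Lemma Cmod_cpow (x : R) (w : C) : Cmod (cpow x w) = exp (Re w * ln x).
Proof.
  destruct w as [p q]. unfold Cmod, cpow, cexp, Re, Im; simpl.
  set (A := exp _). set (t := (p * 0 + q * ln x)).
  replace (A * cos t * (A * cos t * 1) + A * sin t * (A * sin t * 1))
    with (A * A * (Rsqr (sin t) + Rsqr (cos t))) by (unfold Rsqr; ring).
  rewrite sin2_cos2, Rmult_1_r. rewrite sqrt_square.
  - unfold A; f_equal; ring.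
  - left; apply exp_pos.
Qed.

Lemma cpow_Rpower (x : R) (p : R) : cpow x (RtoC p) = RtoC (Rpower x p).
Proof.
  unfold cpow, cexp, RtoC, Re, Im, Rpower; simpl.
  replace (p * 0 + 0 * ln x) with 0 by ring. rewrite cos_0, sin_0.
  replace (p * ln x - 0 * 0) with (p * ln x) by ring. f_equal; ring.
Qed.

Lemma cexp_plus (u v : C) : cexp (Cplus u v) = Cmult (cexp u) (cexp v).
Proof.
  unfold cexp, Cmult, Re, Im; simpl. rewrite exp_plus, cos_plus, sin_plus. f_equal; ring.
Qed.

Lemma cexp_0 : cexp (RtoC 0) = RtoC 1.
Proof. unfold cexp, RtoC, Re, Im; simpl. rewrite exp_0, cos_0, sin_0. f_equal; ring. Qed.

Lemma cpow_plus (x : R) (u v : C) : cpow x (Cplus u v) = Cmult (cpow x u) (cpow x v).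
Proof. unfold cpow. rewrite <- cexp_plus. f_equal. ring. Qed.

Lemma cpow_0 (x : R) : cpow x (RtoC 0) = RtoC 1.
Proof. unfold cpow. rewrite Cmult_0_l. apply cexp_0. Qed.

Lemma cpow_1 (x : R) (Hx : 0 < x) : cpow x (RtoC 1) = RtoC x.
Proof. rewrite cpow_Rpower. f_equal. now apply Rpower_1. Qed.

Lemma cpow_neq_0 (x : R) (w : C) : cpow x w <> RtoC 0.
Proof.
  intros H. assert (E := Cmod_cpow x w). rewrite H, Cmod_0 in E.
  pose proof (exp_pos (Re w * ln x)). lra.
Qed.

Lemma cpow_opp (x : R) (w : C) : cpow x (Copp w) = Cinv (cpow x w).
Proof.
  assert (H : Cmult (cpow x (Copp w)) (cpow x w) = RtoC 1).
  { rewrite <- cpow_plus. replace (Cplus (Copp w) w) with (RtoC 0) by ring. apply cpow_0. }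
  pose proof (cpow_neq_0 x w).
  replace (cpow x (Copp w)) with (Cmult (Cmult (cpow x (Copp w)) (cpow x w)) (Cinv (cpow x w)))
    by (field; assumption).
  rewrite H. ring.
Qed.

Lemma cpow_mult (x y : R) (w : C) (Hx : 0 < x) (Hy : 0 < y) :
  cpow (x * y) w = Cmult (cpow x w) (cpow y w).
Proof.
  unfold cpow. rewrite <- cexp_plus. f_equal. rewrite ln_mult by assumption.
  rewrite RtoC_plus. ring.
Qed.

Lemma Cmod_le_Re_Im (z : C) : Cmod z <= Rabs (Re z) + Rabs (Im z).
Proof.
  destruct z as [a b]. replace (a, b) with (Cplus (RtoC a) (Cmult Ci (RtoC b))).
  2:{ unfold Cplus, Cmult, RtoC, Ci; simpl; f_equal; ring. }
  eapply Rle_trans; [apply Cmod_triangle|]. rewrite Cmod_mult, !Cmod_R.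
  assert (E : Cmod Ci = 1).
  { unfold Cmod, Ci; simpl. replace (0 * (0 * 1) + 1 * (1 * 1)) with 1 by ring. apply sqrt_1. }
  rewrite E. unfold Re, Im; simpl.
  replace (a + (0 * b - 1 * 0)) with a by ring. replace (0 + (0 * 0 + 1 * b)) with b by ring. lra.
Qed.

Lemma Re_le_Cmod (z : C) : Rabs (Re z) <= Cmod z.
Proof. eapply Rle_trans; [|apply Rmax_Cmod]. apply Rmax_l. Qed.
Lemma Im_le_Cmod (z : C) : Rabs (Im z) <= Cmod z.
Proof. eapply Rle_trans; [|apply Rmax_Cmod]. apply Rmax_r. Qed.

(** * Integrals of complex-valued functions over compact intervals *)

Section Integral.
Variables (f g : R -> C) (a b : R).
Hypothesis Hf : forall t, Rmin a b <= t <= Rmax a b -> Ccont f t.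

Lemma ex_RInt_Re : ex_RInt (fun t => Re (f t)) a b.
Proof. apply (ex_RInt_continuous (V := R_CompleteNormedModule)). intros t Ht. apply (Hf t Ht). Qed.

Lemma ex_RInt_Im : ex_RInt (fun t => Im (f t)) a b.
Proof. apply (ex_RInt_continuous (V := R_CompleteNormedModule)). intros t Ht. apply (Hf t Ht). Qed.

Lemma is_RInt_CRInt : is_RInt (V := C_R_NormedModule) f a b (CRInt f a b).
Proof.
  apply (is_RInt_fct_extend_pair (U := R_NormedModule) (V := R_NormedModule)).
  - apply (RInt_correct (V := R_CompleteNormedModule)), ex_RInt_Re.
  - apply (RInt_correct (V := R_CompleteNormedModule)), ex_RInt_Im.
Qed.
End Integral.

Lemma is_RInt_CRInt_unique (f : R -> C) (a b : R) (l : C) :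
  is_RInt (V := C_R_NormedModule) f a b l -> CRInt f a b = l.
Proof.
  intros H. unfold CRInt. destruct l as [l1 l2]. f_equal.
  - apply (is_RInt_unique (V := R_CompleteNormedModule)).
    apply (is_RInt_fct_extend_fst (U := R_NormedModule) (V := R_NormedModule) f a b (l1, l2) H).
  - apply (is_RInt_unique (V := R_CompleteNormedModule)).
    apply (is_RInt_fct_extend_snd (U := R_NormedModule) (V := R_NormedModule) f a b (l1, l2) H).
Qed.

Lemma norm_Cmod (z : C) : @norm R_AbsRing C_R_NormedModule z = Cmod z.
Proof.
  unfold norm, Cmod; simpl. unfold prod_norm, norm; simpl. unfold abs; simpl.
  f_equal. rewrite !Rmult_1_r, <- !Rabs_mult.
  rewrite !Rabs_right; [reflexivity | apply Rle_ge, Rle_0_sqr | apply Rle_ge, Rle_0_sqr].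
Qed.

Lemma CRInt_bound (f : R -> C) (g : R -> R) (a b l : R) :
  a <= b -> (forall t, a <= t <= b -> Ccont f t) ->
  (forall t, a <= t <= b -> Cmod (f t) <= g t) -> is_RInt g a b l ->
  Cmod (CRInt f a b) <= l.
Proof.
  intros Hab Hf Hg Hl. rewrite <- norm_Cmod.
  apply (norm_RInt_le (V := C_R_NormedModule) f g a b (CRInt f a b) l Hab).
  - intros t Ht; rewrite norm_Cmod; now apply Hg.
  - apply is_RInt_CRInt. intros t. rewrite Rmin_left, Rmax_right by assumption. apply Hf.
  - exact Hl.
Qed.

Lemma CRInt_Chasles (f : R -> C) (a b c : R) :
  (forall t, Rmin a b <= t <= Rmax a b -> Ccont f t) ->
  (forall t, Rmin b c <= t <= Rmax b c -> Ccont f t) ->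
  Cplus (CRInt f a b) (CRInt f b c) = CRInt f a c.
Proof.
  intros H1 H2. symmetry. apply is_RInt_CRInt_unique.
  apply (is_RInt_Chasles (V := C_R_NormedModule) f a b c); now apply is_RInt_CRInt.
Qed.


Lemma CRInt_plus (f g : R -> C) (a b : R) :
  (forall t, Rmin a b <= t <= Rmax a b -> Ccont f t) ->
  (forall t, Rmin a b <= t <= Rmax a b -> Ccont g t) ->
  CRInt (fun t => Cplus (f t) (g t)) a b = Cplus (CRInt f a b) (CRInt g a b).
Proof.
  intros H1 H2. apply is_RInt_CRInt_unique.
  apply (is_RInt_plus (V := C_R_NormedModule) f g a b); now apply is_RInt_CRInt.
Qed.

Lemma CRInt_ext (f g : R -> C) (a b : R) :
  (forall t, Rmin a b < t < Rmax a b -> f t = g t) -> CRInt f a b = CRInt g a b.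
Proof.
  intros H. unfold CRInt. f_equal; apply (RInt_ext (V := R_CompleteNormedModule)); intros t Ht; now rewrite H.
Qed.

Lemma CRInt_scal (k : C) (f : R -> C) (a b : R) :
  (forall t, Rmin a b <= t <= Rmax a b -> Ccont f t) ->
  CRInt (fun t => Cmult k (f t)) a b = Cmult k (CRInt f a b).
Proof.
  intros H.
  pose proof (RInt_correct (V := R_CompleteNormedModule) _ _ _ (ex_RInt_Re f a b H)) as I1.
  pose proof (RInt_correct (V := R_CompleteNormedModule) _ _ _ (ex_RInt_Im f a b H)) as I2.
  unfold CRInt, Cmult; simpl. f_equal; apply (is_RInt_unique (V := R_CompleteNormedModule)).
  - apply (is_RInt_minus (V := R_NormedModule) (fun t => fst k * Re (f t)) (fun t => snd k * Im (f t)));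
      now apply (is_RInt_scal (V := R_NormedModule)).
  - apply (is_RInt_plus (V := R_NormedModule) (fun t => fst k * Im (f t)) (fun t => snd k * Re (f t)));
      now apply (is_RInt_scal (V := R_NormedModule)).
Qed.

Lemma CRInt_FTC (F f : R -> C) (a b : R) :
  (forall t, Rmin a b <= t <= Rmax a b -> Cderive F t (f t)) ->
  (forall t, Rmin a b <= t <= Rmax a b -> Ccont f t) ->
  CRInt f a b = Cminus (F b) (F a).
Proof.
  intros H1 H2. unfold CRInt.
  replace (Cminus (F b) (F a)) with (Re (F b) - Re (F a), Im (F b) - Im (F a))
    by (unfold Cminus, Cplus, Copp, Re, Im; simpl; reflexivity).
  f_equal; apply (is_RInt_unique (V := R_CompleteNormedModule)).
  - apply (is_RInt_derive (V := R_CompleteNormedModule) (fun t => Re (F t)) (fun t => Re (f t)));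
      intros t Ht; [apply (H1 t Ht) | apply (H2 t Ht)].
  - apply (is_RInt_derive (V := R_CompleteNormedModule) (fun t => Im (F t)) (fun t => Im (f t)));
      intros t Ht; [apply (H1 t Ht) | apply (H2 t Ht)].
Qed.

(** The real and the imaginary part have different intermediate points; adding the two estimates
    costs the factor 2. It is harmless, since the lemma only serves limits in which the bound tends
    to 0. *)
Lemma CMVT (f df : R -> C) (a b K : R) : a <= b ->
  (forall t, a <= t <= b -> Cderive f t (df t)) ->
  (forall t, a <= t <= b -> Cmod (df t) <= K) ->
  Cmod (Cminus (f b) (f a)) <= 2 * K * (b - a).
Proof.
  intros Hab Hd HK.
  assert (M : forall (u du : R -> R),
     (forall t, a <= t <= b -> is_derive u t (du t)) -> (forall t, a <= t <= b -> Rabs (du t) <= K) ->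
     Rabs (u b - u a) <= K * (b - a)).
  { intros u du Hdu HKu.
    destruct (MVT_gen u a b du) as [x [Hx E]];
      rewrite ?Rmin_left, ?Rmax_right in * by assumption.
    - intros t Ht; apply Hdu; lra.
    - intros t Ht. apply continuity_pt_filterlim.
      apply (ex_derive_continuous (V := R_NormedModule)). exists (du t); now apply Hdu.
    - rewrite E, Rabs_mult, (Rabs_right (b - a)) by lra.
      apply Rmult_le_compat_r; [lra | now apply HKu]. }
  eapply Rle_trans; [apply Cmod_le_Re_Im|].
  assert (A := M (fun t => Re (f t)) (fun t => Re (df t))
     (fun t Ht => proj1 (Hd t Ht)) (fun t Ht => Rle_trans _ _ _ (Re_le_Cmod _) (HK t Ht))).
  assert (B := M (fun t => Im (f t)) (fun t => Im (df t))
     (fun t Ht => proj2 (Hd t Ht)) (fun t Ht => Rle_trans _ _ _ (Im_le_Cmod _) (HK t Ht))).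
  unfold Cminus. unfold Re, Im in *; simpl in *. unfold Rminus in *. lra.
Qed.

Lemma Cmod_minus_sym (a b : C) : Cmod (Cminus a b) = Cmod (Cminus b a).
Proof. replace (Cminus a b) with (Copp (Cminus b a)) by ring. apply Cmod_opp. Qed.

Lemma Cmod_dist (a b c : C) : Cmod (Cminus a c) <= Cmod (Cminus a b) + Cmod (Cminus b c).
Proof.
  replace (Cminus a c) with (Cplus (Cminus a b) (Cminus b c)) by ring. apply Cmod_triangle.
Qed.

Lemma Cmod_le_dist (a b : C) : Cmod a <= Cmod (Cminus a b) + Cmod b.
Proof.
  replace a with (Cplus (Cminus a b) b) at 1 by ring. apply Cmod_triangle.
Qed.

Lemma Cminus_0_eq (a b : C) : Cminus a b = RtoC 0 -> a = b.
Proof.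
  intros H. transitivity (Cplus (Cminus a b) b); [ring|]. rewrite H. ring.
Qed.

Lemma C_eq_epsilon (a b : C) : (forall eps, 0 < eps -> Cmod (Cminus a b) <= eps) -> a = b.
Proof.
  intros H. apply Cminus_0_eq, Cmod_eq_0. apply Rle_antisym; [|apply Cmod_ge_0].
  apply le_epsilon. intros eps He. rewrite Rplus_0_l. now apply H.
Qed.

(** * Parametric and improper integrals *)

Lemma RInt_param_derive (DS DT : R -> Prop) (f fs : R -> R -> R) (a b : R) :
  open DS -> open DT -> a <= b -> (forall t, a <= t <= b -> DT t) ->
  (forall s t, DS s -> DT t -> is_derive (fun s => f s t) s (fs s t)) ->
  (forall s t, DS s -> DT t -> continuous (fun p : R * R => fs (fst p) (snd p)) (s, t)) ->
  (forall s t, DS s -> DT t -> continuous (f s) t) ->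
  forall s, DS s -> is_derive (fun s => RInt (f s) a b) s (RInt (fs s) a b).
Proof.
  intros oS oT Hab HT Hd Hc Hf s Hs.
  replace (RInt (fs s) a b) with (RInt (fun t => Derive (fun u => f u t) s) a b).
  2:{ apply (RInt_ext (V := R_CompleteNormedModule)). intros t Ht.
      rewrite Rmin_left, Rmax_right in Ht by assumption.
      apply is_derive_unique, Hd; [exact Hs | apply HT; lra]. }
  apply (is_derive_RInt_param f a b s); rewrite ?Rmin_left, ?Rmax_right by assumption.
  - apply (filter_imp DS); [|exact (oS s Hs)].
    intros u Hu t Ht. exists (fs u t). apply Hd; auto.
  - intros t Ht. apply continuity_2d_pt_ext_loc with fs.
    + assert (L : locally (s, t) (fun p : R * R => DS (fst p) /\ DT (snd p))).
      { destruct (oS s Hs) as [e1 H1]. destruct (oT t (HT t Ht)) as [e2 H2].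
        exists (mkposreal (Rmin e1 e2) (Rmin_stable_in_posreal e1 e2)).
        intros [u v] [Hu Hv]; simpl in *. split.
        - apply H1. eapply ball_le; [|exact Hu]. apply Rmin_l.
        - apply H2. eapply ball_le; [|exact Hv]. apply Rmin_r. }
      apply locally_2d_locally. revert L. apply filter_imp.
      intros [u v] [Hu Hv]; simpl in *. symmetry. apply is_derive_unique, Hd; assumption.
    + apply continuity_2d_pt_filterlim. apply (Hc s t Hs (HT t Ht)).
  - apply (filter_imp DS); [|exact (oS s Hs)].
    intros u Hu. apply (ex_RInt_continuous (V := R_CompleteNormedModule)).
    intros t Ht. rewrite Rmin_left, Rmax_right in Ht by assumption. apply Hf; auto.
Qed.

Lemma CRInt_param_derive (DS DT : R -> Prop) (f fs : R -> R -> C) (a b : R) :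
  open DS -> open DT -> a <= b -> (forall t, a <= t <= b -> DT t) ->
  (forall s t, DS s -> DT t -> Cderive (fun s => f s t) s (fs s t)) ->
  (forall s t, DS s -> DT t -> Ccont (fun p : R * R => fs (fst p) (snd p)) (s, t)) ->
  (forall s t, DS s -> DT t -> Ccont (f s) t) ->
  forall s, DS s -> Cderive (fun s => CRInt (f s) a b) s (CRInt (fs s) a b).
Proof.
  intros oS oT Hab HT Hd Hc Hf s Hs. split; simpl.
  - apply (RInt_param_derive DS DT (fun s t => Re (f s t)) (fun s t => Re (fs s t))); auto;
      intros u t Hu Ht; [apply (Hd u t Hu Ht) | apply (Hc u t Hu Ht) | apply (Hf u t Hu Ht)].
  - apply (RInt_param_derive DS DT (fun s t => Im (f s t)) (fun s t => Im (fs s t))); auto;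
      intros u t Hu Ht; [apply (Hd u t Hu Ht) | apply (Hc u t Hu Ht) | apply (Hf u t Hu Ht)].
Qed.

(** * Improper integrals dominated by the derivative of a function with limits at both ends *)

Section Improper.
Variables (Fa Fb : (R -> Prop) -> Prop).
Context {PFa : ProperFilter Fa} {PFb : ProperFilter Fb}.
Variables (D : R -> Prop) (f : R -> C) (Lam g : R -> R) (La Lb : R).
Hypothesis Dconv : forall x y t, D x -> D y -> Rmin x y <= t <= Rmax x y -> D t.
Hypothesis FaD : Fa D.
Hypothesis FbD : Fb D.
Hypothesis fcont : forall t, D t -> Ccont f t.
Hypothesis Lam_derive : forall t, D t -> is_derive Lam t (g t).
Hypothesis gcont : forall t, D t -> continuous g t.
Hypothesis f_le : forall t, D t -> Cmod (f t) <= g t.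
Hypothesis lim_a : filterlim Lam Fa (locally La).
Hypothesis lim_b : filterlim Lam Fb (locally Lb).

Lemma CRInt_dominated (x y : R) : D x -> D y -> Cmod (CRInt f x y) <= Rabs (Lam y - Lam x).
Proof.
  assert (A : forall x y, x <= y -> D x -> D y -> Cmod (CRInt f x y) <= Lam y - Lam x).
  { clear x y. intros x y Hxy Hx Hy.
    assert (DD : forall t, x <= t <= y -> D t).
    { intros t Ht. apply (Dconv x y); auto. rewrite Rmin_left, Rmax_right; assumption. }
    apply (CRInt_bound f g x y); auto.
    apply (is_RInt_derive (V := R_CompleteNormedModule) Lam g);
      intros t; rewrite Rmin_left, Rmax_right by assumption; auto. }
  intros Hx Hy. destruct (Rle_dec x y) as [H|H].
  - eapply Rle_trans; [now apply A | apply Rle_abs].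
  - replace (CRInt f x y) with (Copp (CRInt f y x)).
    + rewrite Cmod_opp, Rabs_minus_sym. eapply Rle_trans; [apply A; auto; lra | apply Rle_abs].
    + symmetry. apply is_RInt_CRInt_unique.
      apply (is_RInt_swap (V := C_R_NormedModule)), is_RInt_CRInt.
      intros t Ht. apply fcont. apply (Dconv y x); auto.
Qed.

Lemma CRInt_Chasles_on (x y z : R) : D x -> D y -> D z ->
  Cplus (CRInt f x y) (CRInt f y z) = CRInt f x z.
Proof.
  intros Hx Hy Hz. apply CRInt_Chasles; intros t Ht; apply fcont;
    [apply (Dconv x y) | apply (Dconv y z)]; auto.
Qed.

Lemma CRInt_cauchy (x y x' y' : R) : D x -> D y -> D x' -> D y' ->
  Cmod (Cminus (CRInt f x y) (CRInt f x' y')) <= Rabs (Lam x' - Lam x) + Rabs (Lam y' - Lam y).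
Proof.
  intros Hx Hy Hx' Hy'.
  replace (Cminus (CRInt f x y) (CRInt f x' y')) with (Cminus (CRInt f x x') (CRInt f y y')).
  - unfold Cminus. eapply Rle_trans; [apply Cmod_triangle|]. rewrite Cmod_opp.
    apply Rplus_le_compat; now apply CRInt_dominated.
  - rewrite <- (CRInt_Chasles_on x x' y), <- (CRInt_Chasles_on x' y y') by assumption.
    rewrite <- (CRInt_Chasles_on x' y' y) by assumption.
    rewrite <- (CRInt_Chasles_on x' y y') by assumption.
    ring_simplify.
    (* By Chasles this is the integral from [y] to [y], which is 0 because its modulus is bounded by
       the increment of [Lam] over a single point. *)
    assert (E : Cplus (CRInt f y y') (CRInt f y' y) = RtoC 0).
    { rewrite CRInt_Chasles_on by assumption.
      pose proof (CRInt_dominated y y Hy Hy) as B.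
      rewrite Rminus_diag, Rabs_R0 in B. apply Cmod_eq_0. pose proof (Cmod_ge_0 (CRInt f y y)). lra. }
    replace (CRInt f y' y) with (Copp (CRInt f y y')); [ring|].
    replace (Copp (CRInt f y y')) with (Cminus (RtoC 0) (CRInt f y y')) by ring.
    rewrite <- E. ring.
Qed.

Lemma lim_close (L : R) (F : (R -> Prop) -> Prop) (PF : Filter F) (eps : posreal) :
  F D -> filterlim Lam F (locally L) -> F (fun x => D x /\ Rabs (Lam x - L) < eps).
Proof.
  intros FD H. apply filter_and; [exact FD|].
  apply (H (fun v => Rabs (v - L) < eps)). exists eps. intros v Hv; exact Hv.
Qed.

(** Moving the end points changes the integral by at most the increments of [Lam], and [Lam] has
    limits at both ends, so the Cauchy criterion applies. The second conclusion is the limit of that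
    same estimate; it is the truncation error on which all later passages to the limit rest. *)
Lemma improper_exists :
  exists l : C, is_RInt_gen (V := C_R_NormedModule) f Fa Fb l /\
    forall x y, D x -> D y ->
      Cmod (Cminus (CRInt f x y) l) <= Rabs (Lam x - La) + Rabs (Lam y - Lb).
Proof.
  set (F := filter_prod Fa Fb).
  assert (PF : ProperFilter F) by (apply filter_prod_proper).
  assert (near : forall eps : posreal, exists P, F P /\ (forall p, P p ->
      D (fst p) /\ D (snd p) /\ Rabs (Lam (fst p) - La) < eps /\ Rabs (Lam (snd p) - Lb) < eps)).
  { intros eps.
    exists (fun p => (D (fst p) /\ Rabs (Lam (fst p) - La) < eps) /\
                     (D (snd p) /\ Rabs (Lam (snd p) - Lb) < eps)). split; [|tauto].
    apply (Filter_prod Fa Fb _ (fun x => D x /\ Rabs (Lam x - La) < eps)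
                        (fun x => D x /\ Rabs (Lam x - Lb) < eps)).
    - apply lim_close; auto; typeclasses eauto.
    - apply lim_close; auto; typeclasses eauto.
    - simpl; tauto. }
  assert (cau : forall eps : posreal, exists P, F P /\ forall u v, P u -> P v ->
     Cmod (Cminus (CRInt f (fst u) (snd u)) (CRInt f (fst v) (snd v))) < eps).
  { intros eps. assert (He : 0 < eps / 4) by (destruct eps; simpl; lra).
    destruct (near (mkposreal _ He)) as [P [FP HP]]. exists P. split; [exact FP|].
    intros u v Hu Hv. apply HP in Hu. apply HP in Hv. simpl in Hu, Hv.
    destruct Hu as [U1 [U2 [U3 U4]]]. destruct Hv as [V1 [V2 [V3 V4]]].
    eapply Rle_lt_trans; [apply CRInt_cauchy; assumption|].
    pose proof (Rabs_triang (Lam (fst v) - La) (- (Lam (fst u) - La))) as T1.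
    pose proof (Rabs_triang (Lam (snd v) - Lb) (- (Lam (snd u) - Lb))) as T2.
    rewrite Rabs_Ropp in T1, T2.
    replace (Lam (fst v) - La + - (Lam (fst u) - La)) with (Lam (fst v) - Lam (fst u)) in T1 by ring.
    replace (Lam (snd v) - Lb + - (Lam (snd u) - Lb)) with (Lam (snd v) - Lam (snd u)) in T2 by ring.
    lra. }
  (* [h] stands for [Re] and [Im]: the Cauchy property in modulus passes to every real function that
     is 1-Lipschitz. *)
  assert (lim : forall h : C -> R, (forall z z', Rabs (h z - h z') <= Cmod (Cminus z z')) ->
     exists l : R, filterlim (fun p : R * R => h (CRInt f (fst p) (snd p))) F (locally l)).
  { intros h Hh. apply (filterlim_locally_cauchy (U := R_CompleteSpace)).
    intros eps. destruct (cau eps) as [P [FP HP]]. exists P. split; [exact FP|].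
    intros u v Hu Hv. unfold ball; simpl; unfold AbsRing_ball, abs, minus, plus, opp; simpl.
    eapply Rle_lt_trans; [|apply (HP v u Hv Hu)].
    apply Hh. }
  destruct (lim Re) as [l1 H1].
  { intros z z'. apply (Re_le_Cmod (Cminus z z')). }
  destruct (lim Im) as [l2 H2].
  { intros z z'. apply (Im_le_Cmod (Cminus z z')). }
  assert (cl : forall eps : posreal, F (fun p =>
     Rabs (Re (CRInt f (fst p) (snd p)) - l1) < eps /\ Rabs (Im (CRInt f (fst p) (snd p)) - l2) < eps)).
  { intros eps. apply filter_and.
    - apply (H1 (fun v => Rabs (v - l1) < eps)). exists eps. intros v Hv; exact Hv.
    - apply (H2 (fun v => Rabs (v - l2) < eps)). exists eps. intros v Hv; exact Hv. }
  exists (l1, l2). split.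
  - intros P [eps HP]. unfold filtermapi.
    destruct (near eps) as [Q [FQ HQ]].
    generalize (filter_and _ _ FQ (cl eps)). apply filter_imp.
    intros [x y] [Hq [C1 C2]]. apply HQ in Hq; simpl in *. exists (CRInt f x y). split.
    + apply is_RInt_CRInt. intros t Ht. apply fcont. apply (Dconv x y); tauto.
    + apply HP. split; assumption.
  - intros x y Hx Hy. apply le_epsilon. intros eps Heps.
    assert (He : 0 < eps / 4) by lra.
    destruct (near (mkposreal _ He)) as [Q [FQ HQ]].
    destruct (filter_ex _ (filter_and _ _ FQ (cl (mkposreal _ He)))) as [[x' y'] [Hq [C1 C2]]].
    apply HQ in Hq; simpl in *. destruct Hq as [X1 [X2 [X3 X4]]].
    pose proof (CRInt_cauchy x y x' y' Hx Hy X1 X2) as B.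
    pose proof (Cmod_triangle (Cminus (CRInt f x y) (CRInt f x' y')) (Cminus (CRInt f x' y') (l1, l2))) as T.
    replace (Cplus (Cminus (CRInt f x y) (CRInt f x' y')) (Cminus (CRInt f x' y') (l1, l2)))
      with (Cminus (CRInt f x y) (l1, l2)) in T by ring.
    pose proof (Cmod_le_Re_Im (Cminus (CRInt f x' y') (l1, l2))) as M.
    change (Re (Cminus (CRInt f x' y') (l1, l2))) with (RInt (fun t => Re (f t)) x' y' - l1) in M.
    change (Im (Cminus (CRInt f x' y') (l1, l2))) with (RInt (fun t => Im (f t)) x' y' - l2) in M.
    pose proof (Rabs_triang (Lam x' - La) (- (Lam x - La))) as T1.
    pose proof (Rabs_triang (Lam y' - Lb) (- (Lam y - Lb))) as T2.
    rewrite Rabs_Ropp in T1, T2.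
    replace (Lam x' - La + - (Lam x - La)) with (Lam x' - Lam x) in T1 by ring.
    replace (Lam y' - Lb + - (Lam y - Lb)) with (Lam y' - Lam y) in T2 by ring.
    simpl in C1, C2.
    lra.
Qed.
End Improper.

(** * The Beta kernel *)

Lemma ln_le_sub_1 (x : R) : 0 < x -> ln x <= x - 1.
Proof.
  intros H. pose proof (exp_ineq1_le (ln x)) as E. rewrite exp_ln in E by assumption. lra.
Qed.

Lemma Rpower_at_0 (p : R) : 0 < p -> filterlim (fun t => Rpower t p) (at_right 0) (locally 0).
Proof.
  intros Hp P [eps HP].
  assert (Hd : 0 < Rpower eps (/ p)) by apply exp_pos.
  exists (mkposreal _ Hd). intros t Ht H0.
  unfold ball in Ht; simpl in Ht; unfold AbsRing_ball, abs, minus, plus, opp in Ht; simpl in Ht.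
  rewrite Rabs_right in Ht by lra.
  apply HP. unfold ball; simpl; unfold AbsRing_ball, abs, minus, plus, opp; simpl.
  rewrite Rabs_right; [|apply Rle_ge; rewrite Ropp_0, Rplus_0_r; left; apply exp_pos].
  replace (pos eps) with (Rpower (Rpower eps (/ p)) p).
  - rewrite Ropp_0, Rplus_0_r. apply Rlt_Rpower_l; [exact Hp | lra].
  - rewrite Rpower_mult. replace (/ p * p) with 1 by (field; lra). apply Rpower_1. apply cond_pos.
Qed.

Lemma Rpower_derive (p t : R) : 0 < t -> is_derive (fun u => Rpower u p) t (p * Rpower t (p - 1)).
Proof. intros H. apply is_derive_Reals. apply derivable_pt_lim_power, H. Qed.

Lemma Rpower_continuous (p t : R) : 0 < t -> continuous (fun u => Rpower u p) t.
Proof.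
  intros H. apply (ex_derive_continuous (V := R_NormedModule)). eexists. apply Rpower_derive, H.
Qed.

Lemma continuous_one_minus (t : R) : continuous (fun u : R => 1 - u) t.
Proof. apply (ex_derive_continuous (V := R_NormedModule)). auto_derive; auto. Qed.

(** A power is monotone in its base, so its maximum on [1/2, 1] is one of the values at the ends;
    the sum of both covers either sign of [r]. *)
Lemma Rpower_half_le (u r : R) : / 2 <= u <= 1 -> Rpower u r <= 1 + Rpower (/ 2) r.
Proof.
  intros H.
  assert (L1 : ln u <= 0) by (rewrite <- ln_1; apply ln_le; lra).
  assert (L2 : ln (/ 2) <= ln u) by (apply ln_le; lra).
  pose proof (exp_pos (r * ln (/ 2))). unfold Rpower.
  destruct (Rle_dec 0 r) as [Hr|Hr].
  - assert (exp (r * ln u) <= exp 0).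
    { destruct (Req_dec (r * ln u) 0) as [->|]; [lra|]. left; apply exp_increasing. nra. }
    rewrite exp_0 in *. lra.
  - assert (exp (r * ln u) <= exp (r * ln (/ 2))); [|lra].
    destruct (Req_dec (r * ln u) (r * ln (/ 2))) as [->|]; [lra|]. left; apply exp_increasing. nra.
Qed.

Definition beta_kernel (al be : C) (t : R) : C :=
  Cmult (cpow t (Cminus al (RtoC 1))) (cpow (1 - t) (Cminus be (RtoC 1))).

Lemma Cmod_cpow_minus_1 (t : R) (z : C) : Cmod (cpow t (Cminus z (RtoC 1))) = Rpower t (Re z - 1).
Proof. rewrite Cmod_cpow. reflexivity. Qed.

Lemma beta_kernel_cont (al be : C) (t : R) : 0 < t < 1 -> Ccont (beta_kernel al be) t.
Proof.
  intros H. unfold beta_kernel. apply (Ccont_mult (fun t => cpow t _) (fun t => cpow (1 - t) _)).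
  - apply (cpow_cont (fun t => t)); [apply continuous_id | lra].
  - apply (cpow_cont (fun t => 1 - t)); [apply continuous_one_minus | lra].
Qed.

(** On each half of (0, 1) one of the two powers in the kernel stays bounded. This constant serves
    both halves, and the kernel is dominated by a sum of two pure powers, which has the elementary
    primitive [beta_prim]. *)
Definition beta_bound (p q : R) : R := 1 + Rpower (/ 2) (p - 1) + Rpower (/ 2) (q - 1).

Lemma beta_bound_pos (p q : R) : 0 < beta_bound p q.
Proof. unfold beta_bound. pose proof (exp_pos ((p-1) * ln (/2))). pose proof (exp_pos ((q-1) * ln (/2))). unfold Rpower; lra. Qed.

Lemma beta_kernel_bound (al be : C) (t : R) : 0 < t < 1 ->
  Cmod (beta_kernel al be t) <=
  beta_bound (Re al) (Re be) * (Rpower t (Re al - 1) + Rpower (1 - t) (Re be - 1)).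
Proof.
  intros H. unfold beta_kernel, beta_bound. rewrite Cmod_mult, !Cmod_cpow_minus_1.
  set (p := Re al); set (q := Re be).
  pose proof (exp_pos ((p - 1) * ln t)). pose proof (exp_pos ((q - 1) * ln (1 - t))).
  pose proof (exp_pos ((p - 1) * ln (/ 2))). pose proof (exp_pos ((q - 1) * ln (/ 2))).
  destruct (Rle_dec t (/ 2)) as [L|L].
  - pose proof (Rpower_half_le (1 - t) (q - 1)). unfold Rpower in *. nra.
  - pose proof (Rpower_half_le t (p - 1)). unfold Rpower in *. nra.
Qed.

Definition beta_prim (p q t : R) : R := beta_bound p q * (Rpower t p / p - Rpower (1 - t) q / q).

Lemma beta_prim_derive (p q t : R) : 0 < p -> 0 < q -> 0 < t < 1 ->
  is_derive (beta_prim p q) t (beta_bound p q * (Rpower t (p - 1) + Rpower (1 - t) (q - 1))).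
Proof.
  intros Hp Hq Ht. unfold beta_prim.
  apply (is_derive_scal (fun t => Rpower t p / p - Rpower (1 - t) q / q)).
  replace (Rpower t (p - 1) + Rpower (1 - t) (q - 1)) with
    (/ p * (p * Rpower t (p - 1)) - / q * (-1 * (q * Rpower (1 - t) (q - 1)))) by (field; lra).
  apply (is_derive_minus (V := R_NormedModule) (fun t => Rpower t p / p) (fun t => Rpower (1 - t) q / q)).
  - apply (is_derive_ext (fun t => / p * Rpower t p)); [intros; apply Rmult_comm|].
    apply is_derive_scal, Rpower_derive; lra.
  - apply (is_derive_ext (fun t => / q * Rpower (1 - t) q)); [intros; apply Rmult_comm|].
    apply (is_derive_scal (fun t => Rpower (1 - t) q)).
    apply (is_derive_comp (fun u => Rpower u q) (fun t => 1 - t)); [apply Rpower_derive; lra|].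
    auto_derive; [auto | ring].
Qed.

Lemma one_minus_at_right_0 : filterlim (fun t => 1 - t) (at_right 0) (at_left 1).
Proof.
  intros P [eps HP]. exists eps. intros t Ht H0. apply HP; [|lra].
  change (Rabs (t - 0) < eps) in Ht. change (Rabs (1 - t - 1) < eps).
  replace (1 - t - 1) with (- (t - 0)) by ring. now rewrite Rabs_Ropp.
Qed.

Lemma one_minus_at_left_1 : filterlim (fun t => 1 - t) (at_left 1) (at_right 0).
Proof.
  intros P [eps HP]. exists eps. intros t Ht H0. apply HP; [|lra].
  change (Rabs (t - 1) < eps) in Ht. change (Rabs (1 - t - 0) < eps).
  replace (1 - t - 0) with (- (t - 1)) by ring. now rewrite Rabs_Ropp.
Qed.

Lemma Rpower_one_minus_at_right_0 (q : R) : filterlim (fun t => Rpower (1 - t) q) (at_right 0) (locally 1).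
Proof.
  assert (H : continuous (fun t => Rpower (1 - t) q) 0).
  { apply (continuous_comp (fun t => 1 - t) (fun u => Rpower u q)); [apply continuous_one_minus|].
    apply Rpower_continuous. lra. }
  unfold continuous in H. rewrite Rminus_0_r in H. unfold Rpower at 2 in H.
  rewrite ln_1, Rmult_0_r, exp_0 in H.
  intros P HP. destruct (H P HP) as [e He]. exists e. intros t Ht _. apply He, Ht.
Qed.

Lemma beta_prim_at_0 (p q : R) : 0 < p ->
  filterlim (beta_prim p q) (at_right 0) (locally (beta_bound p q * (0 / p - 1 / q))).
Proof.
  intros Hp. unfold beta_prim.
  apply (filterlim_comp _ _ _ (fun t => Rpower t p / p - Rpower (1 - t) q / q) (fun u => beta_bound p q * u)
           _ (locally (0 / p - 1 / q))).
  - apply (filterlim_comp_2 (F := at_right 0) (G := locally (0 / p)) (H := locally (- (1 / q)))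
             (fun t => Rpower t p / p) (fun t => - (Rpower (1 - t) q / q)) Rplus).
    + apply (filterlim_comp _ _ _ (fun t => Rpower t p) (fun u => u / p) _ (locally 0)).
      * now apply Rpower_at_0.
      * apply (rcont_mult (fun u : R => u) (fun _ => / p)); [apply continuous_id | apply continuous_const].
    + apply (filterlim_comp _ _ _ (fun t => Rpower (1 - t) q) (fun u => - (u / q)) _ (locally 1)).
      * apply Rpower_one_minus_at_right_0.
      * apply (continuous_opp (V := R_NormedModule) (fun u : R => u / q)).
        apply (rcont_mult (fun u : R => u) (fun _ => / q)); [apply continuous_id | apply continuous_const].
    + apply (filterlim_plus (V := R_NormedModule)).
  - apply (rcont_mult (fun _ => beta_bound p q) (fun u : R => u)); [apply continuous_const | apply continuous_id].
Qed.

(** The reflection of (0, 1) exchanges the exponents; it reduces the limit at 1 to the limit at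
    0. *)
Lemma beta_prim_sym (p q t : R) : beta_prim p q (1 - t) = - beta_prim q p t.
Proof. unfold beta_prim, beta_bound. replace (1 - (1 - t)) with t by ring. ring. Qed.

Lemma beta_prim_at_1 (p q : R) : 0 < q ->
  filterlim (beta_prim p q) (at_left 1) (locally (beta_bound p q * (1 / p - 0 / q))).
Proof.
  intros Hq.
  apply (filterlim_ext (fun t => - beta_prim q p (1 - t))).
  { intros t. rewrite beta_prim_sym. ring. }
  apply (filterlim_comp _ _ _ (fun t => 1 - t) (fun u => - beta_prim q p u) _ (at_right 0)).
  { apply one_minus_at_left_1. }
  replace (beta_bound p q * (1 / p - 0 / q)) with (- (beta_bound q p * (0 / q - 1 / p)))
    by (unfold beta_bound; ring).
  apply (filterlim_comp _ _ _ (beta_prim q p) (fun u => - u) _ (locally (beta_bound q p * (0 / q - 1 / p)))).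
  - now apply beta_prim_at_0.
  - apply (continuous_opp (V := R_NormedModule) (fun u : R => u)), continuous_id.
Qed.

Lemma beta_prim_range (p q t : R) : 0 < p -> 0 < q -> 0 < t < 1 ->
  - (beta_bound p q / q) <= beta_prim p q t <= beta_bound p q / p.
Proof.
  intros Hp Hq Ht. unfold beta_prim. pose proof (beta_bound_pos p q) as HB.
  assert (A : forall u r, 0 < u < 1 -> 0 < r -> 0 < Rpower u r / r <= / r).
  { intros u r Hu Hr. pose proof (exp_pos (r * ln u)). pose proof (Rinv_0_lt_compat r Hr).
    assert (Rpower u r <= 1).
    { rewrite <- (Rpower_O u) by lra. unfold Rpower. left. apply exp_increasing.
      assert (ln u < 0) by (rewrite <- ln_1; apply ln_increasing; lra). nra. }
    unfold Rpower, Rdiv in *. split; nra. }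
  pose proof (A t p Ht Hp). pose proof (A (1 - t) q ltac:(lra) Hq). unfold Rdiv in *. split; nra.
Qed.

(** The distance of the primitive from its limits at the two cuts: the error of truncating (0, 1) to
    [d, 1 - d] for a regular factor bounded by 1. It depends on nothing but the exponents and
    [d]. *)
Definition beta_tail (p q d : R) : R :=
  Rabs (beta_prim p q d - beta_bound p q * (0 / p - 1 / q)) +
  Rabs (beta_prim p q (1 - d) - beta_bound p q * (1 / p - 0 / q)).

Lemma beta_tail_pos (p q d : R) : 0 <= beta_tail p q d.
Proof. unfold beta_tail. apply Rplus_le_le_0_compat; apply Rabs_pos. Qed.

Lemma filterlim_Rabs_0 (F : (R -> Prop) -> Prop) (PF : Filter F) (f : R -> R) (l : R) :
  filterlim f F (locally l) -> filterlim (fun t => Rabs (f t - l)) F (locally 0).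
Proof.
  intros H P [eps HP]. unfold filtermap.
  apply (filter_imp (fun t => ball l eps (f t))); [|exact (H _ (locally_ball l eps))].
  intros t Ht. apply HP. change (Rabs (f t - l) < eps) in Ht. change (Rabs (Rabs (f t - l) - 0) < eps).
  rewrite Rminus_0_r, Rabs_Rabsolu. exact Ht.
Qed.

Lemma beta_tail_lim (p q : R) : 0 < p -> 0 < q -> filterlim (beta_tail p q) (at_right 0) (locally 0).
Proof.
  intros Hp Hq. unfold beta_tail.
  apply (filterlim_comp_2 (F := at_right 0) (G := locally 0) (H := locally 0) _ _ Rplus).
  - apply filterlim_Rabs_0; [typeclasses eauto | now apply beta_prim_at_0].
  - apply (filterlim_comp _ _ _ (fun d => 1 - d) (fun d => Rabs (beta_prim p q d - beta_bound p q * (1 / p - 0 / q))) _ (at_left 1)).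
    + apply one_minus_at_right_0.
    + apply filterlim_Rabs_0; [typeclasses eauto | now apply beta_prim_at_1].
  - pose proof (filterlim_plus (V := R_NormedModule) 0 0) as H.
    change (plus 0 0) with (0 + 0) in H. rewrite Rplus_0_l in H. exact H.
Qed.

Lemma beta_dom_cont (p q M t : R) : 0 < t < 1 ->
  continuous (fun t => M * (beta_bound p q * (Rpower t (p - 1) + Rpower (1 - t) (q - 1)))) t.
Proof.
  intros Ht. apply (rcont_mult (fun _ => M)); [apply continuous_const|].
  apply (rcont_mult (fun _ => beta_bound p q)); [apply continuous_const|].
  apply (rcont_plus (fun t => Rpower t (p - 1)) (fun t => Rpower (1 - t) (q - 1))).
  - apply Rpower_continuous; lra.
  - apply (continuous_comp (fun t => 1 - t) (fun u => Rpower u (q - 1))); [apply continuous_one_minus|].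
    apply Rpower_continuous; lra.
Qed.

Section BetaImproper.
Variables (al be : C) (Q : R -> C) (M : R).
Hypothesis Hal : 0 < Re al.
Hypothesis Hbe : 0 < Re be.
Hypothesis Qcont : forall t, 0 < t < 1 -> Ccont Q t.
Hypothesis Qbound : forall t, 0 < t < 1 -> Cmod (Q t) <= M.

Let p := Re al.
Let q := Re be.
Let D (t : R) := 0 < t < 1.
Let f (t : R) := Cmult (beta_kernel al be t) (Q t).
Let Lam (t : R) := M * beta_prim p q t.
Let g (t : R) := M * (beta_bound p q * (Rpower t (p - 1) + Rpower (1 - t) (q - 1))).

Lemma beta_M_pos : 0 <= M.
Proof. eapply Rle_trans; [apply Cmod_ge_0 | apply (Qbound (/ 2)); lra]. Qed.

Let Dconv : forall x y t, D x -> D y -> Rmin x y <= t <= Rmax x y -> D t.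
Proof.
  unfold D; intros x y t Hx Hy Ht. pose proof (Rmin_case x y (fun m => 0 < m)).
  pose proof (Rmax_case x y (fun m => m < 1)). lra.
Qed.

Let fcont : forall t, D t -> Ccont f t.
Proof. intros t Ht. apply (Ccont_mult (beta_kernel al be) Q); [now apply beta_kernel_cont | now apply Qcont]. Qed.

Let Lam_derive : forall t, D t -> is_derive Lam t (g t).
Proof. intros t Ht. apply is_derive_scal, beta_prim_derive; assumption. Qed.

Let gcont : forall t, D t -> continuous g t.
Proof. intros t Ht. now apply beta_dom_cont. Qed.

Let f_le : forall t, D t -> Cmod (f t) <= g t.
Proof.
  intros t Ht. unfold f, g. rewrite Cmod_mult.
  pose proof (beta_kernel_bound al be t Ht). pose proof (Qbound t Ht).
  pose proof (Cmod_ge_0 (beta_kernel al be t)). pose proof (Cmod_ge_0 (Q t)).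
  unfold p, q. nra.
Qed.

(** Every integral over (0, 1) in the proof has this form, the Beta integral itself with [Q] = 1.
    The error involves [Q] through its bound [M] only, so it is uniform in any parameter hidden in
    [Q]. *)
Lemma beta_improper : exists l : C,
  is_RInt_gen (V := C_R_NormedModule) f (at_right 0) (at_left 1) l /\
  forall d, 0 < d < 1 -> Cmod (Cminus (CRInt f d (1 - d)) l) <= M * beta_tail p q d.
Proof.
  assert (scal_lim : forall (F : (R -> Prop) -> Prop) l, filterlim (beta_prim p q) F (locally l) ->
    filterlim Lam F (locally (M * l))).
  { intros F l H. apply (filterlim_comp _ _ _ (beta_prim p q) (fun u => M * u) _ (locally l)); [exact H|].
    apply (rcont_mult (fun _ => M) (fun u : R => u)); [apply continuous_const | apply continuous_id]. }
  destruct (improper_exists (at_right 0) (at_left 1) D f Lam g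
    (M * (beta_bound p q * (0 / p - 1 / q))) (M * (beta_bound p q * (1 / p - 0 / q)))
    Dconv) as [l [H1 H2]]; auto.
  - exists (mkposreal 1 Rlt_0_1). intros t Ht H0.
    unfold ball in Ht; simpl in Ht; unfold AbsRing_ball, abs, minus, plus, opp in Ht; simpl in Ht.
    apply Rabs_def2 in Ht. unfold D; lra.
  - exists (mkposreal 1 Rlt_0_1). intros t Ht H0.
    unfold ball in Ht; simpl in Ht; unfold AbsRing_ball, abs, minus, plus, opp in Ht; simpl in Ht.
    apply Rabs_def2 in Ht. unfold D; lra.
  - apply scal_lim, beta_prim_at_0; assumption.
  - apply scal_lim, beta_prim_at_1; assumption.
  - exists l. split; [exact H1|]. intros d Hd.
    eapply Rle_trans; [apply H2; unfold D; lra|].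
    unfold Lam, beta_tail. rewrite <- !Rmult_minus_distr_l, !Rabs_mult, (Rabs_right M) by (apply Rle_ge, beta_M_pos).
    lra.
Qed.

End BetaImproper.

(** The factor after [M] bounds the total increase of [beta_prim] over (0, 1), the mass of the
    majorant; hence the estimate is uniform in [d]. *)
Lemma beta_CRInt_bound (al be : C) (Q : R -> C) (M d : R) :
  0 < Re al -> 0 < Re be -> 0 < d <= / 2 ->
  (forall t, d <= t <= 1 - d -> Ccont Q t) ->
  (forall t, d <= t <= 1 - d -> Cmod (Q t) <= M) ->
  Cmod (CRInt (fun t => Cmult (beta_kernel al be t) (Q t)) d (1 - d)) <=
  M * (beta_bound (Re al) (Re be) * (/ Re al + / Re be)).
Proof.
  intros Hal Hbe Hd Qc Qb. set (p := Re al) in *; set (q := Re be) in *.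
  assert (HM : 0 <= M) by (eapply Rle_trans; [apply Cmod_ge_0 | apply (Qb d); lra]).
  set (g := fun t => M * (beta_bound p q * (Rpower t (p - 1) + Rpower (1 - t) (q - 1)))).
  apply Rle_trans with (M * beta_prim p q (1 - d) - M * beta_prim p q d).
  - apply (CRInt_bound _ g); [lra | | |].
    + intros t Ht. apply (Ccont_mult (beta_kernel al be) Q); [apply beta_kernel_cont; lra | now apply Qc].
    + intros t Ht. unfold g. rewrite Cmod_mult.
      pose proof (beta_kernel_bound al be t ltac:(lra)). pose proof (Qb t Ht).
      pose proof (Cmod_ge_0 (beta_kernel al be t)). pose proof (Cmod_ge_0 (Q t)).
      unfold p, q. nra.
    + apply (is_RInt_derive (V := R_CompleteNormedModule) (fun t => M * beta_prim p q t) g);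
        rewrite Rmin_left, Rmax_right by lra; intros t Ht.
      * apply is_derive_scal, beta_prim_derive; try assumption; lra.
      * apply beta_dom_cont; lra.
  - rewrite <- Rmult_minus_distr_l. apply Rmult_le_compat_l; [exact HM|].
    pose proof (beta_prim_range p q d Hal Hbe ltac:(lra)).
    pose proof (beta_prim_range p q (1 - d) Hal Hbe ltac:(lra)).
    unfold Rdiv in *. lra.
Qed.

Lemma beta_tail_small (p q eps : R) : 0 < p -> 0 < q -> 0 < eps ->
  exists d, 0 < d <= / 2 /\ forall x, 0 < x <= d -> beta_tail p q x < eps.
Proof.
  intros Hp Hq He.
  destruct (beta_tail_lim p q Hp Hq _ (locally_ball 0 (mkposreal _ He))) as [d Hd].
  exists (Rmin (d / 2) (/ 2)). pose proof (cond_pos d). split.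
  - split; [apply Rmin_glb_lt; lra | apply Rmin_r].
  - intros x Hx. pose proof (Rmin_l (d / 2) (/ 2)).
    assert (B : ball 0 (mkposreal _ He) (beta_tail p q x)).
    { apply Hd; [|lra]. change (Rabs (x - 0) < d). rewrite Rabs_right; lra. }
    change (Rabs (beta_tail p q x - 0) < eps) in B. rewrite Rminus_0_r in B.
    pose proof (Rle_abs (beta_tail p q x)). lra.
Qed.

(** * The Gamma integral *)

Definition gamma_kernel (z : C) (t : R) : C :=
  Cmult (cpow t (Cminus z (RtoC 1))) (RtoC (exp (- t))).

(** The maximum (p + 1)^(p + 1) e^(-p) of (1 + t)^(p + 1) e^(-t), attained at t = p. This is the
    constant by which [gamma_dom] dominates t^(p - 1) e^(-t). *)
Definition gamma_bound (p : R) : R := exp ((p + 1) * ln (p + 1) - p).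
(** The substitution t / (1 + t) maps the half line onto (0, 1) with derivative (1 + t)^(-2), so one
    elementary primitive controls the integral at 0 and at infinity. *)
Definition gamma_prim (p t : R) : R := gamma_bound p / p * Rpower (t / (1 + t)) p.
Definition gamma_dom (p t : R) : R := gamma_bound p * (Rpower (t / (1 + t)) (p - 1) * / (1 + t) ^ 2).

Lemma gamma_kernel_cont (z : C) (t : R) : 0 < t -> Ccont (gamma_kernel z) t.
Proof.
  intros H. apply (Ccont_mult (fun t => cpow t _) (fun t => RtoC (exp (- t)))).
  - apply (cpow_cont (fun t => t)); [apply continuous_id | exact H].
  - apply Ccont_RtoC. apply (ex_derive_continuous (V := R_NormedModule)). auto_derive; auto.
Qed.

Lemma Cmod_gamma_kernel (z : C) (t : R) : Cmod (gamma_kernel z t) = Rpower t (Re z - 1) * exp (- t).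
Proof.
  unfold gamma_kernel. rewrite Cmod_mult, Cmod_cpow_minus_1, Cmod_R, Rabs_right; [reflexivity|].
  apply Rle_ge; left; apply exp_pos.
Qed.

Lemma div_succ_pos (t : R) : 0 < t -> 0 < t / (1 + t) < 1.
Proof.
  intros H. assert (0 < / (1 + t)) by (apply Rinv_0_lt_compat; lra).
  assert ((1 + t) * / (1 + t) = 1) by (field; lra). unfold Rdiv. split; nra.
Qed.

Lemma gamma_prim_derive (p t : R) : 0 < p -> 0 < t -> is_derive (gamma_prim p) t (gamma_dom p t).
Proof.
  intros Hp Ht. unfold gamma_prim, gamma_dom.
  replace (gamma_bound p * (Rpower (t / (1 + t)) (p - 1) * / (1 + t) ^ 2)) with
    (gamma_bound p / p * (/ (1 + t) ^ 2 * (p * Rpower (t / (1 + t)) (p - 1)))) by (field; lra).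
  apply (is_derive_scal (fun t => Rpower (t / (1 + t)) p)).
  apply (is_derive_comp (fun u => Rpower u p) (fun t => t / (1 + t))).
  - apply Rpower_derive. apply div_succ_pos, Ht.
  - auto_derive; [lra | field; lra].
Qed.

Lemma gamma_dom_cont (p t : R) : 0 < t -> continuous (gamma_dom p) t.
Proof.
  intros Ht. unfold gamma_dom.
  apply (rcont_mult (fun _ => gamma_bound p)); [apply continuous_const|].
  apply (rcont_mult (fun t => Rpower (t / (1 + t)) (p - 1)) (fun t => / (1 + t) ^ 2)).
  - apply (continuous_comp (fun t => t / (1 + t)) (fun u => Rpower u (p - 1))).
    + apply (ex_derive_continuous (V := R_NormedModule)). auto_derive; lra.
    + apply Rpower_continuous, div_succ_pos, Ht.
  - apply (ex_derive_continuous (V := R_NormedModule)). auto_derive; nra.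
Qed.

Lemma gamma_kernel_le (z : C) (t : R) : 0 < Re z -> 0 < t -> Cmod (gamma_kernel z t) <= gamma_dom (Re z) t.
Proof.
  intros Hp Ht. rewrite Cmod_gamma_kernel. set (p := Re z) in *. unfold gamma_dom, gamma_bound, Rpower.
  replace (/ (1 + t) ^ 2) with (exp (- (2 * ln (1 + t)))).
  2:{ rewrite exp_Ropp. f_equal. replace (2 * ln (1 + t)) with (ln (1 + t) + ln (1 + t)) by ring.
      rewrite exp_plus, exp_ln by lra. ring. }
  rewrite <- !exp_plus. rewrite ln_div by lra.
  (* The logarithm lies below its tangent at p + 1, the point where (1 + t)^(p + 1) e^(-t) is
     largest. *)
  assert (E : ln (1 + t) <= (1 + t) / (p + 1) - 1 + ln (p + 1)).
  { pose proof (ln_le_sub_1 ((1 + t) / (p + 1))) as L. rewrite ln_div in L by lra.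
    assert (0 < (1 + t) / (p + 1)) by (apply Rdiv_lt_0_compat; lra). lra. }
  assert (E2 : (p + 1) * ln (1 + t) <= 1 + t - (p + 1) + (p + 1) * ln (p + 1)).
  { replace (1 + t - (p + 1) + (p + 1) * ln (p + 1)) with ((p + 1) * ((1 + t) / (p + 1) - 1 + ln (p + 1))) by (field; lra).
    apply Rmult_le_compat_l; lra. }
  match goal with |- exp ?a <= exp ?b => assert (L : a <= b) by lra;
    destruct L as [L | ->]; [left; now apply exp_increasing | right; reflexivity] end.
Qed.

Lemma gamma_prim_at_0 (p : R) : 0 < p -> filterlim (gamma_prim p) (at_right 0) (locally 0).
Proof.
  intros Hp. unfold gamma_prim.
  apply (filterlim_comp _ _ _ (fun t => Rpower (t / (1 + t)) p) (fun u => gamma_bound p / p * u) _ (locally 0)).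
  - apply (filterlim_comp _ _ _ (fun t => t / (1 + t)) (fun u => Rpower u p) _ (at_right 0)); [|now apply Rpower_at_0].
    intros P [eps HP]. exists eps. intros t Ht H0.
    pose proof (div_succ_pos t H0) as B. apply HP; [|apply B].
    change (Rabs (t - 0) < eps) in Ht. change (Rabs (t / (1 + t) - 0) < eps).
    rewrite Rminus_0_r in *. rewrite Rabs_right in * by lra.
    apply Rle_lt_trans with t; [|exact Ht].
    apply Rmult_le_reg_r with (1 + t); [lra|]. unfold Rdiv. rewrite Rmult_assoc, Rinv_l by lra. nra.
  - pose proof (rcont_mult (fun _ => gamma_bound p / p) (fun u : R => u) 0) as H.
    unfold continuous in H. change (mult (gamma_bound p / p) 0) with (gamma_bound p / p * 0) in H.
    rewrite Rmult_0_r in H. apply H; [apply continuous_const | apply continuous_id].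
Qed.

Lemma div_succ_lim : filterlim (fun t => t / (1 + t)) (Rbar_locally p_infty) (locally 1).
Proof.
  intros P [eps HP]. exists (/ eps). intros t Ht. apply HP.
  change (Rabs (t / (1 + t) - 1) < eps).
  assert (0 < / eps) by (apply Rinv_0_lt_compat, cond_pos).
  replace (t / (1 + t) - 1) with (- / (1 + t)) by (field; lra).
  rewrite Rabs_Ropp, Rabs_right by (apply Rle_ge; left; apply Rinv_0_lt_compat; lra).
  rewrite <- (Rinv_inv eps). apply Rinv_lt_contravar; [|lra]. apply Rmult_lt_0_compat; lra.
Qed.

Lemma gamma_prim_at_infty (p : R) :
  filterlim (gamma_prim p) (Rbar_locally p_infty) (locally (gamma_bound p / p)).
Proof.
  unfold gamma_prim.
  apply (filterlim_comp _ _ _ (fun t => t / (1 + t)) (fun u => gamma_bound p / p * Rpower u p) _ (locally 1));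
    [apply div_succ_lim|].
  pose proof (rcont_mult (fun _ => gamma_bound p / p) (fun u : R => Rpower u p) 1) as H.
  assert (E : Rpower 1 p = 1) by (unfold Rpower; rewrite ln_1, Rmult_0_r; apply exp_0).
  unfold continuous in H. change (mult (gamma_bound p / p) (Rpower 1 p)) with (gamma_bound p / p * Rpower 1 p) in H.
  rewrite E, Rmult_1_r in H. pose proof (Rpower_continuous p 1 Rlt_0_1) as H'.
  unfold continuous in H'. rewrite E in H'.
  apply H; [apply filterlim_const | exact H'].
Qed.

Lemma gamma_bound_pos (p : R) : 0 < gamma_bound p.
Proof. apply exp_pos. Qed.

Lemma gamma_prim_pos (p t : R) : 0 < p -> 0 < gamma_prim p t.
Proof.
  intros Hp. unfold gamma_prim. apply Rmult_lt_0_compat; [|apply exp_pos].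
  apply Rdiv_lt_0_compat; [apply gamma_bound_pos | exact Hp].
Qed.

Lemma gamma_prim_le (p t : R) : 0 < p -> 0 < t -> gamma_prim p t <= gamma_bound p / p.
Proof.
  intros Hp Ht. unfold gamma_prim.
  assert (0 < gamma_bound p / p) by (apply Rdiv_lt_0_compat; [apply gamma_bound_pos | exact Hp]).
  assert (Rpower (t / (1 + t)) p <= 1).
  { unfold Rpower. apply Rle_trans with (exp 0); [|rewrite exp_0; lra]. left; apply exp_increasing.
    pose proof (div_succ_pos t Ht) as B.
    assert (ln (t / (1 + t)) < 0) by (rewrite <- ln_1; apply ln_increasing; lra). nra. }
  nra.
Qed.

Lemma gamma_prim_increasing (p s t : R) : 0 < p -> 0 < s <= t -> gamma_prim p s <= gamma_prim p t.
Proof.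
  intros Hp [Hs Ht]. destruct Ht as [Ht | ->]; [|lra]. unfold gamma_prim.
  assert (0 < gamma_bound p / p) by (apply Rdiv_lt_0_compat; [apply gamma_bound_pos | exact Hp]).
  apply Rmult_le_compat_l; [lra|]. left. apply Rlt_Rpower_l; [exact Hp|].
  split; [apply div_succ_pos, Hs|].
  replace (s / (1 + s)) with (1 - / (1 + s)) by (field; lra).
  replace (t / (1 + t)) with (1 - / (1 + t)) by (field; lra).
  assert (/ (1 + t) < / (1 + s)) by (apply Rinv_lt_contravar; nra). lra.
Qed.

Lemma pos_convex (x y t : R) : 0 < x -> 0 < y -> Rmin x y <= t <= Rmax x y -> 0 < t.
Proof. intros Hx Hy Ht. pose proof (Rmin_glb_lt x y 0 Hx Hy). lra. Qed.

Lemma gamma_CRInt_bound (z : C) (x y : R) : 0 < Re z -> 0 < x -> 0 < y ->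
  Cmod (CRInt (gamma_kernel z) x y) <= Rabs (gamma_prim (Re z) y - gamma_prim (Re z) x).
Proof.
  intros Hz Hx Hy.
  apply (CRInt_dominated (fun t => 0 < t) (gamma_kernel z) (gamma_prim (Re z)) (gamma_dom (Re z))); auto.
  - exact pos_convex.
  - apply gamma_kernel_cont.
  - intros t Ht; now apply gamma_prim_derive.
  - intros t Ht; now apply gamma_dom_cont.
  - intros t Ht; now apply gamma_kernel_le.
Qed.

Lemma at_right_0_pos : at_right 0 (fun t => 0 < t).
Proof. exists (mkposreal 1 Rlt_0_1). intros t _ H; exact H. Qed.

Lemma gamma_exists (z : C) : 0 < Re z -> exists G : C, is_Gamma z G /\
  forall x y, 0 < x -> 0 < y -> Cmod (Cminus (CRInt (gamma_kernel z) x y) G) <=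
    gamma_prim (Re z) x + (gamma_bound (Re z) / Re z - gamma_prim (Re z) y).
Proof.
  intros Hz.
  destruct (improper_exists (at_right 0) (Rbar_locally p_infty) (fun t => 0 < t) (gamma_kernel z)
     (gamma_prim (Re z)) (gamma_dom (Re z)) 0 (gamma_bound (Re z) / Re z)) as [G [H1 H2]].
  - exact pos_convex.
  - exact at_right_0_pos.
  - exists 0. auto.
  - apply gamma_kernel_cont.
  - intros t Ht; now apply gamma_prim_derive.
  - intros t Ht; now apply gamma_dom_cont.
  - intros t Ht; now apply gamma_kernel_le.
  - now apply gamma_prim_at_0.
  - apply gamma_prim_at_infty.
  - exists G. split; [exact H1|]. intros x y Hx Hy.
    eapply Rle_trans; [now apply H2|].
    pose proof (gamma_prim_pos (Re z) x Hz). pose proof (gamma_prim_le (Re z) y Hz Hy).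
    rewrite Rminus_0_r, (Rabs_right (gamma_prim _ _)), Rabs_left1 by lra. lra.
Qed.

Lemma gamma_prim_small (p eps : R) : 0 < p -> 0 < eps ->
  exists d, 0 < d /\ forall t, 0 < t <= d -> gamma_prim p t < eps.
Proof.
  intros Hp He. destruct (gamma_prim_at_0 p Hp _ (locally_ball 0 (mkposreal _ He))) as [d Hd].
  exists (d / 2). pose proof (cond_pos d). split; [lra|]. intros t Ht.
  assert (B : ball 0 (mkposreal _ He) (gamma_prim p t)).
  { apply Hd; [|lra]. change (Rabs (t - 0) < d). rewrite Rabs_right; lra. }
  change (Rabs (gamma_prim p t - 0) < eps) in B. rewrite Rminus_0_r in B.
  pose proof (Rle_abs (gamma_prim p t)). lra.
Qed.

Lemma gamma_prim_large (p eps : R) : 0 < p -> 0 < eps ->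
  exists S, 0 < S /\ forall t, S <= t -> gamma_bound p / p - gamma_prim p t < eps.
Proof.
  intros Hp He.
  destruct (gamma_prim_at_infty p _ (locally_ball _ (mkposreal _ He))) as [S HS].
  exists (Rmax (S + 1) 1). split; [eapply Rlt_le_trans; [|apply Rmax_r]; lra|]. intros t Ht.
  pose proof (Rmax_l (S + 1) 1).
  assert (B : Rabs (gamma_prim p t - gamma_bound p / p) < eps) by (apply HS; lra).
  apply Rabs_def2 in B. lra.
Qed.

(* [lg s] is the integral of the kernel over (0, s]. *)
Lemma lower_gamma_exists (z G : C) : 0 < Re z ->
  (forall x y, 0 < x -> 0 < y -> Cmod (Cminus (CRInt (gamma_kernel z) x y) G) <=
    gamma_prim (Re z) x + (gamma_bound (Re z) / Re z - gamma_prim (Re z) y)) ->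
  exists lg : R -> C,
    (forall s, 0 < s -> Cderive lg s (gamma_kernel z s)) /\
    (forall s, 0 < s -> Cmod (lg s) <= gamma_prim (Re z) s) /\
    (forall s, 0 < s -> Cmod (Cminus (lg s) G) <= gamma_bound (Re z) / Re z - gamma_prim (Re z) s) /\
    (forall x s, 0 < x -> 0 < s -> Cmod (Cminus (CRInt (gamma_kernel z) x s) (lg s)) <= gamma_prim (Re z) x).
Proof.
  intros Hz HG.
  (* Only the lower end is improper: [at_point 1] fixes the upper one. From 1 on, an ordinary
     integral continues the function, and its derivative comes from the fundamental theorem. *)
  destruct (improper_exists (at_right 0) (at_point 1) (fun t => 0 < t) (gamma_kernel z)
     (gamma_prim (Re z)) (gamma_dom (Re z)) 0 (gamma_prim (Re z) 1)) as [c [_ H2]].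
  - exact pos_convex.
  - exact at_right_0_pos.
  - exact Rlt_0_1.
  - apply gamma_kernel_cont.
  - intros t Ht; now apply gamma_prim_derive.
  - intros t Ht; now apply gamma_dom_cont.
  - intros t Ht; now apply gamma_kernel_le.
  - now apply gamma_prim_at_0.
  - intros P [e HP]. apply HP. apply ball_center.
  - set (lg := fun s => Cplus c (CRInt (gamma_kernel z) 1 s)).
    assert (ch : forall x y s, 0 < x -> 0 < y -> 0 < s ->
       Cplus (CRInt (gamma_kernel z) x y) (CRInt (gamma_kernel z) y s) = CRInt (gamma_kernel z) x s).
    { intros x y s Hx Hy Hs. apply (CRInt_Chasles_on (fun t => 0 < t)); auto.
      - exact pos_convex.
      - apply gamma_kernel_cont. }
    assert (A : forall x s, 0 < x -> 0 < s -> Cmod (Cminus (CRInt (gamma_kernel z) x s) (lg s)) <= gamma_prim (Re z) x).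
    { intros x s Hx Hs. unfold lg. rewrite <- (ch x 1 s) by lra.
      replace (Cminus (Cplus (CRInt (gamma_kernel z) x 1) (CRInt (gamma_kernel z) 1 s)) (Cplus c (CRInt (gamma_kernel z) 1 s)))
        with (Cminus (CRInt (gamma_kernel z) x 1) c) by ring.
      eapply Rle_trans; [apply H2; lra|]. rewrite Rminus_diag, Rabs_R0, Rminus_0_r, Rplus_0_r.
      rewrite Rabs_right; [lra|]. apply Rle_ge; left; now apply gamma_prim_pos. }
    exists lg. split; [|split; [|split; [|exact A]]].
    + intros s Hs. unfold lg.
      apply (Cderive_eq _ _ (Cplus (RtoC 0) (gamma_kernel z s))); [|ring].
      apply (Cderive_plus (fun _ => c) (CRInt (gamma_kernel z) 1)); [apply Cderive_const|].
      assert (L : locally s (fun y => 0 < y)).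
      { exists (mkposreal s Hs). intros y Hy. change (Rabs (y - s) < s) in Hy. apply Rabs_def2 in Hy. lra. }
      assert (cont : forall y, 0 < y -> forall t, Rmin 1 y <= t <= Rmax 1 y -> Ccont (gamma_kernel z) t).
      { intros y Hy t Ht. apply gamma_kernel_cont. apply (pos_convex 1 y); [lra | exact Hy | exact Ht]. }
      split; simpl.
      * apply (is_derive_RInt (V := R_CompleteNormedModule) (fun t => Re (gamma_kernel z t)) _ 1 s).
        -- revert L; apply filter_imp; intros y Hy.
           apply (RInt_correct (V := R_CompleteNormedModule)). exact (ex_RInt_Re (gamma_kernel z) 1 y (cont y Hy)).
        -- exact (proj1 (gamma_kernel_cont z s Hs)).
      * apply (is_derive_RInt (V := R_CompleteNormedModule) (fun t => Im (gamma_kernel z t)) _ 1 s).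
        -- revert L; apply filter_imp; intros y Hy.
           apply (RInt_correct (V := R_CompleteNormedModule)). exact (ex_RInt_Im (gamma_kernel z) 1 y (cont y Hy)).
        -- exact (proj2 (gamma_kernel_cont z s Hs)).
    + intros s Hs. apply le_epsilon. intros eps He.
      destruct (gamma_prim_small (Re z) eps Hz He) as [d [Hd Hsm]].
      set (x := Rmin d s). assert (Hx : 0 < x) by (apply Rmin_glb_lt; assumption).
      assert (Hxd : x <= d) by apply Rmin_l. assert (Hxs : x <= s) by apply Rmin_r.
      pose proof (A x s Hx Hs) as B. pose proof (gamma_CRInt_bound z x s Hz Hx Hs) as B'.
      pose proof (gamma_prim_increasing (Re z) x s Hz (conj Hx Hxs)).
      rewrite Rabs_right in B' by lra.
      pose proof (Cmod_le_dist (lg s) (CRInt (gamma_kernel z) x s)) as T.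
      rewrite Cmod_minus_sym in T.
      pose proof (Hsm x (conj Hx Hxd)). lra.
    + intros s Hs. apply le_epsilon. intros eps He.
      assert (He2 : 0 < eps / 2) by lra.
      destruct (gamma_prim_small (Re z) (eps / 2) Hz He2) as [d [Hd Hsm]].
      pose proof (A d s Hd Hs) as B. pose proof (HG d s Hd Hs) as B'.
      pose proof (Cmod_dist (lg s) (CRInt (gamma_kernel z) d s) G) as T.
      rewrite (Cmod_minus_sym (lg s) (CRInt (gamma_kernel z) d s)) in T.
      pose proof (Hsm d (conj Hd (Rle_refl d))). lra.
Qed.

(** * The Beta integral in terms of Gamma *)

Lemma cpow_div (x y : R) (w : C) : 0 < x -> 0 < y -> cpow (x / y) w = Cdiv (cpow x w) (cpow y w).
Proof.
  intros Hx Hy. unfold Rdiv. rewrite cpow_mult; [|exact Hx|now apply Rinv_0_lt_compat].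
  unfold Cdiv. f_equal. rewrite <- cpow_opp. unfold cpow. f_equal. rewrite ln_Rinv by assumption.
  rewrite RtoC_opp. ring.
Qed.

Lemma Rpower_between (x a b r : R) : 0 < a -> a <= x <= b -> Rpower x r <= Rpower a r + Rpower b r.
Proof.
  intros Ha H. unfold Rpower.
  pose proof (exp_pos (r * ln a)). pose proof (exp_pos (r * ln b)).
  assert (ln a <= ln x) by (apply ln_le; lra). assert (ln x <= ln b) by (apply ln_le; lra).
  assert (mono : forall u v, u <= v -> exp u <= exp v).
  { intros u v [E | ->]; [left; now apply exp_increasing | lra]. }
  destruct (Rle_dec 0 r).
  - pose proof (mono (r * ln x) (r * ln b)). nra.
  - pose proof (mono (r * ln x) (r * ln a)). nra.
Qed.

Lemma open_pos : open (fun s : R => 0 < s).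
Proof. apply open_gt. Qed.

Lemma open_unit : open (fun t : R => 0 < t < 1).
Proof. apply open_and; [apply open_gt | apply open_lt]. Qed.

Section GammaBeta.
Variables (al be Ga Gb Gab : C).
Hypothesis Hal : 0 < Re al.
Hypothesis Hbe : 0 < Re be.
Let p := Re al.
Let q := Re be.
Let r := Re (Cplus al be).
Variables (la lb lab : R -> C).
Hypothesis la_derive : forall s, 0 < s -> Cderive la s (gamma_kernel al s).
Hypothesis la_small : forall s, 0 < s -> Cmod (la s) <= gamma_prim p s.
Hypothesis la_lim : forall s, 0 < s -> Cmod (Cminus (la s) Ga) <= gamma_bound p / p - gamma_prim p s.
Hypothesis lb_derive : forall s, 0 < s -> Cderive lb s (gamma_kernel be s).
Hypothesis lb_small : forall s, 0 < s -> Cmod (lb s) <= gamma_prim q s.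
Hypothesis lb_lim : forall s, 0 < s -> Cmod (Cminus (lb s) Gb) <= gamma_bound q / q - gamma_prim q s.
Hypothesis lab_derive : forall s, 0 < s -> Cderive lab s (gamma_kernel (Cplus al be) s).
Hypothesis lab_small : forall s, 0 < s -> Cmod (lab s) <= gamma_prim r s.
Hypothesis lab_lim : forall s, 0 < s -> Cmod (Cminus (lab s) Gab) <= gamma_bound r / r - gamma_prim r s.

Let Hr : 0 < r.
Proof. unfold r, p, q; simpl. unfold Re in *. lra. Qed.

(** Let u and v be the variables of the integrals for Gamma(al) and Gamma(be), and t = u / (u + v).
    The strip v <= s reads u + v <= s / (1 - t). So the kernel times [Q s], integrated over t,
    should be Gamma(al) times the incomplete integral of [be] up to s. Differentiation in s proves
    this without a double integral. *)
Let Q (s t : R) : C := lab (s / (1 - t)).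
Let h (d s : R) : C := CRInt (fun t => Cmult (beta_kernel al be t) (Q s t)) d (1 - d).
Let K : R := beta_bound p q * (/ p + / q).
Let M : R := gamma_bound r / r.

Lemma K_pos : 0 < K.
Proof.
  unfold K. apply Rmult_lt_0_compat; [apply beta_bound_pos|].
  pose proof (Rinv_0_lt_compat p Hal). pose proof (Rinv_0_lt_compat q Hbe). lra.
Qed.

Lemma M_pos : 0 < M.
Proof. apply Rdiv_lt_0_compat; [apply gamma_bound_pos | exact Hr]. Qed.

Lemma quot_pos (s t : R) : 0 < s -> 0 < t < 1 -> 0 < s / (1 - t).
Proof. intros. apply Rdiv_lt_0_compat; lra. Qed.

Lemma Q_cont (s t : R) : 0 < s -> 0 < t < 1 -> Ccont (Q s) t.
Proof.
  intros Hs Ht. apply (Ccont_comp lab (fun t => s / (1 - t))).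
  - apply (ex_derive_continuous (V := R_NormedModule)). auto_derive. lra.
  - eapply Cderive_Ccont, lab_derive, quot_pos; assumption.
Qed.

Lemma Q_bound (s t : R) : 0 < s -> 0 < t < 1 -> Cmod (Q s t) <= M.
Proof.
  intros Hs Ht. eapply Rle_trans; [apply lab_small; now apply quot_pos|].
  apply gamma_prim_le; [exact Hr | now apply quot_pos].
Qed.

(** The coordinate u of the point with v = s on the ray of parameter t; its t-derivative s / (1 -
    t)^2 is the factor in [hs]. *)
Let y (s t : R) : R := s * t / (1 - t).
Let hs (s t : R) : C := Cmult (gamma_kernel be s)
    (Cmult (RtoC (s / (1 - t) ^ 2)) (gamma_kernel al (y s t))).

(** The exponential splits because s / (1 - t) = s + y; both sides then carry the power - al - 1 of
    1 - t. *)
Lemma hs_eq (s t : R) : 0 < s -> 0 < t < 1 ->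
  Cmult (beta_kernel al be t) (Cmult (RtoC (/ (1 - t))) (gamma_kernel (Cplus al be) (s / (1 - t)))) = hs s t.
Proof.
  intros Hs Ht. unfold hs, y, gamma_kernel, beta_kernel.
  assert (H1 : 0 < 1 - t) by lra.
  replace (exp (- (s / (1 - t)))) with (exp (- s) * exp (- (s * t / (1 - t)))).
  2:{ rewrite <- exp_plus. f_equal. field. lra. }
  rewrite (cpow_div s (1 - t)), (cpow_div (s * t) (1 - t)), (cpow_mult s t) by nra.
  replace (Cminus (Cplus al be) (RtoC 1)) with (Cplus (Cplus (Cminus al (RtoC 1)) (Cminus be (RtoC 1))) (RtoC 1)) by ring.
  rewrite !(cpow_plus _ _ (RtoC 1)), !cpow_1 by lra.
  rewrite !(cpow_plus _ (Cminus al (RtoC 1)) (Cminus be (RtoC 1))).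
  pose proof (cpow_neq_0 (1 - t) (Cminus al (RtoC 1))).
  pose proof (cpow_neq_0 (1 - t) (Cminus be (RtoC 1))).
  rewrite RtoC_mult.
  unfold Rdiv. rewrite RtoC_mult, !RtoC_inv, RtoC_pow.
  assert (RtoC (1 - t) <> RtoC 0) by (intros E; apply RtoC_inj in E; lra).
  { field. repeat split; assumption. }
  - apply pow_nonzero; lra.
  - lra.
Qed.

(** After differentiation under the integral, the integrand is a constant times the t-derivative of
    [la (y s t)], so the integral in t is evaluated exactly. *)
Lemma h_derive (d s : R) : 0 < d <= / 2 -> 0 < s ->
  Cderive (h d) s (Cmult (gamma_kernel be s) (Cminus (la (y s (1 - d))) (la (y s d)))).
Proof.
  intros Hd Hs.
  assert (ypos : forall s t, 0 < s -> 0 < t < 1 -> 0 < y s t).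
  { intros; unfold y. apply Rdiv_lt_0_compat; [nra | lra]. }
  assert (ycont : forall s t, 0 < s -> 0 < t < 1 -> continuous (fun v : R * R => y (fst v) (snd v)) (s, t)).
  { intros s' t Hs' Ht. unfold y, Rdiv.
    apply (rcont_mult (fun v : R * R => fst v * snd v) (fun v : R * R => / (1 - snd v))).
    - apply (rcont_mult (fun v : R * R => fst v) (fun v : R * R => snd v));
        [apply continuous_fst | apply continuous_snd].
    - apply (continuous_comp (fun v : R * R => snd v) (fun t => / (1 - t))); [apply continuous_snd|].
      apply (ex_derive_continuous (V := R_NormedModule)). simpl. auto_derive. lra. }
  assert (hscont : forall s t, 0 < s -> 0 < t < 1 -> Ccont (fun v : R * R => hs (fst v) (snd v)) (s, t)).
  { intros s' t Hs' Ht. unfold hs.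
    apply (Ccont_mult (fun v : R * R => gamma_kernel be (fst v))
      (fun v : R * R => Cmult (RtoC (fst v / (1 - snd v) ^ 2)) (gamma_kernel al (y (fst v) (snd v))))).
    { apply (Ccont_comp (gamma_kernel be) (fun v : R * R => fst v)); [apply continuous_fst|].
      now apply gamma_kernel_cont. }
    apply (Ccont_mult (fun v : R * R => RtoC (fst v / (1 - snd v) ^ 2)) (fun v : R * R => gamma_kernel al (y (fst v) (snd v)))).
    - apply Ccont_RtoC. unfold Rdiv.
      apply (rcont_mult (fun v : R * R => fst v) (fun v : R * R => / (1 - snd v) ^ 2)); [apply continuous_fst|].
      apply (continuous_comp (fun v : R * R => snd v) (fun t => / (1 - t) ^ 2)); [apply continuous_snd|].
      apply (ex_derive_continuous (V := R_NormedModule)). simpl. auto_derive. nra.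
    - apply (Ccont_comp (gamma_kernel al) (fun v : R * R => y (fst v) (snd v))); [now apply ycont|].
      apply gamma_kernel_cont. now apply ypos. }
  apply (Cderive_eq _ _ (CRInt (hs s) d (1 - d))).
  - apply (CRInt_param_derive (fun s => 0 < s) (fun t => 0 < t < 1)
      (fun s t => Cmult (beta_kernel al be t) (Q s t)) hs d (1 - d)); auto.
    + apply open_pos.
    + apply open_unit.
    + lra.
    + intros t Ht; lra.
    + intros s' t Hs' Ht.
      apply (Cderive_eq _ _ _ _ (Cderive_mult (fun _ => beta_kernel al be t) (fun s => Q s t) s' _ _
        (Cderive_const _ _)
        (Cderive_comp lab (fun s => s / (1 - t)) s' (/ (1 - t)) _ (lab_derive _ (quot_pos s' t Hs' Ht))
           ltac:(auto_derive; [auto | field; lra])))).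
      rewrite <- hs_eq by assumption. ring.
    + intros s' t Hs' Ht. apply (Ccont_mult (beta_kernel al be) (Q s')).
      * now apply beta_kernel_cont.
      * now apply Q_cont.
  - unfold hs.
    assert (cont1 : forall t, 0 < t < 1 -> Ccont (fun t => Cmult (RtoC (s / (1 - t) ^ 2)) (gamma_kernel al (y s t))) t).
    { intros t Ht. apply (Ccont_mult (fun t => RtoC (s / (1 - t) ^ 2)) (fun t => gamma_kernel al (y s t))).
      - apply Ccont_RtoC, (ex_derive_continuous (V := R_NormedModule)). auto_derive. nra.
      - apply (Ccont_comp (gamma_kernel al) (y s)).
        + unfold y. apply (ex_derive_continuous (V := R_NormedModule)). auto_derive. lra.
        + now apply gamma_kernel_cont, ypos. }
    rewrite (CRInt_scal (gamma_kernel be s)).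
    2:{ rewrite Rmin_left, Rmax_right by lra. intros t Ht. apply cont1. lra. }
    f_equal.
    apply (CRInt_FTC (fun t => la (y s t)));
      rewrite Rmin_left, Rmax_right by lra; intros t Ht; [|apply cont1; lra].
    apply (Cderive_comp la (y s)); [apply la_derive, ypos; lra|].
    unfold y. auto_derive; [lra | field; lra].
Qed.

(** The initial value at s = 0. [Q s t] is not small uniformly as t tends to 1, so [d] is first
    chosen to make the tail small, and only then s relative to [d]. *)
Lemma lower_gamma_beta_at_0 (eps : R) : 0 < eps -> exists s0, 0 < s0 /\ forall s, 0 < s <= s0 ->
  exists l, Cmod l < eps /\ forall d, 0 < d < 1 -> Cmod (Cminus (h d s) l) <= M * beta_tail p q d.
Proof.
  intros He. pose proof M_pos as HM. pose proof K_pos as HK.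
  destruct (beta_tail_small p q (eps / 2 / M) Hal Hbe) as [d [Hd Td]].
  { apply Rdiv_lt_0_compat; lra. }
  destruct (gamma_prim_small r (eps / 2 / K) Hr) as [e [He' Te]].
  { apply Rdiv_lt_0_compat; lra. }
  (* On [d, 1 - d] one has 1 - t >= d, so s <= e d gives s / (1 - t) <= e. *)
  exists (e * d). split; [nra|]. intros s Hs.
  destruct (beta_improper al be (Q s) M Hal Hbe) as [l [_ Bl]].
  - intros t Ht; apply Q_cont; lra.
  - intros t Ht; apply Q_bound; lra.
  - exists l. split; [|exact Bl].
    assert (B1 := Bl d ltac:(lra)). specialize (Td d ltac:(lra)).
    assert (B2 : Cmod (h d s) <= (gamma_prim r e) * K).
    { apply (beta_CRInt_bound al be (Q s) (gamma_prim r e) d Hal Hbe Hd).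
      - intros t Ht; apply Q_cont; lra.
      - intros t Ht. eapply Rle_trans; [apply lab_small, quot_pos; lra|].
        apply gamma_prim_increasing; [exact Hr|]. split; [apply quot_pos; lra|].
        apply Rmult_le_reg_r with (1 - t); [lra|]. unfold Rdiv. rewrite Rmult_assoc, Rinv_l by lra. nra. }
    specialize (Te e ltac:(lra)).
    assert (M * beta_tail p q d < eps / 2).
    { apply Rmult_lt_compat_l with (r := M) in Td; [|exact HM].
      replace (M * (eps / 2 / M)) with (eps / 2) in Td by (field; lra). exact Td. }
    assert (gamma_prim r e * K < eps / 2).
    { apply Rmult_lt_compat_r with (r := K) in Te; [|exact HK].
      replace (eps / 2 / K * K) with (eps / 2) in Te by (field; lra). exact Te. }
    pose proof (Cmod_le_dist l (h d s)) as T. rewrite Cmod_minus_sym in T.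
    unfold h, p, q in *. lra.
Qed.

Lemma small_quot (e : R) (P : R) : 0 < P -> 0 < e -> forall x, 0 < x <= e / (2 * P) -> 0 < x <= / 2 ->
  P * x / (1 - x) <= e.
Proof.
  intros HP He x Hx Hx2. apply Rmult_le_reg_r with (1 - x); [lra|].
  unfold Rdiv. rewrite Rmult_assoc, Rinv_l by lra.
  assert (x * (2 * P) <= e).
  { destruct Hx as [_ Hx]. apply Rmult_le_compat_r with (r := 2 * P) in Hx; [|lra].
    replace (e / (2 * P) * (2 * P)) with e in Hx by (field; lra). exact Hx. }
  nra.
Qed.

(* Both sides have the same derivative in S and vanish at 0. *)
Lemma lower_gamma_beta (S d : R) : 0 < S -> 0 < d < 1 ->
  Cmod (Cminus (h d S) (Cmult Ga (lb S))) <= M * beta_tail p q d.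
Proof.
  intros HS Hd1. revert d Hd1. pose proof M_pos as HM. pose proof K_pos as HK.
  destruct (beta_improper al be (Q S) M Hal Hbe) as [l [_ Bl]].
  { intros t Ht; apply Q_cont; lra. }
  { intros t Ht; apply Q_bound; lra. }
  enough (E : l = Cmult Ga (lb S)) by (rewrite <- E; exact Bl).
  apply C_eq_epsilon. intros eps6 He6.
  set (eps := eps6 / 6). assert (He : 0 < eps) by (unfold eps; lra).
  destruct (lower_gamma_beta_at_0 eps He) as [s1 [Hs1 H0]].
  assert (HG : 0 < Cmod Ga + 1) by (pose proof (Cmod_ge_0 Ga); lra).
  destruct (gamma_prim_small q (eps / (Cmod Ga + 1)) Hbe) as [s2 [Hs2 H2]].
  { now apply Rdiv_lt_0_compat. }
  set (s0 := Rmin S (Rmin s1 s2)).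
  assert (Hs0 : 0 < s0) by (repeat apply Rmin_glb_lt; assumption).
  assert (L1 : s0 <= S) by apply Rmin_l.
  assert (L2 : s0 <= s1) by (eapply Rle_trans; [apply Rmin_r | apply Rmin_l]).
  assert (L3 : s0 <= s2) by (eapply Rle_trans; [apply Rmin_r | apply Rmin_r]).
  destruct (H0 s0 (conj Hs0 L2)) as [l0 [Hl0 Bl0]].
  (* Bounds the Gamma kernel of [be] on [s0, S]. That kernel may be unbounded at 0, which is why the
     mean value argument starts at a positive [s0]. *)
  set (K1 := Rpower s0 (q - 1) + Rpower S (q - 1)).
  assert (HK1 : 0 < K1).
  { unfold K1, Rpower. pose proof (exp_pos ((q-1) * ln s0)). pose proof (exp_pos ((q-1) * ln S)). lra. }
  set (eta := eps / (4 * K1 * (S + 1))).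
  assert (Heta : 0 < eta) by (apply Rdiv_lt_0_compat; [exact He | nra]).
  destruct (gamma_prim_small p eta Hal Heta) as [e1 [He1 G1]].
  destruct (gamma_prim_large p eta Hal Heta) as [e2 [He2 G2]].
  destruct (beta_tail_small p q (eps / M) Hal Hbe) as [d0 [Hd0 Td0]].
  { now apply Rdiv_lt_0_compat. }
  (* For all s in [s0, S], the second entry makes [y s d] at most [e1] and the third makes
     [y s (1 - d)] at least [e2], so the difference of the values of [la] there is close to [Ga].
     The first entry controls the tail. *)
  set (d := Rmin d0 (Rmin (e1 / (2 * S)) (/ (2 * e2) * s0))).
  assert (Hd : 0 < d).
  { repeat apply Rmin_glb_lt; [lra | apply Rdiv_lt_0_compat; lra |].
    apply Rmult_lt_0_compat; [apply Rinv_0_lt_compat|]; lra. }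
  assert (D1 : d <= d0) by apply Rmin_l.
  assert (D2 : d <= e1 / (2 * S)) by (eapply Rle_trans; [apply Rmin_r | apply Rmin_l]).
  assert (D3 : d <= / (2 * e2) * s0) by (eapply Rle_trans; [apply Rmin_r | apply Rmin_r]).
  assert (MT : M * beta_tail p q d <= eps).
  { assert (T := Td0 d (conj Hd D1)). left. apply Rmult_lt_compat_l with (r := M) in T; [|exact HM].
    replace (M * (eps / M)) with eps in T by (field; lra). exact T. }
  assert (B1 := Bl d ltac:(lra)). assert (B2 := Bl0 d ltac:(lra)).
  assert (MV : Cmod (Cminus (Cminus (h d S) (Cmult Ga (lb S))) (Cminus (h d s0) (Cmult Ga (lb s0))))
     <= 2 * (K1 * (2 * eta)) * (S - s0)).
  { apply (CMVT (fun s => Cminus (h d s) (Cmult Ga (lb s)))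
      (fun s => Cminus (Cmult (gamma_kernel be s) (Cminus (la (y s (1 - d))) (la (y s d))))
                       (Cmult Ga (gamma_kernel be s)))); [exact L1| |].
    - intros s Hs. apply (Cderive_minus (h d) (fun s => Cmult Ga (lb s))).
      + apply h_derive; lra.
      + apply (Cderive_eq _ _ _ _ (Cderive_mult (fun _ => Ga) lb s _ _ (Cderive_const _ _) (lb_derive s ltac:(lra)))).
        ring.
    - intros s Hs.
      replace (Cminus (Cmult (gamma_kernel be s) (Cminus (la (y s (1 - d))) (la (y s d)))) (Cmult Ga (gamma_kernel be s)))
        with (Cmult (gamma_kernel be s) (Cminus (Cminus (la (y s (1 - d))) Ga) (la (y s d)))) by ring.
      rewrite Cmod_mult. apply Rmult_le_compat; try apply Cmod_ge_0.
      + rewrite Cmod_gamma_kernel. fold q.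
        assert (exp (- s) <= 1).
        { apply Rle_trans with (exp 0); [|rewrite exp_0; lra]. left; apply exp_increasing; lra. }
        pose proof (Rpower_between s s0 S (q - 1) Hs0 Hs). pose proof (exp_pos (- s)).
        pose proof (exp_pos ((q - 1) * ln s)). unfold K1. unfold Rpower in *. nra.
      + unfold Cminus at 1. eapply Rle_trans; [apply Cmod_triangle|]. rewrite Cmod_opp.
        assert (A1 : Cmod (la (y s d)) <= eta).
        { assert (P : 0 < y s d) by (unfold y; apply Rdiv_lt_0_compat; nra).
          eapply Rle_trans; [apply la_small; exact P|]. left. apply G1. split; [exact P|].
          apply Rle_trans with (S * d / (1 - d)).
          - unfold y, Rdiv. apply Rmult_le_compat_r; [left; apply Rinv_0_lt_compat; lra | nra].
          - apply small_quot; lra. }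
        assert (A2 : Cmod (Cminus (la (y s (1 - d))) Ga) <= eta).
        { assert (E2 : e2 <= y s (1 - d)).
          { unfold y. replace (1 - (1 - d)) with d by ring.
            apply Rmult_le_reg_r with d; [lra|]. unfold Rdiv. rewrite Rmult_assoc, Rinv_l by lra.
            assert (d * (2 * e2) <= s0).
            { apply Rmult_le_compat_r with (r := 2 * e2) in D3; [|lra].
              replace (/ (2 * e2) * s0 * (2 * e2)) with s0 in D3 by (field; lra). exact D3. }
            nra. }
          eapply Rle_trans; [apply la_lim; lra|]. left. now apply G2. }
        lra. }
  assert (S1 : 2 * (K1 * (2 * eta)) * (S - s0) <= eps).
  { apply Rle_trans with (2 * (K1 * (2 * eta)) * (S + 1)).
    - apply Rmult_le_compat_l; nra.
    - right. unfold eta. field. split; lra. }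
  assert (S2 : Cmod (Cmult Ga (lb s0)) <= eps).
  { rewrite Cmod_mult. pose proof (lb_small s0 Hs0). pose proof (H2 s0 (conj Hs0 L3)) as H3.
    apply Rmult_lt_compat_l with (r := Cmod Ga + 1) in H3; [|exact HG].
    replace ((Cmod Ga + 1) * (eps / (Cmod Ga + 1))) with eps in H3 by (field; lra).
    pose proof (Cmod_ge_0 Ga). pose proof (Cmod_ge_0 (lb s0)). nra. }
  pose proof (Cmod_dist l (h d S) (Cmult Ga (lb S))) as T1. rewrite (Cmod_minus_sym l (h d S)) in T1.
  pose proof (Cmod_le_dist (Cminus (h d S) (Cmult Ga (lb S))) (Cminus (h d s0) (Cmult Ga (lb s0)))) as T2.
  pose proof (Cmod_triangle (h d s0) (Copp (Cmult Ga (lb s0)))) as T3. rewrite Cmod_opp in T3.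
  pose proof (Cmod_le_dist (h d s0) l0) as T4.
  change (Cplus (h d s0) (Copp (Cmult Ga (lb s0)))) with (Cminus (h d s0) (Cmult Ga (lb s0))) in T3.
  change (Cmod (Cminus (h d S) l) <= M * beta_tail p q d) in B1.
  unfold eps in *. lra.
Qed.

(** In [lower_gamma_beta] the upper limit S goes to infinity. Since S / (1 - t) >= S, [Q S t] tends
    to [Gab] uniformly in t, and the left side becomes [Gab] times the Beta integral, while [lb S]
    tends to [Gb]. *)
Lemma gamma_beta (B : C) :
  (forall d, 0 < d < 1 -> Cmod (Cminus (CRInt (beta_kernel al be) d (1 - d)) B) <= beta_tail p q d) ->
  Cmult Ga Gb = Cmult Gab B.
Proof.
  intros HB. pose proof M_pos as HM. pose proof K_pos as HK.
  apply C_eq_epsilon. intros eps4 He4.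
  set (eps := eps4 / 4). assert (He : 0 < eps) by (unfold eps; lra).
  assert (HG : 0 < Cmod Ga + 1) by (pose proof (Cmod_ge_0 Ga); lra).
  assert (HG' : 0 < Cmod Gab + 1) by (pose proof (Cmod_ge_0 Gab); lra).
  destruct (gamma_prim_large q (eps / (Cmod Ga + 1)) Hbe) as [S1 [HS1 G1]].
  { now apply Rdiv_lt_0_compat. }
  destruct (gamma_prim_large r (eps / K) Hr) as [S2 [HS2 G2]].
  { now apply Rdiv_lt_0_compat. }
  set (S := Rmax S1 S2).
  assert (L1 : S1 <= S) by apply Rmax_l. assert (L2 : S2 <= S) by apply Rmax_r.
  assert (HS : 0 < S) by lra.
  destruct (beta_tail_small p q (eps / (M + (Cmod Gab + 1))) Hal Hbe) as [d [Hd Td]].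
  { apply Rdiv_lt_0_compat; lra. }
  specialize (Td d ltac:(lra)).
  assert (MT : (M + (Cmod Gab + 1)) * beta_tail p q d <= eps).
  { left. apply Rmult_lt_compat_l with (r := M + (Cmod Gab + 1)) in Td; [|lra].
    replace ((M + (Cmod Gab + 1)) * (eps / (M + (Cmod Gab + 1)))) with eps in Td by (field; lra). exact Td. }
  pose proof (lower_gamma_beta S d HS ltac:(lra)) as Bl.
  specialize (HB d ltac:(lra)). pose proof (beta_tail_pos p q d) as HT.
  assert (X1 : Cmod (Cminus (h d S) (Cmult Gab (CRInt (beta_kernel al be) d (1 - d)))) <= eps).
  { assert (kc : forall t, Rmin d (1 - d) <= t <= Rmax d (1 - d) -> Ccont (beta_kernel al be) t).
    { rewrite Rmin_left, Rmax_right by lra. intros t Ht. apply beta_kernel_cont; lra. }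
    replace (Cminus (h d S) (Cmult Gab (CRInt (beta_kernel al be) d (1 - d)))) with
      (CRInt (fun t => Cmult (beta_kernel al be t) (Cminus (Q S t) Gab)) d (1 - d)).
    - eapply Rle_trans.
      + apply (beta_CRInt_bound al be (fun t => Cminus (Q S t) Gab) (gamma_bound r / r - gamma_prim r S) d Hal Hbe Hd).
        * intros t Ht. apply (Ccont_minus (Q S) (fun _ => Gab)); [apply Q_cont; lra | apply Ccont_const].
        * intros t Ht. eapply Rle_trans; [apply lab_lim, quot_pos; lra|].
          assert (gamma_prim r S <= gamma_prim r (S / (1 - t))); [|lra].
          apply gamma_prim_increasing; [exact Hr|]. split; [exact HS|].
          apply Rmult_le_reg_r with (1 - t); [lra|]. unfold Rdiv. rewrite Rmult_assoc, Rinv_l by lra. nra.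
      + specialize (G2 S L2). left. apply Rmult_lt_compat_r with (r := K) in G2; [|exact HK].
        replace (eps / K * K) with eps in G2 by (field; lra). exact G2.
    - rewrite (CRInt_ext _ (fun t => Cplus (Cmult (beta_kernel al be t) (Q S t)) (Cmult (Copp Gab) (beta_kernel al be t))))
        by (intros; ring).
      rewrite (CRInt_plus (fun t => Cmult (beta_kernel al be t) (Q S t)) (fun t => Cmult (Copp Gab) (beta_kernel al be t))).
      + rewrite CRInt_scal by exact kc. unfold h. ring.
      + intros t Ht. apply (Ccont_mult (beta_kernel al be) (Q S)); [now apply kc|].
        rewrite Rmin_left, Rmax_right in Ht by lra. apply Q_cont; lra.
      + intros t Ht. apply (Ccont_mult (fun _ => Copp Gab) (beta_kernel al be)); [apply Ccont_const | now apply kc]. }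
  assert (X2 : Cmod (Cminus (Cmult Ga (lb S)) (Cmult Ga Gb)) <= eps).
  { replace (Cminus (Cmult Ga (lb S)) (Cmult Ga Gb)) with (Cmult Ga (Cminus (lb S) Gb)) by ring.
    rewrite Cmod_mult. pose proof (lb_lim S HS). specialize (G1 S L1).
    apply Rmult_lt_compat_l with (r := Cmod Ga + 1) in G1; [|exact HG].
    replace ((Cmod Ga + 1) * (eps / (Cmod Ga + 1))) with eps in G1 by (field; lra).
    pose proof (Cmod_ge_0 Ga). pose proof (Cmod_ge_0 (Cminus (lb S) Gb)). nra. }
  assert (X3 : Cmod (Cminus (Cmult Gab (CRInt (beta_kernel al be) d (1 - d))) (Cmult Gab B)) <= (Cmod Gab + 1) * beta_tail p q d).
  { replace (Cminus (Cmult Gab (CRInt (beta_kernel al be) d (1 - d))) (Cmult Gab B))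
      with (Cmult Gab (Cminus (CRInt (beta_kernel al be) d (1 - d)) B)) by ring.
    rewrite Cmod_mult. pose proof (Cmod_ge_0 Gab).
    pose proof (Cmod_ge_0 (Cminus (CRInt (beta_kernel al be) d (1 - d)) B)). nra. }
  set (l := Cmult Ga (lb S)) in *.
  pose proof (Cmod_dist (Cmult Ga Gb) l (Cmult Gab B)) as T1. rewrite (Cmod_minus_sym (Cmult Ga Gb) l) in T1.
  pose proof (Cmod_dist l (h d S) (Cmult Gab B)) as T2. rewrite (Cmod_minus_sym l (h d S)) in T2.
  pose proof (Cmod_dist (h d S) (Cmult Gab (CRInt (beta_kernel al be) d (1 - d))) (Cmult Gab B)) as T3.
  assert (0 <= M * beta_tail p q d) by (apply Rmult_le_pos; lra).
  assert (0 <= (Cmod Gab + 1) * beta_tail p q d) by (apply Rmult_le_pos; lra).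
  unfold eps in *. lra.
Qed.
End GammaBeta.

(** * Gamma has no zeros *)

(** The improper integral over the half line in epsilon form, in which linear combinations of
    different Gamma kernels can be compared directly. *)
Definition half_line_int (f : R -> C) (L : C) : Prop :=
  forall eps, 0 < eps -> exists x0 y0, 0 < x0 /\ forall x y, 0 < x <= x0 -> y0 <= y ->
    Cmod (Cminus (CRInt f x y) L) <= eps.

Definition pos_cont (f : R -> C) : Prop := forall t, 0 < t -> Ccont f t.

Lemma half_line_unique (f : R -> C) (L L' : C) :
  half_line_int f L -> half_line_int f L' -> L = L'.
Proof.
  intros H H'. apply C_eq_epsilon. intros eps He.
  destruct (H (eps / 2) ltac:(lra)) as [x0 [y0 [Hx H0]]].
  destruct (H' (eps / 2) ltac:(lra)) as [x1 [y1 [Hx1 H1]]].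
  assert (A : 0 < Rmin x0 x1) by (apply Rmin_glb_lt; assumption).
  pose proof (Rmin_l x0 x1). pose proof (Rmin_r x0 x1).
  pose proof (Rmax_l y0 y1). pose proof (Rmax_r y0 y1).
  assert (B0 := H0 (Rmin x0 x1) (Rmax y0 y1) ltac:(lra) ltac:(lra)).
  assert (B1 := H1 (Rmin x0 x1) (Rmax y0 y1) ltac:(lra) ltac:(lra)).
  pose proof (Cmod_dist L (CRInt f (Rmin x0 x1) (Rmax y0 y1)) L') as T.
  rewrite (Cmod_minus_sym L (CRInt f (Rmin x0 x1) (Rmax y0 y1))) in T. lra.
Qed.

Lemma half_line_plus (f g : R -> C) (L L' : C) : pos_cont f -> pos_cont g ->
  half_line_int f L -> half_line_int g L' -> half_line_int (fun t => Cplus (f t) (g t)) (Cplus L L').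
Proof.
  intros cf cg H H' eps He.
  destruct (H (eps / 2) ltac:(lra)) as [x0 [y0 [Hx H0]]].
  destruct (H' (eps / 2) ltac:(lra)) as [x1 [y1 [Hx1 H1]]].
  exists (Rmin x0 x1), (Rmax 1 (Rmax y0 y1)). split; [apply Rmin_glb_lt; assumption|].
  intros x y Hx' Hy.
  pose proof (Rmin_l x0 x1). pose proof (Rmin_r x0 x1).
  pose proof (Rmax_l y0 y1). pose proof (Rmax_r y0 y1).
  pose proof (Rmax_l 1 (Rmax y0 y1)). pose proof (Rmax_r 1 (Rmax y0 y1)).
  rewrite CRInt_plus.
  - replace (Cminus (Cplus (CRInt f x y) (CRInt g x y)) (Cplus L L')) with
      (Cplus (Cminus (CRInt f x y) L) (Cminus (CRInt g x y) L')) by ring.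
    eapply Rle_trans; [apply Cmod_triangle|].
    assert (B0 := H0 x y ltac:(lra) ltac:(lra)). assert (B1 := H1 x y ltac:(lra) ltac:(lra)). lra.
  - intros t Ht. apply cf, (pos_convex x y); lra.
  - intros t Ht. apply cg, (pos_convex x y); lra.
Qed.

Lemma half_line_scal (k : C) (f : R -> C) (L : C) : pos_cont f ->
  half_line_int f L -> half_line_int (fun t => Cmult k (f t)) (Cmult k L).
Proof.
  intros cf H eps He. pose proof (Cmod_ge_0 k) as Hk.
  destruct (H (eps / (Cmod k + 1))) as [x0 [y0 [Hx H0]]]; [apply Rdiv_lt_0_compat; lra|].
  exists x0, (Rmax 1 y0). split; [exact Hx|]. intros x y Hx' Hy.
  pose proof (Rmax_l 1 y0). pose proof (Rmax_r 1 y0).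
  rewrite CRInt_scal.
  - replace (Cminus (Cmult k (CRInt f x y)) (Cmult k L)) with (Cmult k (Cminus (CRInt f x y) L)) by ring.
    rewrite Cmod_mult. assert (B := H0 x y ltac:(lra) ltac:(lra)).
    pose proof (Cmod_ge_0 (Cminus (CRInt f x y) L)).
    replace eps with ((Cmod k + 1) * (eps / (Cmod k + 1))) by (field; lra). nra.
  - intros t Ht. apply cf, (pos_convex x y); lra.
Qed.

Lemma half_line_Re_ge (f : R -> C) (L : C) (a b : R) : pos_cont f ->
  (forall t, 0 < t -> 0 <= Re (f t)) -> half_line_int f L -> 0 < a <= b ->
  Re (CRInt f a b) <= Re L.
Proof.
  intros cf Hf HL Hab. apply le_epsilon. intros eps He.
  destruct (HL eps He) as [x0 [y0 [Hx H0]]].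
  set (x := Rmin x0 a). set (y := Rmax y0 b).
  assert (Hx' : 0 < x) by (apply Rmin_glb_lt; lra).
  assert (x <= x0) by apply Rmin_l. assert (x <= a) by apply Rmin_r.
  assert (y0 <= y) by apply Rmax_l. assert (b <= y) by apply Rmax_r.
  assert (B := H0 x y ltac:(lra) ltac:(lra)).
  assert (pos : forall u v, 0 < u <= v -> 0 <= Re (CRInt f u v)).
  { intros u v Huv. simpl. apply RInt_ge_0; [lra| |].
    - apply ex_RInt_Re. intros t Ht. apply cf, (pos_convex u v); lra.
    - intros t Ht. apply Hf; lra. }
  assert (ch : forall u v w, 0 < u -> 0 < v -> 0 < w -> Cplus (CRInt f u v) (CRInt f v w) = CRInt f u w).
  { intros u v w Hu Hv Hw. apply (CRInt_Chasles_on (fun t => 0 < t)); auto. exact pos_convex. }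
  rewrite <- (ch x a y), <- (ch a b y) in B by lra.
  pose proof (Re_le_Cmod (Cminus (Cplus (CRInt f x a) (Cplus (CRInt f a b) (CRInt f b y))) L)) as B'.
  pose proof (pos x a ltac:(lra)). pose proof (pos b y ltac:(lra)).
  change (Re (Cminus (Cplus (CRInt f x a) (Cplus (CRInt f a b) (CRInt f b y))) L))
    with (Re (CRInt f x a) + (Re (CRInt f a b) + Re (CRInt f b y)) - Re L) in B'.
  pose proof (Rle_abs (Re (CRInt f x a) + (Re (CRInt f a b) + Re (CRInt f b y)) - Re L)). lra.
Qed.

Definition gamma_value (z G : C) : Prop := forall x y, 0 < x -> 0 < y ->
  Cmod (Cminus (CRInt (gamma_kernel z) x y) G) <=
    gamma_prim (Re z) x + (gamma_bound (Re z) / Re z - gamma_prim (Re z) y).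

Lemma gamma_half_line (z G : C) : 0 < Re z -> gamma_value z G -> half_line_int (gamma_kernel z) G.
Proof.
  intros Hz HG eps He.
  destruct (gamma_prim_small (Re z) (eps / 2) Hz ltac:(lra)) as [d [Hd Hd']].
  destruct (gamma_prim_large (Re z) (eps / 2) Hz ltac:(lra)) as [S [HS HS']].
  exists d, S. split; [exact Hd|]. intros x y Hx Hy.
  eapply Rle_trans; [apply HG; lra|]. specialize (Hd' x Hx). specialize (HS' y Hy). lra.
Qed.

Lemma gamma_pos_cont (z : C) : pos_cont (gamma_kernel z).
Proof. intros t Ht; now apply gamma_kernel_cont. Qed.

(* Integration by parts: the boundary term [t^z e^-t] is the kernel at [z + 1], hence vanishes at both ends. *)
Lemma gamma_recurrence (z G G' : C) : 0 < Re z ->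
  half_line_int (gamma_kernel z) G -> half_line_int (gamma_kernel (Cplus z (RtoC 1))) G' -> G' = Cmult z G.
Proof.
  intros Hz HG HG'.
  set (z' := Cplus z (RtoC 1)) in *.
  set (f := fun t => Cplus (gamma_kernel z' t) (Cmult (Copp z) (gamma_kernel z t))).
  assert (cf : pos_cont f).
  { intros t Ht. apply (Ccont_plus (gamma_kernel z') (fun t => Cmult (Copp z) (gamma_kernel z t)));
      [now apply gamma_kernel_cont|].
    apply (Ccont_mult (fun _ => Copp z) (gamma_kernel z)); [apply Ccont_const | now apply gamma_kernel_cont]. }
  assert (H1 : half_line_int f (Cplus G' (Cmult (Copp z) G))).
  { apply half_line_plus; [apply gamma_pos_cont | | exact HG' |].
    - intros t Ht. apply (Ccont_mult (fun _ => Copp z) (gamma_kernel z)); [apply Ccont_const | now apply gamma_kernel_cont].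
    - apply half_line_scal; [apply gamma_pos_cont | exact HG]. }
  assert (H2 : half_line_int f (RtoC 0)).
  { assert (prim : forall t, 0 < t -> Cderive (fun t => Copp (gamma_kernel z' t)) t (f t)).
    { intros t Ht. unfold gamma_kernel.
      eapply Cderive_eq.
      - apply (Cderive_opp (fun t => Cmult (cpow t (Cminus z' (RtoC 1))) (RtoC (exp (- t))))).
        apply (Cderive_mult (fun t => cpow t (Cminus z' (RtoC 1))) (fun t => RtoC (exp (- t)))).
        + apply cpow_derive, Ht.
        + apply Cderive_RtoC. instantiate (1 := - exp (- t)). auto_derive; [auto | ring].
      - unfold f, gamma_kernel. rewrite RtoC_opp.
        replace (Cminus z' (RtoC 1)) with (Cplus (Cminus z (RtoC 1)) (RtoC 1)) by (unfold z'; ring).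
        rewrite (cpow_plus t (Cminus z (RtoC 1))), cpow_1 by assumption.
        field. intros E. apply RtoC_inj in E. lra. }
    (* One bound for both ends: the power of t / (1 + t) is small at 0, the factor 1 / (1 + t) at
       infinity. *)
    assert (bd : forall t, 0 < t -> Cmod (gamma_kernel z' t) <=
        gamma_bound (Re z + 1) * Rpower (t / (1 + t)) (Re z) * / (1 + t)).
    { intros t Ht. assert (Hz' : 0 < Re z') by (unfold z'; simpl; unfold Re in *; lra).
      eapply Rle_trans; [apply (gamma_kernel_le z' t Hz' Ht)|]. unfold gamma_dom.
      replace (Re z') with (Re z + 1) by reflexivity. replace (Re z + 1 - 1) with (Re z) by ring.
      rewrite Rmult_assoc. apply Rmult_le_compat_l; [left; apply gamma_bound_pos|].
      apply Rmult_le_compat_l; [left; apply exp_pos|].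
      apply Rinv_le_contravar; nra. }
    intros eps He.
    (* [gamma_prim] is used only for its power factor: the quotient of constants removes its own
       prefactor and brings in that of [bd]. *)
    destruct (gamma_prim_small (Re z) (eps / 2 * (gamma_bound (Re z) / Re z / gamma_bound (Re z + 1))) Hz) as [d [Hd Hd']].
    { pose proof (gamma_bound_pos (Re z)). pose proof (gamma_bound_pos (Re z + 1)).
      repeat apply Rmult_lt_0_compat; try lra; apply Rinv_0_lt_compat; lra. }
    exists d, (2 * gamma_bound (Re z + 1) / eps). split; [exact Hd|]. intros x y Hx Hy.
    pose proof (gamma_bound_pos (Re z + 1)) as K1. pose proof (gamma_bound_pos (Re z)) as K0.
    assert (Hy0 : 0 < y).
    { eapply Rlt_le_trans; [|exact Hy]. apply Rdiv_lt_0_compat; lra. }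
    rewrite (CRInt_FTC (fun t => Copp (gamma_kernel z' t)) f).
    2:{ intros t Ht. apply prim, (pos_convex x y); lra. }
    2:{ intros t Ht. apply cf, (pos_convex x y); lra. }
    replace (Cminus (Cminus (Copp (gamma_kernel z' y)) (Copp (gamma_kernel z' x))) (RtoC 0))
      with (Cplus (gamma_kernel z' x) (Copp (gamma_kernel z' y))) by ring.
    eapply Rle_trans; [apply Cmod_triangle|]. rewrite Cmod_opp.
    assert (E : 0 < / (1 + y)) by (apply Rinv_0_lt_compat; lra).
    assert (le1 : forall t, 0 < t -> 0 < Rpower (t / (1 + t)) (Re z) <= 1).
    { intros t Ht. split; [apply exp_pos|].
      pose proof (gamma_prim_le (Re z) t Hz Ht) as L. unfold gamma_prim in L.
      apply Rmult_le_reg_l with (gamma_bound (Re z) / Re z); [apply Rdiv_lt_0_compat; lra | lra]. }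
    assert (A1 : Cmod (gamma_kernel z' x) <= eps / 2).
    { eapply Rle_trans; [apply bd; lra|]. specialize (Hd' x Hx). unfold gamma_prim in Hd'.
      assert (X : Rpower (x / (1 + x)) (Re z) < eps / 2 / gamma_bound (Re z + 1)).
      { apply Rmult_lt_reg_l with (gamma_bound (Re z) / Re z); [apply Rdiv_lt_0_compat; lra|].
        eapply Rlt_le_trans; [exact Hd'|]. right. field. repeat split; lra. }
      apply Rmult_lt_compat_l with (r := gamma_bound (Re z + 1)) in X; [|exact K1].
      replace (gamma_bound (Re z + 1) * (eps / 2 / gamma_bound (Re z + 1))) with (eps / 2) in X by (field; lra).
      assert (0 < / (1 + x) <= 1).
      { split; [apply Rinv_0_lt_compat; lra|]. rewrite <- Rinv_1 at 2. apply Rinv_le_contravar; lra. }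
      pose proof (le1 x ltac:(lra)).
      assert (0 < gamma_bound (Re z + 1) * Rpower (x / (1 + x)) (Re z)) by (apply Rmult_lt_0_compat; lra). nra. }
    assert (A2 : Cmod (gamma_kernel z' y) <= eps / 2).
    { eapply Rle_trans; [apply bd; lra|]. pose proof (le1 y Hy0).
      apply Rle_trans with (gamma_bound (Re z + 1) * / (1 + y)).
      - apply Rmult_le_compat_r; [lra|]. nra.
      - apply Rmult_le_reg_r with (1 + y); [lra|]. rewrite Rmult_assoc, Rinv_l by lra.
        apply Rmult_le_compat_r with (r := eps / 2) in Hy; [|lra].
        replace (2 * gamma_bound (Re z + 1) / eps * (eps / 2)) with (gamma_bound (Re z + 1)) in Hy by (field; lra).
        nra. }
    lra. }
  pose proof (half_line_unique f _ _ H1 H2) as E. apply Cminus_0_eq.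
  rewrite <- E. ring.
Qed.

(** The derivative t - sin t of cos t + t^2 / 2 is nonnegative for t >= 0; evenness gives the
    rest. *)
Lemma one_sub_cos_le (x : R) : 1 - x ^ 2 / 2 <= cos x.
Proof.
  assert (A : forall y, 0 <= y -> sin y <= y).
  { intros y [H | <-]; [left; now apply sin_lt_x | rewrite sin_0; lra]. }
  assert (B : forall x, 0 <= x -> 1 - x ^ 2 / 2 <= cos x).
  { clear x. intros x Hx.
    destruct (MVT_gen (fun t => cos t + t ^ 2 / 2) 0 x (fun t => t - sin t)) as [c [Hc E]].
    - intros t _. auto_derive; [auto | field].
    - intros t _. apply continuity_pt_filterlim, (ex_derive_continuous (V := R_NormedModule) (fun t => cos t + t ^ 2 / 2)). auto_derive; auto.
    - rewrite Rmin_left, Rmax_right in Hc by assumption.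
      rewrite cos_0 in E. pose proof (A c ltac:(lra)).
      assert (0 <= (c - sin c) * (x - 0)) by (apply Rmult_le_pos; lra). nra. }
  destruct (Rle_dec 0 x) as [H|H]; [now apply B|].
  rewrite <- cos_neg. replace (x ^ 2) with ((- x) ^ 2) by ring. apply B. lra.
Qed.

(** With u = e^x this is |x| <= 2 sinh(|x| / 2), squared. The right side is a combination of u, 1
    and 1 / u; against a Gamma kernel these give neighbouring Gamma values, which the recurrence
    links. *)
Lemma ln_sqr_le (u : R) : 0 < u -> ln u ^ 2 <= u - 2 + / u.
Proof.
  intros Hu.
  assert (A : forall v, 0 < v -> (1 <= v -> ln v ^ 2 <= v - 2 + / v)).
  { clear u Hu. intros v Hv H1.
    (* With w = sqrt v, ln w <= (w - 1/w) / 2. *)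
    set (w := sqrt v).
    assert (Hw : 1 <= w) by (unfold w; rewrite <- sqrt_1; now apply sqrt_le_1_alt).
    assert (Hv2 : v = w * w) by (unfold w; now rewrite sqrt_sqrt by lra).
    assert (L : ln w <= (w - / w) / 2).
    { destruct (MVT_gen (fun t => (t - / t) / 2 - ln t) 1 w (fun t => (1 + / t ^ 2) / 2 - / t)) as [c [Hc E]].
      - rewrite Rmin_left, Rmax_right by assumption. intros t Ht. auto_derive; [split; [lra | split; [lra | auto]] | field; lra].
      - rewrite Rmin_left, Rmax_right by assumption. intros t Ht.
        apply continuity_pt_filterlim, (ex_derive_continuous (V := R_NormedModule) (fun t => (t - / t) / 2 - ln t)). auto_derive. split; [lra | split; [lra | auto]].
      - rewrite Rmin_left, Rmax_right in Hc by assumption.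
        rewrite ln_1, Rinv_1 in E.
        assert (P : 0 <= (1 + / c ^ 2) / 2 - / c).
        { replace ((1 + / c ^ 2) / 2 - / c) with ((1 - / c) ^ 2 / 2) by (field; lra). pose proof (pow2_ge_0 (1 - / c)). lra. }
        assert (0 <= ((1 + / c ^ 2) / 2 - / c) * (w - 1)) by (apply Rmult_le_pos; lra). lra. }
    assert (L0 : 0 <= ln w) by (rewrite <- ln_1; apply ln_le; lra).
    rewrite Hv2. rewrite ln_mult by lra.
    replace (w * w - 2 + / (w * w)) with ((w - / w) ^ 2) by (field; lra).
    replace (ln w + ln w) with (2 * ln w) by ring. apply pow_incr. lra. }
  destruct (Rle_dec 1 u) as [H|H]; [now apply A|].
  assert (Hi : 1 <= / u) by (rewrite <- Rinv_1; apply Rinv_le_contravar; lra).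
  pose proof (A (/ u) ltac:(lra) Hi) as B. rewrite ln_Rinv, Rinv_inv in B by assumption.
  replace ((- ln u) ^ 2) with (ln u ^ 2) in B by ring. lra.
Qed.

Lemma gamma_kernel_real (s t : R) : gamma_kernel (RtoC s) t = RtoC (Rpower t (s - 1) * exp (- t)).
Proof.
  unfold gamma_kernel. rewrite <- RtoC_minus, cpow_Rpower, RtoC_mult. reflexivity.
Qed.

Lemma gamma_real_pos (s : R) (G : C) : 0 < s -> half_line_int (gamma_kernel (RtoC s)) G -> 0 < Re G.
Proof.
  intros Hs HG. eapply Rlt_le_trans.
  2:{ apply (half_line_Re_ge (gamma_kernel (RtoC s)) G 1 2); [apply gamma_pos_cont | | exact HG | lra].
      intros t Ht. rewrite gamma_kernel_real. simpl. left. apply Rmult_lt_0_compat; apply exp_pos. }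
  change (0 < RInt (fun t => Re (gamma_kernel (RtoC s) t)) 1 2). apply RInt_gt_0; [lra | |].
  - intros t Ht. rewrite gamma_kernel_real. simpl. apply Rmult_lt_0_compat; apply exp_pos.
  - intros t Ht. apply (gamma_kernel_cont (RtoC s) t). lra.
Qed.

(* For large Re z the integrand concentrates near t = s, where t^(i tau) is almost constant. *)
Lemma gamma_neq_0_large (s tau : R) (G : C) : 1 < s -> tau ^ 2 / 2 < s - 1 ->
  half_line_int (gamma_kernel (s, tau)) G -> G <> RtoC 0.
Proof.
  intros Hs Ht HG E.
  assert (ex : forall r, 0 < r -> exists G, half_line_int (gamma_kernel (RtoC r)) G).
  { intros r Hr. destruct (gamma_exists (RtoC r) Hr) as [g [_ Hg]]. exists g. now apply gamma_half_line. }
  destruct (ex (s - 1) ltac:(lra)) as [G0 H0]. destruct (ex s ltac:(lra)) as [G1 H1].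
  destruct (ex (s + 1) ltac:(lra)) as [G2 H2].
  assert (E1 : G1 = Cmult (RtoC (s - 1)) G0).
  { apply (gamma_recurrence (RtoC (s - 1))); [simpl; lra | exact H0|].
    rewrite <- RtoC_plus. replace (s - 1 + 1) with s by ring. exact H1. }
  assert (E2 : G2 = Cmult (RtoC s) G1).
  { apply (gamma_recurrence (RtoC s)); [simpl; lra | exact H1|]. rewrite <- RtoC_plus. exact H2. }
  pose proof (gamma_real_pos s G1 ltac:(lra) H1) as Pos.
  (* [c] rotates the kernel so that its phase tau ln (t / s) vanishes at t = s. *)
  set (c := cpow s (Copp (0, tau))). set (k := tau ^ 2 / 2).
  (* The real part of [D] is t^(s - 1) e^(-t) times cos(theta) - (1 - k (t / s - 2 + s / t)), where
     theta = tau ln (t / s). It is nonnegative because cos(theta) >= 1 - theta^2 / 2 and [ln_sqr_le]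
     bounds theta^2. The factors t and 1 / t are absorbed by the kernels at s + 1 and s - 1. *)
  set (D := fun t => Cplus (Cmult c (gamma_kernel (s, tau) t))
     (Cplus (Cmult (RtoC (- 1 - 2 * k)) (gamma_kernel (RtoC s) t))
     (Cplus (Cmult (RtoC (k / s)) (gamma_kernel (RtoC (s + 1)) t))
            (Cmult (RtoC (k * s)) (gamma_kernel (RtoC (s - 1)) t))))).
  assert (sc : forall a z, pos_cont (fun t => Cmult a (gamma_kernel z t))).
  { intros a z t Hpt. apply (Ccont_mult (fun _ => a) (gamma_kernel z)); [apply Ccont_const | now apply gamma_kernel_cont]. }
  assert (pl : forall f g, pos_cont f -> pos_cont g -> pos_cont (fun t => Cplus (f t) (g t))).
  { intros f g cf cg t Hpt. apply (Ccont_plus f g); auto. }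
  assert (HD : half_line_int D (Cplus (Cmult c G) (Cplus (Cmult (RtoC (- 1 - 2 * k)) G1)
      (Cplus (Cmult (RtoC (k / s)) G2) (Cmult (RtoC (k * s)) G0))))).
  { pose proof (half_line_scal c _ _ (gamma_pos_cont _) HG) as I1.
    pose proof (half_line_scal (RtoC (- 1 - 2 * k)) _ _ (gamma_pos_cont _) H1) as I2.
    pose proof (half_line_scal (RtoC (k / s)) _ _ (gamma_pos_cont _) H2) as I3.
    pose proof (half_line_scal (RtoC (k * s)) _ _ (gamma_pos_cont _) H0) as I4.
    pose proof (half_line_plus _ _ _ _ (sc _ _) (sc _ _) I3 I4) as I34.
    pose proof (half_line_plus _ _ _ _ (sc _ _) (pl _ _ (sc _ _) (sc _ _)) I2 I34) as I234.
    exact (half_line_plus _ _ _ _ (sc _ _) (pl _ _ (sc _ _) (pl _ _ (sc _ _) (sc _ _))) I1 I234). }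
  assert (cD : pos_cont D) by exact (pl _ _ (sc _ _) (pl _ _ (sc _ _) (pl _ _ (sc _ _) (sc _ _)))).
  assert (PD : forall t, 0 < t -> 0 <= Re (D t)).
  { intros t Hpt. unfold D. rewrite !gamma_kernel_real.
    assert (K1 : Cmult c (gamma_kernel (s, tau) t) =
       Cmult (cexp (0, tau * ln (t / s))) (RtoC (Rpower t (s - 1) * exp (- t)))).
    { unfold c, gamma_kernel. rewrite RtoC_mult, <- cpow_Rpower, !Cmult_assoc. f_equal.
      replace (Cminus (s, tau) (RtoC 1)) with (Cplus (RtoC (s - 1)) (0, tau)).
      2:{ unfold Cminus, Cplus, Copp, RtoC; simpl; f_equal; ring. }
      rewrite cpow_plus. unfold cpow. rewrite <- !cexp_plus. f_equal.
      rewrite ln_div by lra. unfold Cplus, Cmult, Copp, RtoC; simpl; f_equal; ring. }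
    rewrite K1. unfold cexp. simpl. rewrite exp_0.
    set (P := Rpower t (s - 1) * exp (- t)).
    assert (HP : 0 < P) by (apply Rmult_lt_0_compat; apply exp_pos).
    assert (Q2 : Rpower t (s + 1 - 1) * exp (- t) = t * P).
    { unfold P. replace (s + 1 - 1) with (s - 1 + 1) by ring. rewrite Rpower_plus, Rpower_1 by assumption. ring. }
    assert (Q0 : Rpower t (s - 1 - 1) * exp (- t) = / t * P).
    { unfold P. replace (s - 1) with (s - 1 - 1 + 1) at 2 by ring. rewrite Rpower_plus, Rpower_1 by assumption. field. lra. }
    rewrite Q2, Q0. fold P.
    set (th := tau * ln (t / s)).
    assert (Cs : 1 - k * (t / s - 2 + s / t) <= cos th).
    { pose proof (one_sub_cos_le th) as O.
      assert (Hts : 0 < t / s) by (apply Rdiv_lt_0_compat; lra).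
      pose proof (ln_sqr_le (t / s) Hts) as Lq. replace (/ (t / s)) with (s / t) in Lq by (field; lra).
      assert (k * ln (t / s) ^ 2 <= k * (t / s - 2 + s / t)).
      { apply Rmult_le_compat_l; [unfold k; pose proof (pow2_ge_0 tau); lra | exact Lq]. }
      replace (th ^ 2 / 2) with (k * ln (t / s) ^ 2) in O by (unfold th, k; field). lra. }
    match goal with |- 0 <= ?X => replace X with (P * (cos th - (1 - k * (t / s - 2 + s / t)))) by (field; lra) end.
    apply Rmult_le_pos; lra. }
  (* The empty interval [1, 1] gives just that the whole integral has nonnegative real part. If [G]
     were 0, the recurrences would turn it into (k - (s - 1)) Gamma(s - 1), which is negative. *)
  pose proof (half_line_Re_ge D _ 1 1 cD PD HD ltac:(lra)) as R0.
  rewrite E, E2, E1 in R0. rewrite E1 in Pos.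
  simpl in R0. rewrite RInt_point in R0. unfold zero in R0; simpl in R0.
  simpl in Pos. unfold Re in *.
  match type of R0 with 0 <= ?X => replace X with (fst G0 * (k - (s - 1))) in R0 by (field; lra) end.
  assert (0 < fst G0) by nra. fold k in Ht. nra.
Qed.

(** By the recurrence a zero at z would be a zero at every z + n. The imaginary part stays fixed
    while the real part grows, so [gamma_neq_0_large] eventually excludes this. *)
Lemma gamma_neq_0 (z G : C) : 0 < Re z -> gamma_value z G -> G <> RtoC 0.
Proof.
  intros Hz HG E.
  assert (A : forall n G', half_line_int (gamma_kernel (Cplus z (RtoC (INR n)))) G' -> G' = RtoC 0).
  { induction n as [|n IH]; intros G' H'.
    - simpl in H'. replace (Cplus z (RtoC 0)) with z in H' by ring.
      rewrite <- E. apply (half_line_unique (gamma_kernel z)); [exact H' | now apply gamma_half_line].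
    - assert (Hp : 0 < Re (Cplus z (RtoC (INR n)))).
      { simpl. unfold Re in Hz. pose proof (pos_INR n). lra. }
      destruct (gamma_exists _ Hp) as [g [_ Hg]]. apply gamma_half_line in Hg; [|exact Hp].
      rewrite (gamma_recurrence (Cplus z (RtoC (INR n))) g G' Hp Hg).
      + rewrite (IH g Hg). ring.
      + replace (Cplus (Cplus z (RtoC (INR n))) (RtoC 1)) with (Cplus z (RtoC (INR (S n)))); [exact H'|].
        rewrite S_INR, RtoC_plus. ring. }
  destruct (INR_unbounded (1 + Im z ^ 2 / 2)) as [n Hn].
  assert (Hp : 0 < Re (Cplus z (RtoC (INR n)))).
  { simpl. unfold Re in Hz. pose proof (pos_INR n). lra. }
  destruct (gamma_exists _ Hp) as [g [_ Hg]]. apply gamma_half_line in Hg; [|exact Hp].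
  pose proof (A n g Hg) as Eg. revert Eg.
  pose proof (pow2_ge_0 (Im z)).
  apply (gamma_neq_0_large (Re z + INR n) (Im z)); [lra | lra |].
  replace (Re z + INR n, Im z) with (Cplus z (RtoC (INR n))); [exact Hg|].
  unfold Cplus, RtoC, Re, Im; simpl. f_equal; ring.
Qed.

(** * Hypergeometric series *)

Definition Csum (s : nat -> C) (l : C) : Prop :=
  is_series (fun n => Re (s n)) (Re l) /\ is_series (fun n => Im (s n)) (Im l).

Lemma Csum_plus (s s' : nat -> C) (l l' : C) :
  Csum s l -> Csum s' l' -> Csum (fun n => Cplus (s n) (s' n)) (Cplus l l').
Proof.
  intros [H1 H2] [H3 H4]; split.
  - exact (is_series_plus (V := R_NormedModule) (fun n => Re (s n)) (fun n => Re (s' n)) _ _ H1 H3).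
  - exact (is_series_plus (V := R_NormedModule) (fun n => Im (s n)) (fun n => Im (s' n)) _ _ H2 H4).
Qed.

Lemma Csum_scal (k : C) (s : nat -> C) (l : C) :
  Csum s l -> Csum (fun n => Cmult k (s n)) (Cmult k l).
Proof.
  intros [H1 H2]; split.
  - exact (is_series_minus (V := R_NormedModule) _ _ _ _
      (is_series_scal (V := R_NormedModule) (Re k) _ _ H1) (is_series_scal (V := R_NormedModule) (Im k) _ _ H2)).
  - exact (is_series_plus (V := R_NormedModule) _ _ _ _
      (is_series_scal (V := R_NormedModule) (Re k) _ _ H2) (is_series_scal (V := R_NormedModule) (Im k) _ _ H1)).
Qed.

Lemma Csum_ext (s s' : nat -> C) (l : C) : (forall n, s n = s' n) -> Csum s l -> Csum s' l.
Proof.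
  intros E [H1 H2]; split.
  - apply (is_series_ext (fun n => Re (s n))); [intros n; now rewrite E | exact H1].
  - apply (is_series_ext (fun n => Im (s n))); [intros n; now rewrite E | exact H2].
Qed.

Lemma Csum_unique (s : nat -> C) (l l' : C) : Csum s l -> Csum s l' -> l = l'.
Proof.
  intros [H1 H2] [H3 H4]. apply is_series_unique in H1, H2, H3, H4.
  destruct l, l'; unfold Re, Im in *; simpl in *. f_equal; congruence.
Qed.

Lemma RtoC_m1 : RtoC (-1) = Copp (RtoC 1).
Proof. unfold RtoC, Copp; simpl. f_equal; ring. Qed.

Definition shift_right (s : nat -> C) (n : nat) : C := match n with O => RtoC 0 | S m => s m end.

Lemma Csum_shift (s : nat -> C) (l : C) : Csum s l -> Csum (shift_right s) l.
Proof.
  assert (A : forall (a b : nat -> R) (x : R), b 0%nat = 0 -> (forall n, b (S n) = a n) -> is_series a x -> is_series b x).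
  { intros a b x H0 HS H. apply (is_series_decr_1 b). rewrite H0.
    change (plus x (opp 0)) with (x + - 0). rewrite Ropp_0, Rplus_0_r.
    apply (is_series_ext a); [intros n; now rewrite HS | exact H]. }
  intros [H1 H2]; split.
  - now apply (A (fun n => Re (s n))).
  - now apply (A (fun n => Im (s n))).
Qed.

(** Only real arguments occur along the deformation, so complex coefficients with a real variable
    suffice, and the theory of real power series applies to each component. *)
Definition CPS (u : nat -> C) (x : R) : C :=
  (PSeries (fun n => Re (u n)) x, PSeries (fun n => Im (u n)) x).

(** Radius of convergence at least 1, in the form of Cauchy bounds. It applies to both components at
    once and survives termwise differentiation. *)
Definition bounded_below_1 (u : nat -> C) : Prop :=
  forall r, 0 <= r < 1 -> exists M, forall n, Cmod (u n) * r ^ n <= M.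

Lemma bounded_radius (u : nat -> C) (p : C -> R) (x : R) : (forall z, Rabs (p z) <= Cmod z) ->
  bounded_below_1 u -> Rabs x < 1 -> Rbar_lt (Rabs x) (CV_radius (fun n => p (u n))).
Proof.
  intros Hp H Hx. pose proof (Rabs_pos x) as H0.
  destruct (H ((1 + Rabs x) / 2) ltac:(lra)) as [M HM].
  eapply (Rbar_lt_le_trans _ (Finite ((1 + Rabs x) / 2))); [simpl; lra|].
  apply (proj1 (CV_radius_bounded (fun n => p (u n)))). exists M. intros n.
  rewrite Rabs_mult, (Rabs_right (_ ^ n)) by (apply Rle_ge, pow_le; lra).
  eapply Rle_trans; [|apply (HM n)]. apply Rmult_le_compat_r; [apply pow_le; lra | apply Hp].
Qed.

Lemma CPS_sum (u : nat -> C) (x : R) : bounded_below_1 u -> Rabs x < 1 ->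
  Csum (fun n => Cmult (u n) (RtoC (x ^ n))) (CPS u x).
Proof.
  intros H Hx.
  assert (A : forall p : C -> R, (forall z, Rabs (p z) <= Cmod z) ->
     is_series (fun n => p (u n) * x ^ n) (PSeries (fun n => p (u n)) x)).
  { intros p Hp. pose proof (bounded_radius u p x Hp H Hx) as B.
    apply CV_radius_inside, PSeries_correct in B.
    apply (is_series_ext (fun n => scal (pow_n x n) (p (u n)))); [|exact B].
    intros n. rewrite pow_n_pow. unfold scal; simpl; unfold mult; simpl. ring. }
  split; simpl.
  - apply (is_series_ext (fun n => Re (u n) * x ^ n)); [intros n; unfold Re; simpl; ring | apply A, Re_le_Cmod].
  - apply (is_series_ext (fun n => Im (u n) * x ^ n)); [intros n; unfold Re, Im; simpl; ring | apply A, Im_le_Cmod].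
Qed.

Definition deriv_coef (u : nat -> C) (n : nat) : C := Cmult (RtoC (INR (S n))) (u (S n)).

Lemma CPS_derive (u : nat -> C) (x : R) : bounded_below_1 u -> Rabs x < 1 ->
  Cderive (CPS u) x (CPS (deriv_coef u) x).
Proof.
  intros H Hx. split; simpl.
  - rewrite (PSeries_ext _ (PS_derive (fun n => Re (u n)))).
    + apply is_derive_PSeries. now apply (bounded_radius u Re x Re_le_Cmod).
    + intros n. unfold deriv_coef, PS_derive, Re; simpl. ring.
  - rewrite (PSeries_ext _ (PS_derive (fun n => Im (u n)))).
    + apply is_derive_PSeries. now apply (bounded_radius u Im x Im_le_Cmod).
    + intros n. unfold deriv_coef, PS_derive, Re, Im; simpl. ring.
Qed.

Lemma deriv_coef_bounded (u : nat -> C) : bounded_below_1 u -> bounded_below_1 (deriv_coef u).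
Proof.
  intros H r Hr. set (q := (1 + r) / 2). assert (Hq : 0 < q < 1) by (unfold q; lra).
  destruct (H q ltac:(lra)) as [M HM].
  (* (n + 1) (r / q)^n is bounded, by Bernoulli's inequality applied to q / r. *)
  assert (M0 : 0 <= M) by (pose proof (HM 0%nat); pose proof (Cmod_ge_0 (u 0%nat)); simpl in *; lra).
  assert (B : exists K, 0 <= K /\ forall n, INR (S n) * r ^ n <= K * q ^ S n).
  { destruct (Req_dec r 0) as [->|Hr0].
    (* Since 0 ^ 0 = 1, the term n = 0 is the only one that does not vanish, and 1 / q turns its
       inequality into an equality. *)
    - exists (/ q). split; [left; apply Rinv_0_lt_compat; lra|]. intros [|n].
      + simpl. right. field. lra.
      + rewrite pow_i by lia. rewrite Rmult_0_r. apply Rmult_le_pos; [left; apply Rinv_0_lt_compat; lra | apply pow_le; lra].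
    - set (h := q / r - 1).
      assert (Hh : 0 < h).
      { unfold h. assert (1 < q / r); [|lra]. apply Rmult_lt_reg_r with r; [lra|].
        unfold Rdiv. rewrite Rmult_assoc, Rinv_l by lra. unfold q; lra. }
      exists ((1 + / h) / q). assert (Hih : 0 < / h) by now apply Rinv_0_lt_compat.
      split; [left; apply Rdiv_lt_0_compat; lra|]. intros n.
      assert (Be : forall m, 1 + INR m * h <= (1 + h) ^ m).
      { induction m as [|m IH]; [simpl; lra|]. rewrite S_INR. simpl. pose proof (pos_INR m). nra. }
      specialize (Be n). replace (1 + h) with (q / r) in Be by (unfold h; ring).
      unfold Rdiv in Be. rewrite Rpow_mult_distr, pow_inv in Be.
      assert (Hrn : 0 < r ^ n) by (apply pow_lt; lra).
      assert (X : (1 + INR n * h) * r ^ n <= q ^ n).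
      { apply Rmult_le_compat_r with (r := r ^ n) in Be; [|lra].
        replace (q ^ n * / r ^ n * r ^ n) with (q ^ n) in Be by (field; lra). exact Be. }
      replace ((1 + / h) / q * q ^ S n) with ((1 + / h) * q ^ n) by (simpl; field; lra).
      rewrite S_INR. pose proof (pos_INR n).
      apply Rle_trans with ((1 + / h) * ((1 + INR n * h) * r ^ n)); [|apply Rmult_le_compat_l; lra].
      rewrite <- Rmult_assoc. apply Rmult_le_compat_r; [lra|].
      replace ((1 + / h) * (1 + INR n * h)) with (INR n + 1 + INR n * h + / h) by (field; lra). nra. }
  destruct B as [K [HK HB]]. exists (K * M). intros n.
  unfold deriv_coef. rewrite Cmod_mult, Cmod_R, Rabs_right by (apply Rle_ge, pos_INR).
  specialize (HB n). specialize (HM (S n)). pose proof (Cmod_ge_0 (u (S n))).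
  assert (0 <= q ^ S n) by (apply pow_le; lra).
  apply Rle_trans with (Cmod (u (S n)) * (K * q ^ S n)); nra.
Qed.

Definition hyp_coef (a b c : C) (n : nat) : C :=
  Cdiv (Cmult (poch a n) (poch b n)) (Cmult (RtoC (INR (fact n))) (poch c n)).

Lemma plus_nat_neq_0 (c : C) (n : nat) : 0 < Re c -> Cplus c (RtoC (INR n)) <> RtoC 0.
Proof.
  intros H E. apply (f_equal Re) in E. simpl in E. pose proof (pos_INR n). unfold Re in H. lra.
Qed.

Lemma poch_neq_0 (c : C) (n : nat) : 0 < Re c -> poch c n <> RtoC 0.
Proof.
  intros H. induction n as [|n IH]; simpl.
  - intros E. apply RtoC_inj in E. lra.
  - apply Cmult_neq_0; [exact IH | now apply plus_nat_neq_0].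
Qed.

Lemma fact_C_neq_0 (n : nat) : RtoC (INR (fact n)) <> RtoC 0.
Proof. intros E. apply RtoC_inj in E. now apply (INR_fact_neq_0 n). Qed.

Lemma succ_C_neq_0 (n : nat) : RtoC (INR (S n)) <> RtoC 0.
Proof. intros E. apply RtoC_inj in E. rewrite S_INR in E. pose proof (pos_INR n). lra. Qed.

Lemma fact_S_C (n : nat) : RtoC (INR (fact (S n))) = Cmult (RtoC (INR (S n))) (RtoC (INR (fact n))).
Proof. rewrite <- RtoC_mult, <- mult_INR. reflexivity. Qed.

Lemma hyp_coef_S (a b c : C) (n : nat) : 0 < Re c ->
  hyp_coef a b c (S n) = Cmult (hyp_coef a b c n)
    (Cdiv (Cmult (Cplus a (RtoC (INR n))) (Cplus b (RtoC (INR n))))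
          (Cmult (RtoC (INR (S n))) (Cplus c (RtoC (INR n))))).
Proof.
  intros Hc. unfold hyp_coef. rewrite fact_S_C. simpl poch.
  pose proof (poch_neq_0 c n Hc). pose proof (plus_nat_neq_0 c n Hc).
  pose proof (fact_C_neq_0 n). pose proof (succ_C_neq_0 n).
  field. repeat split; assumption.
Qed.

Lemma eventually_decreasing_bounded (N : nat) : forall f : nat -> R,
  (forall n, (N <= n)%nat -> f (S n) <= f n) -> exists M, forall n, f n <= M.
Proof.
  induction N as [|N IH]; intros f H.
  - exists (f 0%nat). induction n as [|n IHn]; [lra|]. specialize (H n ltac:(lia)). lra.
  - destruct (IH (fun n => f (S n))) as [M HM]; [intros n Hn; apply H; lia|].
    exists (Rmax M (f 0%nat)). intros [|n]; [apply Rmax_r|]. eapply Rle_trans; [apply HM | apply Rmax_l].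
Qed.

Lemma hyp_coef_bounded (a b c : C) : 0 < Re c -> bounded_below_1 (hyp_coef a b c).
Proof.
  intros Hc r Hr. set (A := Cmod a + Cmod b).
  pose proof (Cmod_ge_0 a) as Ha. pose proof (Cmod_ge_0 b) as Hb.
  (* The ratio of consecutive terms is at most r (n + A)^2 / n^2. For n >= 1 it is at most 1 as soon
     as (2 A + A^2) r <= n (1 - r). *)
  destruct (INR_unbounded ((2 * A + A * A) * r / (1 - r))) as [N HN].
  apply (eventually_decreasing_bounded (S N)). intros n Hn.
  rewrite hyp_coef_S by assumption. rewrite Cmod_mult. simpl pow.
  set (rho := Cdiv _ _).
  assert (Hn1 : 1 <= INR n) by (apply (le_INR 1); lia).
  assert (HNn : INR N <= INR n) by (apply le_INR; lia).
  enough (Cmod rho * r <= 1).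
  { pose proof (Cmod_ge_0 (hyp_coef a b c n)). assert (0 <= r ^ n) by (apply pow_le; lra).
    assert (0 <= Cmod (hyp_coef a b c n) * r ^ n) by now apply Rmult_le_pos. nra. }
  unfold rho. pose proof (plus_nat_neq_0 c n Hc) as Hcn. pose proof (succ_C_neq_0 n) as Hsn.
  rewrite Cmod_div by now apply Cmult_neq_0. rewrite !Cmod_mult.
  assert (B1 : Cmod (Cplus a (RtoC (INR n))) <= INR n + A).
  { eapply Rle_trans; [apply Cmod_triangle|]. rewrite Cmod_R, Rabs_right by (apply Rle_ge, pos_INR). unfold A; lra. }
  assert (B2 : Cmod (Cplus b (RtoC (INR n))) <= INR n + A).
  { eapply Rle_trans; [apply Cmod_triangle|]. rewrite Cmod_R, Rabs_right by (apply Rle_ge, pos_INR). unfold A; lra. }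
  assert (B3 : INR n <= Cmod (Cplus c (RtoC (INR n)))).
  { eapply Rle_trans; [|apply Re_le_Cmod]. simpl. unfold Re in Hc. rewrite Rabs_right; lra. }
  assert (B4 : INR n <= Cmod (RtoC (INR (S n)))).
  { rewrite Cmod_R, Rabs_right by (apply Rle_ge, pos_INR). rewrite S_INR. lra. }
  assert (HA : (2 * A + A * A) * r <= INR n * (1 - r)).
  { apply Rmult_le_reg_r with (/ (1 - r)); [apply Rinv_0_lt_compat; lra|].
    replace (INR n * (1 - r) * / (1 - r)) with (INR n) by (field; lra). unfold Rdiv in HN. lra. }
  assert (A0 : 0 <= A) by (unfold A; lra).
  set (U := Cmod (Cplus a (RtoC (INR n)))) in *. set (V := Cmod (Cplus b (RtoC (INR n)))) in *.
  set (W := Cmod (Cplus c (RtoC (INR n)))) in *. set (Z := Cmod (RtoC (INR (S n)))) in *.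
  assert (0 <= U) by apply Cmod_ge_0. assert (0 <= V) by apply Cmod_ge_0.
  set (x := INR n) in *.
  apply Rmult_le_reg_r with (Z * W); [nra|].
  replace (U * V / (Z * W) * r * (Z * W)) with (U * V * r) by (field; split; nra).
  assert (X1 : U * V <= (x + A) * (x + A)) by (apply Rmult_le_compat; lra).
  assert (X2 : x * x <= Z * W) by (apply Rmult_le_compat; lra).
  assert (X3 : (x + A) * (x + A) * r <= x * x).
  { assert (A * A * r <= A * A * r * x).
    { assert (0 <= A * A * r) by (apply Rmult_le_pos; nra). nra. }
    assert ((2 * A + A * A) * r * x <= x * (1 - r) * x) by (apply Rmult_le_compat_r; lra). nra. }
  assert (U * V * r <= (x + A) * (x + A) * r) by (apply Rmult_le_compat_r; lra). lra.
Qed.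

Lemma poch_shift (a : C) (n : nat) : Cmult a (poch (Cplus a (RtoC 1)) n) = Cmult (poch a n) (Cplus a (RtoC (INR n))).
Proof.
  induction n as [|n IH]; [simpl; ring|].
  simpl poch. rewrite Cmult_assoc, IH, S_INR, RtoC_plus. ring.
Qed.

(** The coefficients of (c - b) / c times the series with [a] and [c] raised by 1. For b = - beta
    and c = alpha this is the function G; the prefactor is what makes (1 - x) F' equal to a (F -
    G). *)
Definition hyp_companion (a b c : C) (n : nat) : C :=
  Cmult (Cdiv (Cminus c b) c) (hyp_coef (Cplus a (RtoC 1)) b (Cplus c (RtoC 1)) n).

(** * The first order system satisfied by the series and its companion *)

Section System.
Variables (a b c : C).
Hypothesis Hc : 0 < Re c.
Let u := hyp_coef a b c.
Let v := hyp_companion a b c.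

Let Hc1 : 0 < Re (Cplus c (RtoC 1)).
Proof. simpl. unfold Re in Hc. lra. Qed.

Let c_neq_0 : c <> RtoC 0.
Proof. intros E. rewrite E in Hc. simpl in Hc. lra. Qed.

Lemma companion_bounded : bounded_below_1 v.
Proof.
  intros r Hr. destruct (hyp_coef_bounded (Cplus a (RtoC 1)) b _ Hc1 r Hr) as [M HM].
  exists (Cmod (Cdiv (Cminus c b) c) * M). intros n. unfold v, hyp_companion.
  rewrite Cmod_mult, Rmult_assoc. apply Rmult_le_compat_l; [apply Cmod_ge_0 | apply HM].
Qed.

(** [poch_shift] expresses a v(n) as a rational multiple of u(n). The factor [a] stays on the right
    because [a] may be 0. *)
Lemma coef_relation_1 (n : nat) :
  Cminus (deriv_coef u n) (Cmult (RtoC (INR n)) (u n)) = Cmult a (Cminus (u n) (v n)).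
Proof.
  assert (E : Cmult a (v n) = Cmult (Cdiv (Cmult (Cminus c b) (Cplus a (RtoC (INR n)))) (Cplus c (RtoC (INR n)))) (u n)).
  { unfold u, v, hyp_companion, hyp_coef.
    pose proof (poch_neq_0 c n Hc). pose proof (plus_nat_neq_0 c n Hc).
    pose proof (fact_C_neq_0 n). pose proof (poch_neq_0 _ n Hc1).
    transitivity (Cdiv (Cmult (Cminus c b) (Cmult (Cmult a (poch (Cplus a (RtoC 1)) n)) (poch b n)))
       (Cmult (RtoC (INR (fact n))) (Cmult c (poch (Cplus c (RtoC 1)) n)))).
    - field. repeat split; assumption.
    - rewrite !poch_shift. field. repeat split; assumption. }
  replace (Cmult a (Cminus (u n) (v n))) with (Cminus (Cmult a (u n)) (Cmult a (v n))) by ring.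
  rewrite E. unfold deriv_coef, u. rewrite hyp_coef_S by assumption.
  pose proof (plus_nat_neq_0 c n Hc). pose proof (succ_C_neq_0 n).
  field. split; assumption.
Qed.

Lemma coef_relation_2 (n : nat) :
  Cmult (Cplus c (RtoC (INR (S n)))) (v (S n)) =
  Cplus (Cmult (Cminus c b) (u (S n))) (Cmult (Cplus b (RtoC (INR n))) (v n)).
Proof.
  assert (E : u (S n) = Cdiv (Cmult (Cmult a (poch (Cplus a (RtoC 1)) n)) (Cmult (poch b n) (Cplus b (RtoC (INR n)))))
     (Cmult (Cmult (RtoC (INR (S n))) (RtoC (INR (fact n)))) (Cmult c (poch (Cplus c (RtoC 1)) n)))).
  { unfold u, hyp_coef. rewrite fact_S_C. simpl poch. rewrite !poch_shift. reflexivity. }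
  rewrite E. unfold v, hyp_companion. rewrite hyp_coef_S by assumption. unfold hyp_coef.
  pose proof (fact_C_neq_0 n). pose proof (poch_neq_0 _ n Hc1). pose proof (succ_C_neq_0 n).
  pose proof (plus_nat_neq_0 _ n Hc1). pose proof (plus_nat_neq_0 c (S n) Hc).
  rewrite S_INR, RtoC_plus in *.
  field. repeat split; assumption.
Qed.

Variable x : R.
Hypothesis Hx : Rabs x < 1.

Lemma pow_S_C (n : nat) : RtoC (x ^ S n) = Cmult (RtoC x) (RtoC (x ^ n)).
Proof. simpl. apply RtoC_mult. Qed.

(** Coefficients are compared: multiplication by x shifts a series, so x F' has the coefficients n
    u(n), and [coef_relation_1] applies termwise. *)
Lemma hyp_relation_1 :
  Cmult (RtoC (1 - x)) (CPS (deriv_coef u) x) = Cmult a (Cminus (CPS u x) (CPS v x)).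
Proof.
  assert (Bu : bounded_below_1 u) by exact (hyp_coef_bounded a b c Hc).
  pose proof companion_bounded as Bv.
  pose proof (CPS_sum _ x (deriv_coef_bounded _ Bu) Hx) as S1.
  pose proof (Csum_shift _ _ (Csum_scal (RtoC x) _ _ S1)) as S2.
  pose proof (Csum_plus _ _ _ _ S1 (Csum_scal (RtoC (-1)) _ _ S2)) as L.
  pose proof (Csum_scal a _ _ (Csum_plus _ _ _ _ (CPS_sum u x Bu Hx) (Csum_scal (RtoC (-1)) _ _ (CPS_sum v x Bv Hx)))) as Rr.
  assert (E : Cplus (CPS (deriv_coef u) x) (Cmult (RtoC (-1)) (Cmult (RtoC x) (CPS (deriv_coef u) x))) =
     Cmult a (Cplus (CPS u x) (Cmult (RtoC (-1)) (CPS v x)))).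
  { eapply Csum_unique; [exact L|]. refine (Csum_ext _ _ _ _ Rr). intros n.
    transitivity (Cmult (Cmult a (Cminus (u n) (v n))) (RtoC (x ^ n))).
    - rewrite RtoC_m1. ring.
    - rewrite <- coef_relation_1. destruct n as [|n]; unfold shift_right.
      + simpl INR. ring.
      + rewrite pow_S_C. unfold deriv_coef. rewrite RtoC_m1. ring. }
  rewrite RtoC_minus. transitivity (Cmult a (Cplus (CPS u x) (Cmult (RtoC (-1)) (CPS v x)))).
  - rewrite <- E. rewrite RtoC_m1. ring.
  - rewrite RtoC_m1. ring.
Qed.

Lemma hyp_relation_2 :
  Cmult (RtoC (x * (1 - x))) (CPS (deriv_coef v) x) =
  Cminus (Cmult (Cminus c b) (CPS u x)) (Cmult (Cminus c (Cmult b (RtoC x))) (CPS v x)).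
Proof.
  assert (Bu : bounded_below_1 u) by exact (hyp_coef_bounded a b c Hc).
  pose proof companion_bounded as Bv.
  pose proof (CPS_sum _ x (deriv_coef_bounded _ Bv) Hx) as S1.
  pose proof (Csum_shift _ _ (Csum_scal (RtoC x) _ _ S1)) as S2.
  pose proof (Csum_shift _ _ (Csum_scal (RtoC x) _ _ S2)) as S3.
  pose proof (CPS_sum u x Bu Hx) as Su. pose proof (CPS_sum v x Bv Hx) as Sv.
  pose proof (Csum_shift _ _ (Csum_scal (RtoC x) _ _ Sv)) as Sv1.
  pose proof (Csum_plus _ _ _ _ S2 (Csum_scal (RtoC (-1)) _ _ S3)) as L.
  pose proof (Csum_plus _ _ _ _ (Csum_scal (Cminus c b) _ _ Su)
     (Csum_plus _ _ _ _ (Csum_scal (Copp c) _ _ Sv) (Csum_scal b _ _ Sv1))) as Rr.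
  assert (E : Cplus (Cmult (RtoC x) (CPS (deriv_coef v) x))
       (Cmult (RtoC (-1)) (Cmult (RtoC x) (Cmult (RtoC x) (CPS (deriv_coef v) x)))) =
     Cplus (Cmult (Cminus c b) (CPS u x)) (Cplus (Cmult (Copp c) (CPS v x)) (Cmult b (Cmult (RtoC x) (CPS v x))))).
  { eapply Csum_unique; [exact L|]. refine (Csum_ext _ _ _ _ Rr). intros n.
    destruct n as [|n]; unfold shift_right.
    (* The constant coefficient is checked by hand, because [coef_relation_2] relates index n + 1 to
       n and starts at 1. *)
    - assert (E0 : Cmult c (v 0%nat) = Cmult (Cminus c b) (u 0%nat)).
      { unfold u, v, hyp_companion, hyp_coef. simpl. field. exact c_neq_0. }
      transitivity (Cmult (Cminus (Cmult (Cminus c b) (u 0%nat)) (Cmult c (v 0%nat))) (RtoC (x ^ 0))); [ring|].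
      rewrite E0. ring.
    - rewrite pow_S_C.
      transitivity (Cmult (Cplus (Cminus (Cmult (Cminus c b) (u (S n))) (Cmult c (v (S n)))) (Cmult b (v n)))
        (Cmult (RtoC x) (RtoC (x ^ n)))); [ring|].
      replace (Cmult (Cminus c b) (u (S n))) with
        (Cminus (Cmult (Cplus c (RtoC (INR (S n)))) (v (S n))) (Cmult (Cplus b (RtoC (INR n))) (v n)))
        by (rewrite coef_relation_2; ring).
      rewrite RtoC_m1. destruct n as [|n].
      + unfold deriv_coef. simpl INR. ring.
      + rewrite pow_S_C. unfold deriv_coef. ring. }
  rewrite RtoC_mult, RtoC_minus.
  transitivity (Cplus (Cmult (Cminus c b) (CPS u x)) (Cplus (Cmult (Copp c) (CPS v x)) (Cmult b (Cmult (RtoC x) (CPS v x))))); [|ring].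
  rewrite <- E. rewrite RtoC_m1. ring.
Qed.
End System.

Lemma is_series_Csum (s : nat -> C) (l : C) :
  is_series (K := C_AbsRing) (V := C_NormedModule) s l -> Csum s l.
Proof.
  intros H.
  assert (Sre : forall n, Re (sum_n (G := C_NormedModule) s n) = sum_n (fun k => Re (s k)) n).
  { induction n as [|n IH]; [now rewrite !sum_O|]. rewrite !sum_Sn, <- IH. reflexivity. }
  assert (Sim : forall n, Im (sum_n (G := C_NormedModule) s n) = sum_n (fun k => Im (s k)) n).
  { induction n as [|n IH]; [now rewrite !sum_O|]. rewrite !sum_Sn, <- IH. reflexivity. }
  split.
  - apply (filterlim_ext (fun n => Re (sum_n (G := C_NormedModule) s n)) _ Sre).
    apply (filterlim_comp _ _ _ _ Re _ _ _ H).
    intros P [eps HP]. exists eps. intros z Hz. apply HP. apply Hz.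
  - apply (filterlim_ext (fun n => Im (sum_n (G := C_NormedModule) s n)) _ Sim).
    apply (filterlim_comp _ _ _ _ Im _ _ _ H).
    intros P [eps HP]. exists eps. intros z Hz. apply HP. apply Hz.
Qed.

Lemma pow_n_RtoC (x : R) (n : nat) : pow_n (K := C_Ring) (RtoC x) n = RtoC (x ^ n).
Proof.
  induction n as [|n IH]; [reflexivity|]. simpl. rewrite IH. rewrite RtoC_mult. reflexivity.
Qed.

Lemma F21_CPS (a b c l : C) (x : R) : 0 < Re c -> Rabs x < 1 ->
  is_series (K := C_AbsRing) (V := C_NormedModule) (F21_term a b c (RtoC x)) l ->
  l = CPS (hyp_coef a b c) x.
Proof.
  intros Hc Hx H. apply (Csum_unique (F21_term a b c (RtoC x))).
  - now apply is_series_Csum.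
  - eapply Csum_ext; [|exact (CPS_sum _ x (hyp_coef_bounded a b c Hc) Hx)].
    intros n. unfold F21_term, hyp_coef.
    change (@pow_n C_Ring (RtoC x) n) with (@pow_n C_Ring (RtoC x) n).
    replace (pow_n (RtoC x) n) with (RtoC (x ^ n)) by (symmetry; apply pow_n_RtoC).
    pose proof (poch_neq_0 c n Hc). pose proof (fact_C_neq_0 n). field. split; assumption.
Qed.

Lemma CPS_0 (u : nat -> C) : CPS u 0 = u 0%nat.
Proof. unfold CPS. rewrite !PSeries_0. symmetry. apply surjective_pairing. Qed.

(** * The certificates *)


(* Everything is expressed through x, s, t and Z = c - x^2.  The numeral 2 is written
   1 + 1 because [ring] and [field] on C do not interpret RtoC 2. *)
Section Certificate.
Local Open Scope C_scope.
Variables (al be x s t Z F G F1 G1 : C).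
Let a := x - s * t.
Let w := x + s * (1 - t).
Let X := Z + x * s * t.
Let W := Z - x * s * (1 - t).
Let Y := Z + x * x - a * w.
(** [Lt] and [Ls] are the logarithmic derivatives in t and s of X^be W^(be - 1) Z^(-2 be), where x
    has t-derivative s and s-derivative - (1 - t). Likewise [zt] and [zs] are the partial
    derivatives of the argument x s t / X. *)
Let Lt := - (be * (a * s) / X) - (be - 1) * (w * s) / W + (1 + 1) * be * ((1 + 1) * x * s) / Z.
Let Ls := be * (x + a * (1 - t)) / X + (be - 1) * (w * (1 - t)) / W - (1 + 1) * be * ((1 + 1) * x * (1 - t)) / Z.
Let zt := s * ((s * t + x) * X + x * t * (a * s)) / (X * X).
Let zs := t * ((x - s * (1 - t)) * X - x * s * (x + a * (1 - t))) / (X * X).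
(** The certificate for J: its product with t^al (1 - t)^be X^be W^(be - 1) Z^(-2 be) is the
    function whose t-derivative telescopes. [B1t] is its derivative in t. *)
Let B1 := (- w * F + (1 + 1) * x * W / Z * (F - G)) / Y.
Let B1t := (- w * (zt * F1) + ((1 + 1) * (s * W - x * (w * s)) / Z + (1 + 1) * x * W * ((1 + 1) * x * s) / (Z * Z)) * (F - G)
            + (1 + 1) * x * W / Z * (zt * F1 - zt * G1)) / Y.
Hypothesis HX : X <> 0.
Hypothesis HW : W <> 0.
Hypothesis HY : Y <> 0.
Hypothesis HZ : Z <> 0.
Hypothesis rel1 : Z * F1 = (al - be - 1) * X * (F - G).
Hypothesis rel2 : x * s * t * Z * G1 = X * X * (al + be) * F - X * (al * X + be * (x * s * t)) * G.

(** With the common factor t^(al - 1) (1 - t)^(be - 1) X^be W^(be - 1) Z^(-2 be) removed, the left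
    side is the t-derivative of the boundary function. The right side is the s-derivative of the
    integrand of J minus k times the integrand of E. After [rel1] eliminates [F1], the difference of
    the two sides is a multiple of [rel2]. *)
Lemma certificate_1 :
  (al * (1 - t) - be * t) * B1 + t * (1 - t) * (Lt * B1 + B1t) =
  Ls * F + zs * F1 - (al + be - 1) * w / Y * (F - t * G).
Proof.
  assert (E1 : F1 = (al - be - 1) * X * (F - G) / Z).
  { rewrite <- rel1. field. exact HZ. }
  (* The coefficient of [G1] in the left side, divided by x s t Z. With this multiplier [rel2] is
     never solved for [G1], as x, s or t may be 0. *)
  set (k := - ((1 + 1) * (1 - t) * W * ((s * t + x) * X + x * t * (a * s)) / (Y * Z * Z * X * X))).
  assert (D : (al * (1 - t) - be * t) * B1 + t * (1 - t) * (Lt * B1 + B1t) -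
    (Ls * F + zs * F1 - (al + be - 1) * w / Y * (F - t * G)) =
    k * (x * s * t * Z * G1 - (X * X * (al + be) * F - X * (al * X + be * (x * s * t)) * G))).
  { unfold k, B1, B1t, Lt, Ls, zt, zs. rewrite E1. unfold Y, W, X, a, w in *. field.
    repeat split; assumption. }
  rewrite rel2 in D.
  transitivity ((al * (1 - t) - be * t) * B1 + t * (1 - t) * (Lt * B1 + B1t) -
    (Ls * F + zs * F1 - (al + be - 1) * w / Y * (F - t * G)) +
    (Ls * F + zs * F1 - (al + be - 1) * w / Y * (F - t * G))); [ring|].
  rewrite D. ring.
Qed.

Hypothesis Hs : s <> 0.

(** The certificate for E adds G / s to that for J. What remains after [certificate_1] says that the
    integral of t G alone has s-derivative (al + be) / s times E; it is 1 / (s X^2) times [rel2]. *)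
Lemma certificate_2 :
  (al * (1 - t) - be * t) * (B1 + G / s) + t * (1 - t) * (Lt * (B1 + G / s) + (B1t + zt * G1 / s)) =
  Ls * (F - t * G) + zs * (F1 - t * G1) - ((al + be - 1) * w / Y - (al + be) / s) * (F - t * G).
Proof.
  pose proof certificate_1 as C1.
  assert (D : (al * (1 - t) - be * t) * (G / s) + t * (1 - t) * (Lt * (G / s) + zt * G1 / s) -
     (- (Ls * (t * G)) - zs * (t * G1) + (al + be) / s * (F - t * G)) =
     / (s * (X * X)) * (x * s * t * Z * G1 - (X * X * (al + be) * F - X * (al * X + be * (x * s * t)) * G))).
  { unfold Lt, Ls, zt, zs. unfold W, X, a, w in *. field. repeat split; assumption. }
  rewrite rel2 in D.
  transitivity (((al * (1 - t) - be * t) * B1 + t * (1 - t) * (Lt * B1 + B1t)) +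
    ((al * (1 - t) - be * t) * (G / s) + t * (1 - t) * (Lt * (G / s) + zt * G1 / s) -
     (- (Ls * (t * G)) - zs * (t * G1) + (al + be) / s * (F - t * G))) +
     (- (Ls * (t * G)) - zs * (t * G1) + (al + be) / s * (F - t * G))).
  { unfold Cdiv. ring. }
  rewrite C1, D. unfold Cdiv. ring.
Qed.
End Certificate.

(** * The deformation *)

Ltac rcont :=
  lazymatch goal with
  | |- continuous (fun u => fst u) ?x => apply continuous_fst
  | |- continuous (fun u => snd u) ?x => apply continuous_snd
  | |- continuous (fun u => @?f u + @?g u) ?x => apply (rcont_plus f g x); cbv beta; rcont
  | |- continuous (fun u => @?f u - @?g u) ?x => apply (rcont_minus f g x); cbv beta; rcont
  | |- continuous (fun u => - @?f u) ?x => apply (rcont_opp f x); cbv beta; rcont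
  | |- continuous (fun u => @?f u * @?g u) ?x => apply (rcont_mult f g x); cbv beta; rcont
  | |- continuous (fun u => / @?f u) ?x => apply (rcont_inv f x); cbv beta; [rcont|]
  | |- _ => try apply continuous_const
  end.

Ltac ccont :=
  lazymatch goal with
  | |- Ccont (fun u => Cplus (@?f u) (@?g u)) ?x => apply (Ccont_plus f g x); cbv beta; ccont
  | |- Ccont (fun u => Cminus (@?f u) (@?g u)) ?x => apply (Ccont_minus f g x); cbv beta; ccont
  | |- Ccont (fun u => Copp (@?f u)) ?x => apply (Ccont_opp f x); cbv beta; ccont
  | |- Ccont (fun u => Cmult (@?f u) (@?g u)) ?x => apply (Ccont_mult f g x); cbv beta; ccont
  | |- Ccont (fun u => RtoC (@?f u)) ?x => apply (Ccont_RtoC f x); cbv beta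
  | |- _ => try apply Ccont_const
  end.

Lemma cpow_derive_comp (h : R -> R) (k : C) (x dh : R) : is_derive h x dh -> 0 < h x ->
  Cderive (fun u => cpow (h u) k) x (Cmult (cpow (h x) k) (Cmult k (RtoC (dh / h x)))).
Proof.
  intros H H0. eapply Cderive_eq; [apply (Cderive_comp (fun v => cpow v k) h x dh); [apply cpow_derive, H0 | exact H]|].
  cbv beta. unfold Rdiv. rewrite RtoC_mult, RtoC_inv by lra. field. intros E. apply RtoC_inj in E. lra.
Qed.

Lemma continuous_slice_r (h : R * R -> R) (s t : R) : continuous h (s, t) -> continuous (fun u => h (s, u)) t.
Proof.
  intros H. apply (continuous_comp_2 (fun _ => s) (fun u => u) (fun u v => h (u, v)) t).
  - apply continuous_const.
  - apply continuous_id.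
  - apply (continuous_ext h); [intros [u v]; reflexivity | exact H].
Qed.

Lemma Ccont_slice_r (h : R -> R -> C) (s t : R) :
  Ccont (fun p : R * R => h (fst p) (snd p)) (s, t) -> Ccont (h s) t.
Proof.
  intros [H1 H2]; split.
  - exact (continuous_slice_r (fun p => Re (h (fst p) (snd p))) s t H1).
  - exact (continuous_slice_r (fun p => Im (h (fst p) (snd p))) s t H2).
Qed.

(** By uniform continuity, n equal steps along the segment from the origin to (x, y) change [h] by
    less than 1 each; hence the bound |h(0, 0)| + n. *)
Lemma real_bounded_on_square (h : R -> R -> R) :
  (forall x y, 0 <= x <= 1 -> 0 <= y <= 1 -> continuous (fun p : R * R => h (fst p) (snd p)) (x, y)) ->
  exists M, forall x y, 0 <= x <= 1 -> 0 <= y <= 1 -> Rabs (h x y) <= M.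
Proof.
  intros H.
  destruct (uniform_continuity_2d h 0 1 0 1) with (eps := mkposreal 1 Rlt_0_1) as [d Hd].
  { intros x y Hx Hy. apply continuity_2d_pt_filterlim. apply (H x y Hx Hy). }
  destruct (INR_unbounded (/ d)) as [n Hn].
  assert (Hd0 : 0 < / d) by (apply Rinv_0_lt_compat, cond_pos).
  assert (Hn0 : 0 < INR n) by lra.
  assert (Hnd : / INR n < d).
  { rewrite <- (Rinv_inv d). apply Rinv_lt_contravar; [apply Rmult_lt_0_compat; lra | exact Hn]. }
  exists (Rabs (h 0 0) + INR n). intros x y Hx Hy.
  assert (A : forall k, (k <= n)%nat -> Rabs (h (INR k / INR n * x) (INR k / INR n * y)) <= Rabs (h 0 0) + INR k).
  { induction k as [|k IH]; intros Hk.
    - simpl INR. unfold Rdiv. rewrite !Rmult_0_l. lra.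
    - specialize (IH ltac:(lia)). rewrite S_INR.
      assert (K0 : 0 <= INR k) by apply pos_INR.
      assert (K1 : INR k + 1 <= INR n) by (rewrite <- S_INR; now apply le_INR).
      assert (Hinv : 0 < / INR n) by now apply Rinv_0_lt_compat.
      assert (R0 : forall j, 0 <= j <= INR n -> 0 <= j / INR n <= 1).
      { intros j Hj. split; [apply Rmult_le_pos; lra|]. apply Rmult_le_reg_r with (INR n); [lra|].
        unfold Rdiv. rewrite Rmult_assoc, Rinv_l by lra. lra. }
      pose proof (R0 (INR k) ltac:(lra)) as A1. pose proof (R0 (INR k + 1) ltac:(lra)) as A2.
      assert (D : Rabs (h ((INR k + 1) / INR n * x) ((INR k + 1) / INR n * y) - h (INR k / INR n * x) (INR k / INR n * y)) < 1).
      { apply (Hd (INR k / INR n * x) (INR k / INR n * y)); try (split; nra).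
        - replace ((INR k + 1) / INR n * x - INR k / INR n * x) with (/ INR n * x) by (field; lra).
          rewrite Rabs_right by nra. nra.
        - replace ((INR k + 1) / INR n * y - INR k / INR n * y) with (/ INR n * y) by (field; lra).
          rewrite Rabs_right by nra. nra. }
      pose proof (Rabs_triang_inv (h ((INR k + 1) / INR n * x) ((INR k + 1) / INR n * y)) (h (INR k / INR n * x) (INR k / INR n * y))).
      lra. }
  specialize (A n (le_n n)). replace (INR n / INR n) with 1 in A by (field; lra). rewrite !Rmult_1_l in A. exact A.
Qed.

Lemma C_bounded_on_square (h : R -> R -> C) :
  (forall x y, 0 <= x <= 1 -> 0 <= y <= 1 -> Ccont (fun p : R * R => h (fst p) (snd p)) (x, y)) ->
  exists M, forall x y, 0 <= x <= 1 -> 0 <= y <= 1 -> Cmod (h x y) <= M.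
Proof.
  intros H.
  destruct (real_bounded_on_square (fun x y => Re (h x y))) as [M1 H1]; [intros x y Hx Hy; apply (H x y Hx Hy)|].
  destruct (real_bounded_on_square (fun x y => Im (h x y))) as [M2 H2]; [intros x y Hx Hy; apply (H x y Hx Hy)|].
  exists (M1 + M2). intros x y Hx Hy. eapply Rle_trans; [apply Cmod_le_Re_Im|].
  specialize (H1 x y Hx Hy). specialize (H2 x y Hx Hy). lra.
Qed.

Section Deformation.
Variables (al be : C) (w c : R) (f g f1 g1 : R -> C).
Hypothesis Hw : w * w < c.
Hypothesis f_derive : forall z, Rabs z < 1 -> Cderive f z (f1 z).
Hypothesis g_derive : forall z, Rabs z < 1 -> Cderive g z (g1 z).
Hypothesis f1_cont : forall z, Rabs z < 1 -> Ccont f1 z.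
Hypothesis g1_cont : forall z, Rabs z < 1 -> Ccont g1 z.
(** [f] and [g] stand for F and G. Besides smoothness and the value [f] 0 = 1, this system is all
    that the deformation knows of the hypergeometric series. *)
Hypothesis fg_rel_1 : forall z, Rabs z < 1 ->
  Cmult (RtoC (1 - z)) (f1 z) = Cmult (Cminus (Cminus al be) (RtoC 1)) (Cminus (f z) (g z)).
Hypothesis fg_rel_2 : forall z, Rabs z < 1 ->
  Cmult (RtoC (z * (1 - z))) (g1 z) =
  Cminus (Cmult (Cplus al be) (f z)) (Cmult (Cplus al (Cmult be (RtoC z))) (g z)).

(* At s = 1 and with w = a + 1 these are a, a + t, c - a (a + t), c - (a + 1) (a + t),
   c - (a + t)^2, c - a (a + 1) and the argument of the hypergeometric function. *)
Definition da (s : R) : R := w - s.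
Definition dx (s t : R) : R := w - s * (1 - t).
Definition dX (s t : R) : R := c - da s * dx s t.
Definition dW (s t : R) : R := c - w * dx s t.
Definition dZ (s t : R) : R := c - dx s t * dx s t.
Definition dY (s : R) : R := c - da s * w.
Definition dz (s t : R) : R := dx s t * (s * t) * / dX s t.

(** An open condition, so that derivatives in s are two-sided also at s = 0 and s = 1. Together with
    w^2 < c it makes every denominator positive. *)
Definition admissible (s : R) : Prop := da s * da s < c.

Section Point.
Variables s t : R.
Hypothesis Hs : admissible s.
Hypothesis Ht : 0 <= t <= 1.

(** [dx] is the convex combination (1 - t) (w - s) + t w, and the square is convex: the gap is t (1
    - t) s^2. The end points are covered by [admissible] and [Hw]. *)
Lemma dZ_pos : 0 < dZ s t.
Proof.
  unfold admissible, da in *. unfold dZ, dx.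
  assert (0 <= t * (1 - t) * (s * s)) by (apply Rmult_le_pos; nra).
  assert ((1 - t) * ((w - s) * (w - s)) + t * (w * w) < c).
  { destruct (Req_dec t 0) as [->|]; [lra|]. nra. }
  nra.
Qed.

(** From 2 a x <= a^2 + x^2 < 2 c. The same argument gives [dW_pos] and [dY_pos]. *)
Lemma dX_pos : 0 < dX s t.
Proof. pose proof dZ_pos. unfold dX, dZ, admissible in *. pose proof (Rle_0_sqr (da s - dx s t)). unfold Rsqr in *. nra. Qed.

Lemma dW_pos : 0 < dW s t.
Proof. pose proof dZ_pos. unfold dW, dZ in *. pose proof (Rle_0_sqr (w - dx s t)). unfold Rsqr in *. nra. Qed.

Lemma dY_pos : 0 < dY s.
Proof. unfold dY, admissible in *. pose proof (Rle_0_sqr (da s - w)). unfold Rsqr in *. nra. Qed.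

Lemma dz_compl : 1 - dz s t = dZ s t / dX s t.
Proof. pose proof dX_pos. unfold dz. apply Rmult_eq_reg_r with (dX s t); [|lra]. field_simplify; [|lra|lra]. unfold dX, dZ, dx, da. ring. Qed.

(** With x = a + s t, both 1 - z = Z / X and 1 + z = (c - a^2 + s^2 t^2) / X are quotients of
    positive numbers. *)
Lemma dz_lt_1 : Rabs (dz s t) < 1.
Proof.
  pose proof dX_pos as HX. pose proof dZ_pos as HZ. pose proof dz_compl as E.
  assert (0 < dZ s t / dX s t) by now apply Rdiv_lt_0_compat.
  assert (E2 : 1 + dz s t = (c - da s * da s + (s * t) * (s * t)) / dX s t).
  { unfold dz. apply Rmult_eq_reg_r with (dX s t); [|lra]. field_simplify; [|lra|lra]. unfold dX, dx, da. ring. }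
  assert (0 < (c - da s * da s + (s * t) * (s * t)) / dX s t).
  { apply Rdiv_lt_0_compat; [|exact HX]. unfold admissible in Hs. nra. }
  apply Rabs_def1; lra.
Qed.
End Point.

Lemma admissible_0 : admissible 0.
Proof. unfold admissible, da. rewrite Rminus_0_r. exact Hw. Qed.

Lemma open_admissible : open admissible.
Proof.
  unfold admissible. apply (open_comp (fun s => da s * da s) (fun u => u < c)).
  - intros s _. unfold da.
    apply (ex_derive_continuous (V := R_NormedModule) (fun s => (w - s) * (w - s))). auto_derive; auto.
  - apply open_lt.
Qed.

Definition dX_s (s t : R) : R := dx s t + da s * (1 - t).
Definition dW_s (t : R) : R := w * (1 - t).
Definition dZ_s (s t : R) : R := (1 + 1) * dx s t * (1 - t).
Definition dz_s (s t : R) : R :=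
  t * ((dx s t - s * (1 - t)) * dX s t - dx s t * s * dX_s s t) * / (dX s t * dX s t).
Definition dz_t (s t : R) : R :=
  s * ((s * t + dx s t) * dX s t + dx s t * t * (da s * s)) * / (dX s t * dX s t).

Definition base (s t : R) : C :=
  Cmult (Cmult (cpow (dX s t) be) (cpow (dW s t) (Cminus be (RtoC 1)))) (cpow (dZ s t) (Copp (Cplus be be))).

Definition base_log_s (s t : R) : C :=
  Cplus (Cplus (Cmult be (RtoC (dX_s s t * / dX s t))) (Cmult (Cminus be (RtoC 1)) (RtoC (dW_s t * / dW s t))))
    (Cmult (Copp (Cplus be be)) (RtoC (dZ_s s t * / dZ s t))).

Definition base_log_t (s t : R) : C :=
  Cplus (Cplus (Cmult be (RtoC (- (da s * s) * / dX s t))) (Cmult (Cminus be (RtoC 1)) (RtoC (- (w * s) * / dW s t))))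
    (Cmult (Copp (Cplus be be)) (RtoC (- ((1 + 1) * dx s t * s) * / dZ s t))).

Definition coef_V (s t : R) : R := (1 + 1) * dx s t * dW s t * / dZ s t.
Definition coef_V_t (s t : R) : R :=
  (1 + 1) * (s * dW s t - dx s t * (w * s)) * / dZ s t
  + (1 + 1) * dx s t * dW s t * ((1 + 1) * dx s t * s) * / (dZ s t * dZ s t).

(** The certificate [B1] along the path, with [coef_V] = 2 x W / Z as the weight of F - G. *)
Definition flux (s t : R) : C :=
  Cmult (Cplus (Cmult (RtoC (- w)) (f (dz s t))) (Cmult (RtoC (coef_V s t)) (Cminus (f (dz s t)) (g (dz s t)))))
    (RtoC (/ dY s)).

Definition flux_t (s t : R) : C :=
  Cmult (Cplus (Cmult (RtoC (- w)) (Cmult (RtoC (dz_t s t)) (f1 (dz s t))))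
    (Cplus (Cmult (RtoC (coef_V_t s t)) (Cminus (f (dz s t)) (g (dz s t))))
           (Cmult (RtoC (coef_V s t)) (Cminus (Cmult (RtoC (dz_t s t)) (f1 (dz s t))) (Cmult (RtoC (dz_t s t)) (g1 (dz s t)))))))
    (RtoC (/ dY s)).

Definition qf (s t : R) : C := Cmult (base s t) (f (dz s t)).
Definition qe (s t : R) : C := Cmult (base s t) (Cminus (f (dz s t)) (Cmult (RtoC t) (g (dz s t)))).
Definition q1 (s t : R) : C := Cmult (base s t) (flux s t).
(** s times the boundary function of E. Clearing the pole at s = 0 makes it continuous, hence
    bounded, on the whole closed square. *)
Definition q2 (s t : R) : C := Cmult (base s t) (Cplus (Cmult (RtoC s) (flux s t)) (g (dz s t))).
Definition qf_s (s t : R) : C :=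
  Cmult (base s t) (Cplus (Cmult (base_log_s s t) (f (dz s t))) (Cmult (RtoC (dz_s s t)) (f1 (dz s t)))).
Definition qe_s (s t : R) : C :=
  Cmult (base s t) (Cplus (Cmult (base_log_s s t) (Cminus (f (dz s t)) (Cmult (RtoC t) (g (dz s t)))))
    (Cmult (RtoC (dz_s s t)) (Cminus (f1 (dz s t)) (Cmult (RtoC t) (g1 (dz s t)))))).

(** * Joint continuity in s and t, for differentiation under the integral and for bounds on the
    square *)

Section Continuity.
Variables s t : R.
Hypothesis Hs : admissible s.
Hypothesis Ht : 0 <= t <= 1.

Ltac geo_neq_0 := cbn [fst snd];
  pose proof (dX_pos s t Hs Ht); pose proof (dW_pos s t Hs Ht); pose proof (dZ_pos s t Hs Ht);
  pose proof (dY_pos s Hs); unfold dX, dW, dZ, dY, dx, da in *; nra.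

Lemma dX_cont : continuous (fun p : R * R => dX (fst p) (snd p)) (s, t).
Proof. unfold dX, dx, da. rcont. Qed.
Lemma dW_cont : continuous (fun p : R * R => dW (fst p) (snd p)) (s, t).
Proof. unfold dW, dx, da. rcont. Qed.
Lemma dZ_cont : continuous (fun p : R * R => dZ (fst p) (snd p)) (s, t).
Proof. unfold dZ, dx, da. rcont. Qed.
Lemma dz_cont : continuous (fun p : R * R => dz (fst p) (snd p)) (s, t).
Proof. unfold dz, dX, dx, da. rcont. geo_neq_0. Qed.

Lemma base_cont : Ccont (fun p : R * R => base (fst p) (snd p)) (s, t).
Proof.
  unfold base. ccont.
  - apply (cpow_cont (fun p : R * R => dX (fst p) (snd p))); [apply dX_cont | now apply dX_pos].
  - apply (cpow_cont (fun p : R * R => dW (fst p) (snd p))); [apply dW_cont | now apply dW_pos].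
  - apply (cpow_cont (fun p : R * R => dZ (fst p) (snd p))); [apply dZ_cont | now apply dZ_pos].
Qed.

Lemma comp_dz_cont (h : R -> C) : Ccont h (dz s t) -> Ccont (fun p : R * R => h (dz (fst p) (snd p))) (s, t).
Proof. intros H. apply (Ccont_comp h (fun p : R * R => dz (fst p) (snd p))); [apply dz_cont | exact H]. Qed.

Lemma f_dz_cont : Ccont (fun p : R * R => f (dz (fst p) (snd p))) (s, t).
Proof. apply comp_dz_cont. eapply Cderive_Ccont, f_derive. now apply dz_lt_1. Qed.
Lemma g_dz_cont : Ccont (fun p : R * R => g (dz (fst p) (snd p))) (s, t).
Proof. apply comp_dz_cont. eapply Cderive_Ccont, g_derive. now apply dz_lt_1. Qed.
Lemma f1_dz_cont : Ccont (fun p : R * R => f1 (dz (fst p) (snd p))) (s, t).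
Proof. apply comp_dz_cont, f1_cont. now apply dz_lt_1. Qed.
Lemma g1_dz_cont : Ccont (fun p : R * R => g1 (dz (fst p) (snd p))) (s, t).
Proof. apply comp_dz_cont, g1_cont. now apply dz_lt_1. Qed.

Lemma base_log_s_cont : Ccont (fun p : R * R => base_log_s (fst p) (snd p)) (s, t).
Proof.
  unfold base_log_s, dX_s, dW_s, dZ_s, dX, dW, dZ, dx, da. ccont; rcont; geo_neq_0.
Qed.

Lemma dz_s_cont : continuous (fun p : R * R => dz_s (fst p) (snd p)) (s, t).
Proof. unfold dz_s, dX_s, dX, dx, da. rcont. apply Rmult_integral_contrapositive_currified; geo_neq_0. Qed.

Lemma flux_cont : Ccont (fun p : R * R => flux (fst p) (snd p)) (s, t).
Proof.
  unfold flux. ccont; try apply f_dz_cont; try apply g_dz_cont.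
  - rcont.
  - unfold coef_V, dW, dZ, dx, da. rcont. geo_neq_0.
  - unfold dY, da. rcont. geo_neq_0.
Qed.

Lemma qf_cont : Ccont (fun p : R * R => qf (fst p) (snd p)) (s, t).
Proof. unfold qf. ccont; [apply base_cont | apply f_dz_cont]. Qed.
Lemma qe_cont : Ccont (fun p : R * R => qe (fst p) (snd p)) (s, t).
Proof. unfold qe. ccont; [apply base_cont | apply f_dz_cont | rcont | apply g_dz_cont]. Qed.
Lemma q1_cont : Ccont (fun p : R * R => q1 (fst p) (snd p)) (s, t).
Proof. unfold q1. ccont; [apply base_cont | apply flux_cont]. Qed.
Lemma q2_cont : Ccont (fun p : R * R => q2 (fst p) (snd p)) (s, t).
Proof. unfold q2. ccont; [apply base_cont | rcont | apply flux_cont | apply g_dz_cont]. Qed.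
Lemma qf_s_cont : Ccont (fun p : R * R => qf_s (fst p) (snd p)) (s, t).
Proof.
  unfold qf_s. ccont; [apply base_cont | apply base_log_s_cont | apply f_dz_cont | apply dz_s_cont | apply f1_dz_cont].
Qed.
Lemma qe_s_cont : Ccont (fun p : R * R => qe_s (fst p) (snd p)) (s, t).
Proof.
  unfold qe_s. ccont; [apply base_cont | apply base_log_s_cont | apply f_dz_cont | rcont | apply g_dz_cont
    | apply dz_s_cont | apply f1_dz_cont | rcont | apply g1_dz_cont].
Qed.
End Continuity.

(** * Partial derivatives in s and t *)

Section Derivatives.
Variables s t : R.
Hypothesis Hs : admissible s.
Hypothesis Ht : 0 <= t <= 1.

Lemma base_derive_s : Cderive (fun s => base s t) s (Cmult (base s t) (base_log_s s t)).
Proof.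
  pose proof (dX_pos s t Hs Ht). pose proof (dW_pos s t Hs Ht). pose proof (dZ_pos s t Hs Ht).
  unfold base. eapply Cderive_eq.
  - apply (Cderive_mult (fun s => Cmult (cpow (dX s t) be) (cpow (dW s t) (Cminus be (RtoC 1))))
      (fun s => cpow (dZ s t) (Copp (Cplus be be)))).
    + apply (Cderive_mult (fun s => cpow (dX s t) be) (fun s => cpow (dW s t) (Cminus be (RtoC 1)))).
      * apply (cpow_derive_comp (fun s => dX s t) be s (dX_s s t)); [|assumption].
        unfold dX, dX_s, dx, da. auto_derive; [auto | ring].
      * apply (cpow_derive_comp (fun s => dW s t) _ s (dW_s t)); [|assumption].
        unfold dW, dW_s, dx. auto_derive; [auto | ring].
    + apply (cpow_derive_comp (fun s => dZ s t) _ s (dZ_s s t)); [|assumption].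
      unfold dZ, dZ_s, dx. auto_derive; [auto | ring].
  - unfold base_log_s, Rdiv. cbv beta. ring.
Qed.

Lemma base_derive_t : Cderive (base s) t (Cmult (base s t) (base_log_t s t)).
Proof.
  pose proof (dX_pos s t Hs Ht). pose proof (dW_pos s t Hs Ht). pose proof (dZ_pos s t Hs Ht).
  unfold base. eapply Cderive_eq.
  - apply (Cderive_mult (fun t => Cmult (cpow (dX s t) be) (cpow (dW s t) (Cminus be (RtoC 1))))
      (fun t => cpow (dZ s t) (Copp (Cplus be be)))).
    + apply (Cderive_mult (fun t => cpow (dX s t) be) (fun t => cpow (dW s t) (Cminus be (RtoC 1)))).
      * apply (cpow_derive_comp (fun t => dX s t) be t (- (da s * s))); [|assumption].
        unfold dX, dx. auto_derive; [auto | ring].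
      * apply (cpow_derive_comp (fun t => dW s t) _ t (- (w * s))); [|assumption].
        unfold dW, dx. auto_derive; [auto | ring].
    + apply (cpow_derive_comp (fun t => dZ s t) _ t (- ((1 + 1) * dx s t * s))); [|assumption].
      unfold dZ, dx. auto_derive; [auto | ring].
  - unfold base_log_t, Rdiv. cbv beta. ring.
Qed.

Lemma dz_derive_s : is_derive (fun s => dz s t) s (dz_s s t).
Proof.
  pose proof (dX_pos s t Hs Ht) as P. unfold dz, dz_s, dX_s. unfold dX, dx, da in *.
  auto_derive; [lra | field; lra].
Qed.

Lemma dz_derive_t : is_derive (dz s) t (dz_t s t).
Proof.
  pose proof (dX_pos s t Hs Ht) as P. unfold dz, dz_t. unfold dX, dx in *.
  auto_derive; [lra | field; lra].
Qed.

Lemma f_dz_derive_s : Cderive (fun s => f (dz s t)) s (Cmult (RtoC (dz_s s t)) (f1 (dz s t))).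
Proof. apply (Cderive_comp f (fun s => dz s t)); [apply f_derive; now apply dz_lt_1 | apply dz_derive_s]. Qed.
Lemma g_dz_derive_s : Cderive (fun s => g (dz s t)) s (Cmult (RtoC (dz_s s t)) (g1 (dz s t))).
Proof. apply (Cderive_comp g (fun s => dz s t)); [apply g_derive; now apply dz_lt_1 | apply dz_derive_s]. Qed.
Lemma f_dz_derive_t : Cderive (fun t => f (dz s t)) t (Cmult (RtoC (dz_t s t)) (f1 (dz s t))).
Proof. apply (Cderive_comp f (dz s)); [apply f_derive; now apply dz_lt_1 | apply dz_derive_t]. Qed.
Lemma g_dz_derive_t : Cderive (fun t => g (dz s t)) t (Cmult (RtoC (dz_t s t)) (g1 (dz s t))).
Proof. apply (Cderive_comp g (dz s)); [apply g_derive; now apply dz_lt_1 | apply dz_derive_t]. Qed.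

Lemma qf_derive_s : Cderive (fun s => qf s t) s (qf_s s t).
Proof.
  unfold qf. eapply Cderive_eq.
  - apply (Cderive_mult (fun s => base s t) (fun s => f (dz s t))); [apply base_derive_s | apply f_dz_derive_s].
  - unfold qf_s. ring.
Qed.

Lemma qe_derive_s : Cderive (fun s => qe s t) s (qe_s s t).
Proof.
  unfold qe. eapply Cderive_eq.
  - apply (Cderive_mult (fun s => base s t) (fun s => Cminus (f (dz s t)) (Cmult (RtoC t) (g (dz s t)))));
      [apply base_derive_s|].
    apply (Cderive_minus (fun s => f (dz s t)) (fun s => Cmult (RtoC t) (g (dz s t)))); [apply f_dz_derive_s|].
    apply (Cderive_mult (fun _ => RtoC t) (fun s => g (dz s t))); [apply Cderive_const | apply g_dz_derive_s].
  - unfold qe_s. ring.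
Qed.

Lemma coef_V_derive_t : is_derive (coef_V s) t (coef_V_t s t).
Proof.
  pose proof (dZ_pos s t Hs Ht) as P. unfold coef_V, coef_V_t. unfold dW, dZ, dx in *.
  auto_derive; [lra | field; lra].
Qed.

Lemma flux_derive_t : Cderive (flux s) t (flux_t s t).
Proof.
  unfold flux. eapply Cderive_eq.
  - apply (Cderive_mult (fun t => Cplus (Cmult (RtoC (- w)) (f (dz s t))) (Cmult (RtoC (coef_V s t)) (Cminus (f (dz s t)) (g (dz s t)))))
      (fun _ => RtoC (/ dY s))); [|apply Cderive_const].
    apply (Cderive_plus (fun t => Cmult (RtoC (- w)) (f (dz s t))) (fun t => Cmult (RtoC (coef_V s t)) (Cminus (f (dz s t)) (g (dz s t))))).
    + apply (Cderive_mult (fun _ => RtoC (- w)) (fun t => f (dz s t))); [apply Cderive_const | apply f_dz_derive_t].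
    + apply (Cderive_mult (fun t => RtoC (coef_V s t)) (fun t => Cminus (f (dz s t)) (g (dz s t)))).
      * apply Cderive_RtoC, coef_V_derive_t.
      * apply (Cderive_minus (fun t => f (dz s t)) (fun t => g (dz s t))); [apply f_dz_derive_t | apply g_dz_derive_t].
  - unfold flux_t. ring.
Qed.
End Derivatives.

(** The kernel times t (1 - t). It multiplies every boundary term and tends to 0 at both ends, since
    both exponents have positive real part. *)
Definition edge (t : R) : C := Cmult (cpow t al) (cpow (1 - t) be).

Lemma edge_eq (t : R) : 0 < t < 1 -> edge t = Cmult (beta_kernel al be t) (Cmult (RtoC t) (Cminus (RtoC 1) (RtoC t))).
Proof.
  intros Ht. unfold edge, beta_kernel.
  replace al with (Cplus (Cminus al (RtoC 1)) (RtoC 1)) at 1 by ring.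
  replace be with (Cplus (Cminus be (RtoC 1)) (RtoC 1)) at 1 by ring.
  rewrite (cpow_plus t (Cminus al (RtoC 1))), (cpow_plus (1 - t) (Cminus be (RtoC 1))), !cpow_1 by lra.
  rewrite RtoC_minus. ring.
Qed.

Lemma edge_derive (t : R) : 0 < t < 1 ->
  Cderive edge t (Cmult (beta_kernel al be t) (Cminus (Cmult al (Cminus (RtoC 1) (RtoC t))) (Cmult be (RtoC t)))).
Proof.
  intros Ht. unfold edge. eapply Cderive_eq.
  - apply (Cderive_mult (fun t => cpow t al) (fun t => cpow (1 - t) be)).
    + apply (cpow_derive_comp (fun t => t) al t 1); [apply (is_derive_id (K := R_AbsRing)) | lra].
    + apply (cpow_derive_comp (fun t => 1 - t) be t (-1)); [auto_derive; [auto | ring] | lra].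
  - fold (edge t).
    transitivity (Cmult (edge t) (Cplus (Cmult al (RtoC (1 / t))) (Cmult be (RtoC (-1 / (1 - t)))))).
    { unfold edge. ring. }
    rewrite edge_eq by assumption.
    replace (-1 / (1 - t)) with (- / (1 - t)) by (field; lra). unfold Rdiv.
    rewrite RtoC_opp, RtoC_mult, !RtoC_inv, RtoC_minus by lra.
    field. split; intros E; [rewrite <- RtoC_minus in E|]; apply RtoC_inj in E; lra.
Qed.

Definition kappa (s : R) : C := Cmult (Cminus (Cplus al be) (RtoC 1)) (RtoC (w * / dY s)).

Section Certificates.
Variables s t : R.
Hypothesis Hs : admissible s.
Hypothesis Ht : 0 < t < 1.

Let Ht' : 0 <= t <= 1.
Proof. lra. Qed.
Let xc := RtoC (dx s t).
Let sc := RtoC s.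
Let tc := RtoC t.
Let Zc := RtoC (dZ s t).

Lemma RtoC_neq_0 (u : R) : u <> 0 -> RtoC u <> RtoC 0.
Proof. intros H E. apply RtoC_inj in E. contradiction. Qed.

Let EA : RtoC (da s) = Cminus xc (Cmult sc tc).
Proof. unfold xc, sc, tc. rewrite <- RtoC_mult, <- RtoC_minus. f_equal. unfold da, dx. ring. Qed.
Let Ew : RtoC w = Cplus xc (Cmult sc (Cminus (RtoC 1) tc)).
Proof. unfold xc, sc, tc. rewrite <- RtoC_minus, <- RtoC_mult, <- RtoC_plus. f_equal. unfold dx. ring. Qed.
Let EX : RtoC (dX s t) = Cplus Zc (Cmult (Cmult xc sc) tc).
Proof. unfold Zc, xc, sc, tc. rewrite <- !RtoC_mult, <- RtoC_plus. f_equal. unfold dX, dZ, dx, da. ring. Qed.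
Let EW : RtoC (dW s t) = Cminus Zc (Cmult (Cmult xc sc) (Cminus (RtoC 1) tc)).
Proof. unfold Zc, xc, sc, tc. rewrite <- !RtoC_minus, <- !RtoC_mult, <- RtoC_minus. f_equal. unfold dW, dZ, dx. ring. Qed.
Let EY : RtoC (dY s) = Cminus (Cplus Zc (Cmult xc xc)) (Cmult (Cminus xc (Cmult sc tc)) (Cplus xc (Cmult sc (Cminus (RtoC 1) tc)))).
Proof. rewrite <- EA, <- Ew. unfold Zc, xc. rewrite <- !RtoC_mult, <- RtoC_plus, <- RtoC_minus. f_equal. unfold dY, dZ. ring. Qed.
Let nX : RtoC (dX s t) <> RtoC 0.
Proof. apply RtoC_neq_0. pose proof (dX_pos s t Hs Ht'). lra. Qed.
Let nW : RtoC (dW s t) <> RtoC 0.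
Proof. apply RtoC_neq_0. pose proof (dW_pos s t Hs Ht'). lra. Qed.
Let nZ : Zc <> RtoC 0.
Proof. apply RtoC_neq_0. pose proof (dZ_pos s t Hs Ht'). lra. Qed.
Let nY : RtoC (dY s) <> RtoC 0.
Proof. apply RtoC_neq_0. pose proof (dY_pos s Hs). lra. Qed.

(** The system at z = x s t / X, freed of denominators by 1 - z = Z / X, is in the form that the
    certificates expect. *)
Let rel1 : Cmult Zc (f1 (dz s t)) =
  Cmult (Cmult (Cminus (Cminus al be) (RtoC 1)) (RtoC (dX s t))) (Cminus (f (dz s t)) (g (dz s t))).
Proof.
  pose proof (fg_rel_1 _ (dz_lt_1 s t Hs Ht')) as E. rewrite (dz_compl s t Hs Ht') in E.
  unfold Rdiv in E. rewrite RtoC_mult, RtoC_inv in E by (pose proof (dX_pos s t Hs Ht'); lra).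
  fold Zc in E.
  transitivity (Cmult (RtoC (dX s t)) (Cmult (Cmult Zc (Cinv (RtoC (dX s t)))) (f1 (dz s t)))); [field; exact nX|].
  rewrite E. ring.
Qed.

Let rel2 : Cmult (Cmult (Cmult (Cmult xc sc) tc) Zc) (g1 (dz s t)) =
  Cminus (Cmult (Cmult (Cmult (RtoC (dX s t)) (RtoC (dX s t))) (Cplus al be)) (f (dz s t)))
    (Cmult (Cmult (RtoC (dX s t)) (Cplus (Cmult al (RtoC (dX s t))) (Cmult be (Cmult (Cmult xc sc) tc)))) (g (dz s t))).
Proof.
  pose proof (fg_rel_2 _ (dz_lt_1 s t Hs Ht')) as E. rewrite (dz_compl s t Hs Ht') in E.
  assert (Ez : RtoC (dz s t) = Cmult (Cmult (Cmult xc sc) tc) (Cinv (RtoC (dX s t)))).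
  { unfold dz, xc, sc, tc. rewrite !RtoC_mult, RtoC_inv by (pose proof (dX_pos s t Hs Ht'); lra). ring. }
  unfold Rdiv in E. rewrite !RtoC_mult, RtoC_inv, Ez in E by (pose proof (dX_pos s t Hs Ht'); lra).
  fold Zc in E.
  transitivity (Cmult (Cmult (RtoC (dX s t)) (RtoC (dX s t))) (Cmult (Cmult (Cmult (Cmult (Cmult xc sc) tc) (Cinv (RtoC (dX s t))))
         (Cmult Zc (Cinv (RtoC (dX s t))))) (g1 (dz s t)))); [field; exact nX|].
  rewrite E. field. exact nX.
Qed.

Ltac push_RtoC :=
  repeat first
    [ rewrite RtoC_plus | rewrite RtoC_minus | rewrite RtoC_mult | rewrite RtoC_opp
    | rewrite RtoC_inv by (pose proof (dX_pos s t Hs Ht'); pose proof (dW_pos s t Hs Ht');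
        pose proof (dZ_pos s t Hs Ht'); pose proof (dY_pos s Hs); nra) ].

Lemma certificate_1_real :
  Cplus (Cmult (Cminus (Cmult al (Cminus (RtoC 1) tc)) (Cmult be tc)) (flux s t))
    (Cmult (Cmult tc (Cminus (RtoC 1) tc)) (Cplus (Cmult (base_log_t s t) (flux s t)) (flux_t s t))) =
  Cminus (Cplus (Cmult (base_log_s s t) (f (dz s t))) (Cmult (RtoC (dz_s s t)) (f1 (dz s t))))
    (Cmult (kappa s) (Cminus (f (dz s t)) (Cmult tc (g (dz s t))))).
Proof.
  assert (nX' := nX). assert (nW' := nW). assert (nY' := nY). assert (r1 := rel1). assert (r2 := rel2).
  rewrite EX in nX', r1, r2. rewrite EW in nW'. rewrite EY in nY'.
  pose proof (certificate_1 al be xc sc tc Zc (f (dz s t)) (g (dz s t)) (f1 (dz s t)) (g1 (dz s t))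
      nX' nW' nY' nZ r1 r2) as Cert. cbv zeta in Cert.
  etransitivity; [|etransitivity; [exact Cert|]]; clear Cert r1 r2.
  - unfold flux, flux_t, base_log_t, coef_V, coef_V_t, dz_t. push_RtoC.
    rewrite EX, EW, EY, EA, Ew. fold xc sc tc Zc. field. repeat split; assumption.
  - unfold base_log_s, kappa, dz_s, dX_s, dW_s, dZ_s. push_RtoC.
    rewrite EX, EW, EY, EA, Ew. fold xc sc tc Zc. field. repeat split; assumption.
Qed.

Lemma certificate_2_real : s <> 0 ->
  Cplus (Cmult (Cminus (Cmult al (Cminus (RtoC 1) tc)) (Cmult be tc)) (Cplus (flux s t) (Cmult (g (dz s t)) (Cinv sc))))
    (Cmult (Cmult tc (Cminus (RtoC 1) tc))
      (Cplus (Cmult (base_log_t s t) (Cplus (flux s t) (Cmult (g (dz s t)) (Cinv sc))))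
        (Cplus (flux_t s t) (Cmult (Cmult (RtoC (dz_t s t)) (g1 (dz s t))) (Cinv sc))))) =
  Cminus (Cplus (Cmult (base_log_s s t) (Cminus (f (dz s t)) (Cmult tc (g (dz s t)))))
            (Cmult (RtoC (dz_s s t)) (Cminus (f1 (dz s t)) (Cmult tc (g1 (dz s t))))))
    (Cmult (Cminus (kappa s) (Cmult (Cplus al be) (Cinv sc))) (Cminus (f (dz s t)) (Cmult tc (g (dz s t))))).
Proof.
  intros Hs0. assert (nS : sc <> RtoC 0) by now apply RtoC_neq_0.
  assert (nX' := nX). assert (nW' := nW). assert (nY' := nY). assert (r1 := rel1). assert (r2 := rel2).
  rewrite EX in nX', r1, r2. rewrite EW in nW'. rewrite EY in nY'.
  pose proof (certificate_2 al be xc sc tc Zc (f (dz s t)) (g (dz s t)) (f1 (dz s t)) (g1 (dz s t))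
      nX' nW' nY' nZ r1 r2 nS) as Cert. cbv zeta in Cert.
  etransitivity; [|etransitivity; [exact Cert|]]; clear Cert r1 r2.
  - unfold flux, flux_t, base_log_t, coef_V, coef_V_t, dz_t. push_RtoC.
    rewrite EX, EW, EY, EA, Ew. fold xc sc tc Zc. field. repeat split; assumption.
  - unfold base_log_s, kappa, dz_s, dX_s, dW_s, dZ_s. push_RtoC.
    rewrite EX, EW, EY, EA, Ew. fold xc sc tc Zc. field. repeat split; assumption.
Qed.

(** Since [edge] is the kernel times t (1 - t), the product rule yields the kernel times [base]
    times the left side of the certificate. *)
Lemma flux_1_derive : Cderive (fun t => Cmult (edge t) (q1 s t)) t
  (Cmult (beta_kernel al be t) (Cminus (qf_s s t) (Cmult (kappa s) (qe s t)))).
Proof.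
  eapply Cderive_eq.
  - apply (Cderive_mult edge (q1 s)); [now apply edge_derive|].
    apply (Cderive_mult (base s) (flux s)); [now apply base_derive_t | now apply flux_derive_t].
  - rewrite edge_eq by assumption.
    pose proof certificate_1_real as Cert. unfold tc in Cert. unfold q1, qf_s, qe.
    etransitivity; [|etransitivity; [exact (f_equal (Cmult (Cmult (beta_kernel al be t) (base s t))) Cert)|]]; ring.
Qed.

Lemma flux_2_derive : s <> 0 -> Cderive (fun t => Cmult (edge t) (Cmult (q2 s t) (RtoC (/ s)))) t
  (Cmult (beta_kernel al be t) (Cminus (qe_s s t) (Cmult (Cminus (kappa s) (Cmult (Cplus al be) (RtoC (/ s)))) (qe s t)))).
Proof.
  intros Hs0. assert (nS : sc <> RtoC 0) by now apply RtoC_neq_0.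
  assert (Es : RtoC (/ s) = Cinv sc) by (apply RtoC_inv; exact Hs0).
  eapply Cderive_eq.
  - apply (Cderive_mult edge (fun t => Cmult (q2 s t) (RtoC (/ s)))); [now apply edge_derive|].
    apply (Cderive_mult (q2 s) (fun _ => RtoC (/ s))); [|apply Cderive_const].
    apply (Cderive_mult (base s) (fun t => Cplus (Cmult (RtoC s) (flux s t)) (g (dz s t)))); [now apply base_derive_t|].
    apply (Cderive_plus (fun t => Cmult (RtoC s) (flux s t)) (fun t => g (dz s t))); [|now apply g_dz_derive_t].
    apply (Cderive_mult (fun _ => RtoC s) (flux s)); [apply Cderive_const | now apply flux_derive_t].
  - rewrite edge_eq by assumption. rewrite Es.
    pose proof (certificate_2_real Hs0) as Cert. unfold q2, qe_s, qe. fold sc tc.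
    etransitivity; [|etransitivity; [exact (f_equal (Cmult (Cmult (beta_kernel al be t) (base s t))) Cert)|]];
      field; exact nS.
Qed.
End Certificates.

(** * Truncated integrals along the path and the passage to the limit *)

Lemma Rpower_le_1 (d r : R) : 0 < d <= 1 -> 0 < r -> Rpower d r <= 1.
Proof.
  intros Hd Hr. apply Rle_trans with (Rpower 1 r).
  - apply Rle_Rpower_l; lra.
  - unfold Rpower. rewrite ln_1, Rmult_0_r, exp_0. lra.
Qed.

Hypothesis Hal : 0 < Re al.
Hypothesis Hbe : 0 < Re be.
Hypothesis H1 : admissible 1.
Hypothesis f_0 : f 0 = RtoC 1.

Lemma admissible_unit (s : R) : 0 <= s <= 1 -> admissible s.
Proof.
  intros Hs. unfold admissible, da in *.
  assert (0 <= s * (1 - s)) by (apply Rmult_le_pos; lra).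
  assert (s * ((w - 1) * (w - 1)) + (1 - s) * (w * w) < c).
  { destruct (Req_dec s 0) as [->|]; [lra|]. nra. }
  nra.
Qed.

Definition edge_size (d : R) : R := Rpower d (Re al) + Rpower d (Re be).

Lemma edge_size_pos (d : R) : 0 < edge_size d.
Proof. unfold edge_size, Rpower. pose proof (exp_pos (Re al * ln d)). pose proof (exp_pos (Re be * ln d)). lra. Qed.

(** At each cut one factor of [edge] is a power of [d] and the other has modulus at most 1. *)
Lemma Cmod_edge_jump (h : R -> C) (M d : R) : 0 < d <= / 2 ->
  (forall t, 0 <= t <= 1 -> Cmod (h t) <= M) ->
  Cmod (Cminus (Cmult (edge (1 - d)) (h (1 - d))) (Cmult (edge d) (h d))) <= M * edge_size d.
Proof.
  intros Hd Hh. unfold Cminus. eapply Rle_trans; [apply Cmod_triangle|].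
  rewrite Cmod_opp, !Cmod_mult. unfold edge. rewrite !Cmod_mult, !Cmod_cpow.
  replace (1 - (1 - d)) with d by ring.
  pose proof (Rpower_le_1 d (Re al) ltac:(lra) Hal). pose proof (Rpower_le_1 d (Re be) ltac:(lra) Hbe).
  pose proof (Rpower_le_1 (1 - d) (Re al) ltac:(lra) Hal). pose proof (Rpower_le_1 (1 - d) (Re be) ltac:(lra) Hbe).
  pose proof (Hh (1 - d) ltac:(lra)). pose proof (Hh d ltac:(lra)).
  pose proof (Cmod_ge_0 (h (1 - d))). pose proof (Cmod_ge_0 (h d)).
  unfold edge_size, Rpower in *.
  pose proof (exp_pos (Re al * ln d)). pose proof (exp_pos (Re be * ln d)).
  pose proof (exp_pos (Re al * ln (1 - d))). pose proof (exp_pos (Re be * ln (1 - d))).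
  rewrite Rmult_plus_distr_l, Rplus_comm. apply Rplus_le_compat.
  - rewrite Rmult_comm. apply Rmult_le_compat; try assumption; nra.
  - rewrite Rmult_comm. apply Rmult_le_compat; try assumption; nra.
Qed.

Lemma edge_size_small (eps : R) : 0 < eps ->
  exists d0, 0 < d0 <= / 2 /\ forall d, 0 < d <= d0 ->
    edge_size d < eps /\ beta_tail (Re al) (Re be) d < eps.
Proof.
  intros He.
  assert (A : forall r, 0 < r -> exists d0, 0 < d0 /\ forall d, 0 < d <= d0 -> Rpower d r < eps / 2).
  { intros r Hr. exists (Rpower (eps / 4) (/ r)). split; [apply exp_pos|]. intros d Hd.
    apply Rle_lt_trans with (Rpower (Rpower (eps / 4) (/ r)) r); [apply Rle_Rpower_l; lra|].
    rewrite Rpower_mult. replace (/ r * r) with 1 by (field; lra). rewrite Rpower_1; lra. }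
  destruct (A (Re al) Hal) as [d1 [P1 Q1]]. destruct (A (Re be) Hbe) as [d2 [P2 Q2]].
  destruct (beta_tail_small (Re al) (Re be) eps Hal Hbe He) as [d3 [P3 Q3]].
  exists (Rmin d3 (Rmin d1 d2)).
  pose proof (Rmin_l d3 (Rmin d1 d2)). pose proof (Rmin_r d3 (Rmin d1 d2)).
  pose proof (Rmin_l d1 d2). pose proof (Rmin_r d1 d2).
  split; [split; [repeat apply Rmin_glb_lt; lra | lra]|].
  intros d Hd. split; [|apply Q3; lra]. unfold edge_size.
  specialize (Q1 d ltac:(lra)). specialize (Q2 d ltac:(lra)). lra.
Qed.

Let Kb : R := beta_bound (Re al) (Re be) * (/ Re al + / Re be).

Lemma Kb_pos : 0 < Kb.
Proof.
  unfold Kb. apply Rmult_lt_0_compat; [apply beta_bound_pos|].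
  pose proof (Rinv_0_lt_compat _ Hal). pose proof (Rinv_0_lt_compat _ Hbe). lra.
Qed.

Definition trunc (h : R -> R -> C) (d s : R) : C :=
  CRInt (fun t => Cmult (beta_kernel al be t) (h s t)) d (1 - d).

Lemma trunc_derive (h h_s : R -> R -> C) (d s : R) :
  (forall s t, admissible s -> 0 <= t <= 1 -> Cderive (fun s => h s t) s (h_s s t)) ->
  (forall s t, admissible s -> 0 <= t <= 1 -> Ccont (fun p : R * R => h (fst p) (snd p)) (s, t)) ->
  (forall s t, admissible s -> 0 <= t <= 1 -> Ccont (fun p : R * R => h_s (fst p) (snd p)) (s, t)) ->
  0 < d <= / 2 -> admissible s -> Cderive (trunc h d) s (trunc h_s d s).
Proof.
  intros Hd Hc Hcs Hdd Hs.
  apply (CRInt_param_derive admissible (fun t => 0 < t < 1)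
    (fun s t => Cmult (beta_kernel al be t) (h s t)) (fun s t => Cmult (beta_kernel al be t) (h_s s t)) d (1 - d)).
  - apply open_admissible.
  - apply open_unit.
  - lra.
  - intros t Ht; lra.
  - intros s' t Hs' Ht. eapply Cderive_eq.
    + apply (Cderive_mult (fun _ => beta_kernel al be t) (fun s => h s t)); [apply Cderive_const|].
      apply Hd; [exact Hs' | lra].
    + ring.
  - intros s' t Hs' Ht.
    apply (Ccont_mult (fun p : R * R => beta_kernel al be (snd p)) (fun p : R * R => h_s (fst p) (snd p))).
    + apply (Ccont_comp (beta_kernel al be) (fun p : R * R => snd p)); [apply continuous_snd | now apply beta_kernel_cont].
    + apply Hcs; [exact Hs' | lra].
  - intros s' t Hs' Ht. apply (Ccont_mult (beta_kernel al be) (h s')); [now apply beta_kernel_cont|].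
    apply Ccont_slice_r. apply Hc; [exact Hs' | lra].
  - exact Hs.
Qed.

(** The telescoping step: integrating the certificate over [d, 1 - d] turns its t-derivative into
    boundary values and leaves a differential equation in s. *)
Lemma trunc_flux (h h' flux0 : R -> R -> C) (k : C) (d s : R) :
  0 < d <= / 2 ->
  (forall t, 0 < t < 1 -> Ccont (h s) t) -> (forall t, 0 < t < 1 -> Ccont (h' s) t) ->
  (forall t, 0 < t < 1 -> Cderive (fun t => Cmult (edge t) (flux0 s t)) t
      (Cmult (beta_kernel al be t) (Cminus (h' s t) (Cmult k (h s t))))) ->
  trunc h' d s = Cplus (Cmult k (trunc h d s))
    (Cminus (Cmult (edge (1 - d)) (flux0 s (1 - d))) (Cmult (edge d) (flux0 s d))).
Proof.
  intros Hd Hc Hc' Hf. unfold trunc.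
  assert (k1 : forall t, Rmin d (1 - d) <= t <= Rmax d (1 - d) -> 0 < t < 1).
  { rewrite Rmin_left, Rmax_right by lra. intros t Ht; lra. }
  assert (c1 : forall t, 0 < t < 1 -> Ccont (fun t => Cmult (beta_kernel al be t) (h s t)) t).
  { intros t Ht. apply (Ccont_mult (beta_kernel al be) (h s)); [now apply beta_kernel_cont | now apply Hc]. }
  assert (c2 : forall t, 0 < t < 1 -> Ccont (fun t => Cmult (beta_kernel al be t) (Cminus (h' s t) (Cmult k (h s t)))) t).
  { intros t Ht. apply (Ccont_mult (beta_kernel al be) (fun t => Cminus (h' s t) (Cmult k (h s t))));
      [now apply beta_kernel_cont|].
    apply (Ccont_minus (h' s) (fun t => Cmult k (h s t))); [now apply Hc'|].
    apply (Ccont_mult (fun _ => k) (h s)); [apply Ccont_const | now apply Hc]. }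
  rewrite <- (CRInt_FTC (fun t => Cmult (edge t) (flux0 s t))
    (fun t => Cmult (beta_kernel al be t) (Cminus (h' s t) (Cmult k (h s t)))));
    [|intros t Ht; now apply Hf, k1 | intros t Ht; now apply c2, k1].
  rewrite <- CRInt_scal by (intros t Ht; now apply c1, k1).
  rewrite <- CRInt_plus.
  - apply CRInt_ext. intros t Ht. ring.
  - intros t Ht. apply (Ccont_mult (fun _ => k) (fun t => Cmult (beta_kernel al be t) (h s t)));
      [apply Ccont_const | now apply c1, k1].
  - intros t Ht. now apply c2, k1.
Qed.

Lemma slice_cont (h : R -> R -> C) (s : R) :
  (forall s t, admissible s -> 0 <= t <= 1 -> Ccont (fun p : R * R => h (fst p) (snd p)) (s, t)) ->
  admissible s -> forall t, 0 < t < 1 -> Ccont (h s) t.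
Proof. intros H Hs t Ht. apply Ccont_slice_r, H; [exact Hs | lra]. Qed.

Lemma trunc_qf_derive (d s : R) : 0 < d <= / 2 -> admissible s ->
  Cderive (trunc qf d) s (Cplus (Cmult (kappa s) (trunc qe d s))
    (Cminus (Cmult (edge (1 - d)) (q1 s (1 - d))) (Cmult (edge d) (q1 s d)))).
Proof.
  intros Hd Hs. rewrite <- (trunc_flux qe qf_s q1); [|exact Hd| | |].
  - apply trunc_derive; [exact qf_derive_s | exact qf_cont | exact qf_s_cont | exact Hd | exact Hs].
  - apply slice_cont; [exact qe_cont | exact Hs].
  - apply slice_cont; [exact qf_s_cont | exact Hs].
  - intros t Ht. now apply flux_1_derive.
Qed.

Lemma trunc_qe_derive (d s : R) : 0 < d <= / 2 -> admissible s -> s <> 0 ->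
  Cderive (trunc qe d) s (Cplus (Cmult (Cminus (kappa s) (Cmult (Cplus al be) (RtoC (/ s)))) (trunc qe d s))
    (Cminus (Cmult (edge (1 - d)) (Cmult (q2 s (1 - d)) (RtoC (/ s)))) (Cmult (edge d) (Cmult (q2 s d) (RtoC (/ s)))))).
Proof.
  intros Hd Hs Hs0. rewrite <- (trunc_flux qe qe_s (fun s t => Cmult (q2 s t) (RtoC (/ s)))); [|exact Hd| | |].
  - apply trunc_derive; [exact qe_derive_s | exact qe_cont | exact qe_s_cont | exact Hd | exact Hs].
  - apply slice_cont; [exact qe_cont | exact Hs].
  - apply slice_cont; [exact qe_s_cont | exact Hs].
  - intros t Ht. now apply flux_2_derive.
Qed.

(* Integrating factor of the equation of [trunc qe]. *)
Definition mu (s : R) : C := Cmult (cpow s (Cplus al be)) (cpow (dY s) (Cminus (RtoC 1) (Cplus al be))).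

(** [dY] has derivative [w], so the logarithmic derivative of [mu] is (al + be) / s + (1 - al - be)
    w / Y, the negative of the coefficient in the equation. *)
Lemma mu_derive (s : R) : 0 < s -> admissible s ->
  Cderive mu s (Copp (Cmult (Cminus (kappa s) (Cmult (Cplus al be) (RtoC (/ s)))) (mu s))).
Proof.
  intros Hs0 Hs. pose proof (dY_pos s Hs). unfold mu. eapply Cderive_eq.
  - apply (Cderive_mult (fun s => cpow s (Cplus al be)) (fun s => cpow (dY s) (Cminus (RtoC 1) (Cplus al be)))).
    + apply (cpow_derive_comp (fun s => s) _ s 1); [apply (is_derive_id (K := R_AbsRing)) | exact Hs0].
    + apply (cpow_derive_comp dY _ s w); [unfold dY, da; auto_derive; [auto | ring] | assumption].
  - unfold kappa. replace (1 / s) with (/ s) by (field; lra). unfold Rdiv. ring.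
Qed.

Let ymin : R := Rmin (dY 0) (dY 1).
Let ymax : R := Rmax (dY 0) (dY 1).

Lemma ymin_pos : 0 < ymin.
Proof. apply Rmin_glb_lt; apply dY_pos; [apply admissible_0 | exact H1]. Qed.

Lemma dY_range (s : R) : 0 <= s <= 1 -> ymin <= dY s <= ymax.
Proof.
  intros Hs.
  pose proof (Rmin_l (dY 0) (dY 1)). pose proof (Rmin_r (dY 0) (dY 1)).
  pose proof (Rmax_l (dY 0) (dY 1)). pose proof (Rmax_r (dY 0) (dY 1)).
  assert (E : dY s = (1 - s) * dY 0 + s * dY 1) by (unfold dY, da; ring).
  unfold ymin, ymax. split; rewrite E; nra.
Qed.

Let Kmu : R := Rpower ymin (1 - Re (Cplus al be)) + Rpower ymax (1 - Re (Cplus al be)).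

Lemma Kmu_pos : 0 < Kmu.
Proof. unfold Kmu, Rpower. apply Rplus_lt_0_compat; apply exp_pos. Qed.

Lemma mu_bound (s : R) : 0 < s <= 1 -> Cmod (mu s) <= Rpower s (Re (Cplus al be)) * Kmu.
Proof.
  intros Hs. unfold mu. rewrite Cmod_mult, !Cmod_cpow.
  apply Rmult_le_compat_l; [left; apply exp_pos|].
  apply (Rpower_between (dY s) ymin ymax (1 - Re (Cplus al be))); [apply ymin_pos | apply dY_range; lra].
Qed.

(** [mu] times the truncated integral is small at a small [s0] and varies little between [s0] and
    [s1]. The order of choices matters: the variation involves 1 / s0, so [s0] comes first and [d]
    after it. *)
Lemma qe_integral_zero (M : R) (l : C) (s1 : R) : 0 < s1 <= 1 ->
  (forall s t, 0 <= s <= 1 -> 0 <= t <= 1 -> Cmod (qe s t) <= M) ->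
  (forall d, 0 < d < 1 -> Cmod (Cminus (trunc qe d s1) l) <= M * beta_tail (Re al) (Re be) d) ->
  l = RtoC 0.
Proof.
  intros Hs1 HM Hl.
  assert (M0 : 0 <= M) by (eapply Rle_trans; [apply Cmod_ge_0 | apply (HM 0 0); lra]).
  destruct (C_bounded_on_square q2) as [M2 HM2].
  { intros x y Hx Hy. apply q2_cont; [now apply admissible_unit | exact Hy]. }
  assert (M20 : 0 <= M2) by (eapply Rle_trans; [apply Cmod_ge_0 | apply (HM2 0 0); lra]).
  pose proof Kmu_pos as HK. pose proof Kb_pos as HKb.
  set (r := Re (Cplus al be)). assert (Hr : 0 < r) by (unfold r; simpl; unfold Re in *; lra).
  assert (mu_le : forall s, 0 < s <= 1 -> Cmod (mu s) <= Kmu).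
  { intros s Hs. eapply Rle_trans; [now apply mu_bound|]. fold r. pose proof (Rpower_le_1 s r Hs Hr).
    pose proof (exp_pos (r * ln s)). unfold Rpower in *. nra. }
  assert (E : Cmult (mu s1) l = RtoC 0).
  { apply C_eq_epsilon. intros eps3 He3. set (eps := eps3 / 3). assert (He : 0 < eps) by (unfold eps; lra).
    set (K0 := Kmu * (M * Kb) + 1). assert (HK0 : 0 < K0).
    { unfold K0. assert (0 <= Kmu * (M * Kb)); [|lra]. apply Rmult_le_pos; [lra|]. apply Rmult_le_pos; lra. }
    (* The modulus of [mu s0] is at most [Kmu] times s0^r, so this makes its product with the
       truncated integral small for every [d]. *)
    set (s0 := Rmin s1 (Rpower (eps / K0) (/ r))).
    assert (Hs0 : 0 < s0) by (apply Rmin_glb_lt; [lra | apply exp_pos]).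
    assert (Hs01 : s0 <= s1) by apply Rmin_l.
    assert (Hs0r : Rpower s0 r <= eps / K0).
    { apply Rle_trans with (Rpower (Rpower (eps / K0) (/ r)) r).
      - apply Rle_Rpower_l; [lra|]. split; [exact Hs0 | apply Rmin_r].
      - rewrite Rpower_mult. replace (/ r * r) with 1 by (field; lra).
        rewrite Rpower_1; [lra | now apply Rdiv_lt_0_compat]. }
    (* Bounds the derivative of the product on [s0, s1] up to the factor [edge_size d]. *)
    set (L := Kmu * (M2 * / s0)). assert (HL : 0 <= L).
    { unfold L. apply Rmult_le_pos; [lra|]. apply Rmult_le_pos; [lra | left; now apply Rinv_0_lt_compat]. }
    destruct (edge_size_small (eps / (2 * L + Kmu * M + 1))) as [d [Hd Hsm]].
    { apply Rdiv_lt_0_compat; [exact He|]. assert (0 <= Kmu * M) by (apply Rmult_le_pos; lra). lra. }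
    destruct (Hsm d ltac:(lra)) as [S1 S2]. specialize (Hl d ltac:(lra)).
    assert (HKM : 0 <= Kmu * M) by (apply Rmult_le_pos; lra).
    set (D := 2 * L + Kmu * M + 1) in *. assert (HD : 0 < D) by (unfold D; lra).
    assert (big : forall k u, 0 <= k <= D -> 0 <= u < eps / D -> k * u <= eps).
    { intros k u Hk Hu. apply Rle_trans with (D * (eps / D)); [apply Rmult_le_compat; lra|].
      right. field. lra. }
    assert (V : Cmod (Cminus (Cmult (mu s1) (trunc qe d s1)) (Cmult (mu s0) (trunc qe d s0)))
       <= 2 * (L * edge_size d) * (s1 - s0)).
    (* The integrating factor cancels the homogeneous part of the equation; only boundary terms
       remain in the derivative. *)
    { apply (CMVT (fun s => Cmult (mu s) (trunc qe d s))
        (fun s => Cmult (mu s) (Cmult (RtoC (/ s))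
           (Cminus (Cmult (edge (1 - d)) (q2 s (1 - d))) (Cmult (edge d) (q2 s d)))))); [exact Hs01| |].
      - intros s Hs. eapply Cderive_eq.
        + apply (Cderive_mult mu (trunc qe d)); [apply mu_derive; [lra | apply admissible_unit; lra]|].
          apply trunc_qe_derive; [lra | apply admissible_unit; lra | lra].
        + ring.
      - intros s Hs. rewrite !Cmod_mult, Cmod_R.
        pose proof (mu_le s ltac:(lra)) as A1.
        pose proof (Cmod_edge_jump (q2 s) M2 d Hd (fun t Ht => HM2 s t ltac:(lra) Ht)) as A2.
        assert (A3 : Rabs (/ s) <= / s0).
        { rewrite Rabs_right by (apply Rle_ge; left; apply Rinv_0_lt_compat; lra).
          apply Rinv_le_contravar; lra. }
        unfold L. replace (Kmu * (M2 * / s0) * edge_size d) with (Kmu * (/ s0 * (M2 * edge_size d))) by ring.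
        apply Rmult_le_compat; [apply Cmod_ge_0 | | exact A1|].
        + apply Rmult_le_pos; [apply Rabs_pos | apply Cmod_ge_0].
        + apply Rmult_le_compat; [apply Rabs_pos | apply Cmod_ge_0 | exact A3 | exact A2]. }
    assert (V' : 2 * (L * edge_size d) * (s1 - s0) <= eps).
    { pose proof (edge_size_pos d).
      apply Rle_trans with (2 * L * edge_size d).
      - assert (0 <= L * edge_size d) by (apply Rmult_le_pos; lra). nra.
      - apply big; [unfold D; lra | lra]. }
    assert (B0 : Cmod (Cmult (mu s0) (trunc qe d s0)) <= eps).
    { rewrite Cmod_mult.
      assert (A1 : Cmod (trunc qe d s0) <= M * Kb).
      { apply (beta_CRInt_bound al be (qe s0) M d Hal Hbe Hd).
        - intros t Ht. apply (slice_cont qe s0); [exact qe_cont | apply admissible_unit; lra | lra].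
        - intros t Ht. apply HM; lra. }
      pose proof (mu_bound s0 ltac:(lra)) as A2. fold r in A2.
      apply Rle_trans with ((eps / K0 * Kmu) * (M * Kb)).
      - apply Rmult_le_compat; [apply Cmod_ge_0 | apply Cmod_ge_0 | | exact A1].
        eapply Rle_trans; [exact A2|]. apply Rmult_le_compat_r; lra.
      - apply Rle_trans with (eps / K0 * K0); [|right; field; lra].
        rewrite Rmult_assoc. apply Rmult_le_compat_l; [left; now apply Rdiv_lt_0_compat | unfold K0; lra]. }
    assert (B1 : Cmod (Cmult (mu s1) (Cminus (trunc qe d s1) l)) <= eps).
    { rewrite Cmod_mult. pose proof (mu_le s1 Hs1). pose proof (beta_tail_pos (Re al) (Re be) d).
      apply Rle_trans with (Kmu * (M * beta_tail (Re al) (Re be) d)).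
      - apply Rmult_le_compat; try apply Cmod_ge_0; assumption.
      - rewrite <- Rmult_assoc. apply big; [unfold D; lra | lra]. }
    replace (Cminus (Cmult (mu s1) l) (RtoC 0)) with
      (Cplus (Cmult (mu s0) (trunc qe d s0)) (Cplus (Cminus (Cmult (mu s1) (trunc qe d s1)) (Cmult (mu s0) (trunc qe d s0)))
         (Copp (Cmult (mu s1) (Cminus (trunc qe d s1) l))))) by ring.
    eapply Rle_trans; [apply Cmod_triangle|].
    eapply Rle_trans; [apply Rplus_le_compat_l, Cmod_triangle|]. rewrite Cmod_opp. unfold eps in *. lra. }
  assert (Hmu : mu s1 <> RtoC 0) by (unfold mu; apply Cmult_neq_0; apply cpow_neq_0).
  transitivity (Cmult (Cmult (mu s1) l) (Cinv (mu s1))); [field; exact Hmu|]. rewrite E. ring.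
Qed.

(** At s = 0 all three bases equal c - w^2, the exponents add up to -1, and the hypergeometric
    argument is 0. *)
Lemma qf_0 (t : R) : 0 <= t <= 1 -> qf 0 t = RtoC (/ (c - w * w)).
Proof.
  intros Ht. unfold qf, base, dz, dX, dW, dZ, dx, da.
  replace (0 * (1 - t)) with 0 by ring. rewrite Rminus_0_r.
  replace (w * (0 * t) * / (c - w * w)) with 0 by ring. rewrite f_0.
  assert (P : 0 < c - w * w) by lra.
  rewrite <- !cpow_plus.
  replace (Cplus (Cplus be (Cminus be (RtoC 1))) (Copp (Cplus be be))) with (Copp (RtoC 1)) by ring.
  rewrite cpow_opp, cpow_1, RtoC_inv by lra. ring.
Qed.

Lemma kappa_bound : exists K, 0 <= K /\ forall s, 0 <= s <= 1 -> Cmod (kappa s) <= K.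
Proof.
  pose proof ymin_pos as Hy.
  exists (Cmod (Cminus (Cplus al be) (RtoC 1)) * (Rabs w * / ymin)). split.
  - apply Rmult_le_pos; [apply Cmod_ge_0|]. apply Rmult_le_pos; [apply Rabs_pos | left; now apply Rinv_0_lt_compat].
  - intros s Hs. unfold kappa. rewrite Cmod_mult, Cmod_R, Rabs_mult.
    pose proof (dY_range s Hs).
    apply Rmult_le_compat_l; [apply Cmod_ge_0|]. apply Rmult_le_compat_l; [apply Rabs_pos|].
    rewrite Rabs_right by (apply Rle_ge; left; apply Rinv_0_lt_compat; lra).
    apply Rinv_le_contravar; lra.
Qed.

Lemma deformation : exists l : C,
  is_RInt_gen (V := C_R_NormedModule) (fun t => Cmult (beta_kernel al be t) (qf 1 t)) (at_right 0) (at_left 1) l /\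
  forall B, (forall d, 0 < d < 1 -> Cmod (Cminus (CRInt (beta_kernel al be) d (1 - d)) B) <= beta_tail (Re al) (Re be) d) ->
    B = Cmult (RtoC (c - w * w)) l.
Proof.
  destruct (C_bounded_on_square qf) as [Mf HMf].
  { intros x y Hx Hy. apply qf_cont; [now apply admissible_unit | exact Hy]. }
  destruct (C_bounded_on_square qe) as [Me HMe].
  { intros x y Hx Hy. apply qe_cont; [now apply admissible_unit | exact Hy]. }
  destruct (C_bounded_on_square q1) as [M1 HM1].
  { intros x y Hx Hy. apply q1_cont; [now apply admissible_unit | exact Hy]. }
  assert (Mf0 : 0 <= Mf) by (eapply Rle_trans; [apply Cmod_ge_0 | apply (HMf 0 0); lra]).
  assert (Me0 : 0 <= Me) by (eapply Rle_trans; [apply Cmod_ge_0 | apply (HMe 0 0); lra]).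
  assert (M10 : 0 <= M1) by (eapply Rle_trans; [apply Cmod_ge_0 | apply (HM1 0 0); lra]).
  destruct kappa_bound as [Kk [HKk HKb]]. pose proof Kb_pos as Kb0.
  destruct (beta_improper al be (qf 1) Mf Hal Hbe) as [l [Hl Bl]].
  { apply slice_cont; [exact qf_cont | exact H1]. }
  { intros t Ht. apply HMf; lra. }
  exists l. split; [exact Hl|]. intros B HB.
  assert (HC : 0 < c - w * w) by lra.
  enough (E : Cmult (RtoC (/ (c - w * w))) B = l).
  { rewrite <- E. rewrite RtoC_inv by lra. field. apply RtoC_neq_0. lra. }
  apply C_eq_epsilon. intros eps4 He4. set (eps := eps4 / 4). assert (He : 0 < eps) by (unfold eps; lra).
  (* The mean value constant on [0, s0], once the edge size is at most 1. *)
  set (K1 := 2 * (Kk * (Me * Kb) + M1) + 1).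
  assert (X0 : 0 <= Kk * (Me * Kb)) by (apply Rmult_le_pos; [|apply Rmult_le_pos]; lra).
  assert (HK1 : 0 < K1) by (unfold K1; lra).
  (* E is known to vanish for s > 0 only. Near s = 0 the crude bound on E is enough, because [0, s0]
     is short. *)
  set (s0 := Rmin 1 (eps / K1)).
  assert (Hs0 : 0 < s0) by (apply Rmin_glb_lt; [lra | now apply Rdiv_lt_0_compat]).
  assert (Hs01 : s0 <= 1) by apply Rmin_l.
  assert (Hs0e : K1 * s0 <= eps).
  { apply Rle_trans with (K1 * (eps / K1)); [apply Rmult_le_compat_l; [lra | apply Rmin_r] | right; field; lra]. }
  (* Dominates every coefficient that multiplies an edge size or a tail below; the summand [eps]
     ensures eps / D < 1, hence an edge size at most 1. *)
  set (D := 2 * (Kk * Me + M1) + Mf + / (c - w * w) + 1 + eps).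
  assert (X1 : 0 <= Kk * Me) by (apply Rmult_le_pos; lra).
  assert (X2 : 0 < / (c - w * w)) by now apply Rinv_0_lt_compat.
  assert (HD : 0 < D) by (unfold D; lra).
  destruct (edge_size_small (eps / D)) as [d [Hd Hsm]]; [now apply Rdiv_lt_0_compat|].
  destruct (Hsm d ltac:(lra)) as [S1 S2]. pose proof (beta_tail_pos (Re al) (Re be) d) as S0.
  pose proof (edge_size_pos d) as E0.
  assert (S3 : edge_size d <= 1).
  { left. eapply Rlt_trans; [exact S1|]. apply Rmult_lt_reg_r with D; [exact HD|].
    unfold Rdiv. rewrite Rmult_assoc, Rinv_l by lra. unfold D. lra. }
  assert (big : forall k u, 0 <= k <= D -> 0 <= u < eps / D -> k * u <= eps).
  { intros k u Hk Hu. apply Rle_trans with (D * (eps / D)); [apply Rmult_le_compat; lra|].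
    right. field. lra. }
  specialize (Bl d ltac:(lra)). specialize (HB d ltac:(lra)).
  change (Cmod (Cminus (trunc qf d 1) l) <= Mf * beta_tail (Re al) (Re be) d) in Bl.
  assert (der_le : forall s m, 0 <= s <= 1 -> Cmod (trunc qe d s) <= m ->
    Cmod (Cplus (Cmult (kappa s) (trunc qe d s))
      (Cminus (Cmult (edge (1 - d)) (q1 s (1 - d))) (Cmult (edge d) (q1 s d)))) <= Kk * m + M1 * edge_size d).
  { intros s m Hs Hm. eapply Rle_trans; [apply Cmod_triangle|]. apply Rplus_le_compat.
    - rewrite Cmod_mult. apply Rmult_le_compat; [apply Cmod_ge_0 | apply Cmod_ge_0 | now apply HKb | exact Hm].
    - apply (Cmod_edge_jump (q1 s)); [exact Hd|]. intros t Ht. now apply HM1. }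
  assert (V1 : Cmod (Cminus (trunc qf d 1) (trunc qf d s0)) <= eps).
  { eapply Rle_trans.
    - apply (CMVT (trunc qf d) (fun s => Cplus (Cmult (kappa s) (trunc qe d s))
        (Cminus (Cmult (edge (1 - d)) (q1 s (1 - d))) (Cmult (edge d) (q1 s d)))) s0 1
        (Kk * (Me * beta_tail (Re al) (Re be) d) + M1 * edge_size d)); [exact Hs01| |].
      + intros s Hs. apply trunc_qf_derive; [exact Hd | apply admissible_unit; lra].
      + intros s Hs. apply der_le; [lra|].
        destruct (beta_improper al be (qe s) Me Hal Hbe) as [le [_ Ble]].
        { apply slice_cont; [exact qe_cont | apply admissible_unit; lra]. }
        { intros t Ht. apply HMe; lra. }
        assert (Hs' : 0 < s <= 1) by lra.
        (* The full integral is 0, so the truncated one is no larger than the truncation error,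
           uniformly in s. *)
        pose proof (qe_integral_zero Me le s Hs' HMe Ble) as Ez. specialize (Ble d ltac:(lra)).
        rewrite Ez in Ble. replace (trunc qe d s) with (Cminus (trunc qe d s) (RtoC 0)) by ring. exact Ble.
    - set (T := beta_tail (Re al) (Re be) d) in *. set (S := edge_size d) in *.
      assert (Y0 : 0 <= Kk * (Me * T) + M1 * S).
      { apply Rplus_le_le_0_compat; apply Rmult_le_pos; try lra. apply Rmult_le_pos; lra. }
      apply Rle_trans with (2 * (Kk * (Me * T) + M1 * S)); [nra|].
      set (u := Rmax T S). assert (T <= u) by apply Rmax_l. assert (S <= u) by apply Rmax_r.
      assert (u < eps / D) by (apply Rmax_lub_lt; assumption).
      apply Rle_trans with ((2 * (Kk * Me + M1)) * u); [|apply big; [unfold D; lra | lra]].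
      assert (Kk * Me * T <= Kk * Me * u) by (apply Rmult_le_compat_l; lra).
      assert (M1 * S <= M1 * u) by (apply Rmult_le_compat_l; lra). lra. }
  assert (V2 : Cmod (Cminus (trunc qf d s0) (trunc qf d 0)) <= eps).
  { eapply Rle_trans.
    - apply (CMVT (trunc qf d) (fun s => Cplus (Cmult (kappa s) (trunc qe d s))
        (Cminus (Cmult (edge (1 - d)) (q1 s (1 - d))) (Cmult (edge d) (q1 s d)))) 0 s0
        (Kk * (Me * Kb) + M1 * edge_size d)); [lra| |].
      + intros s Hs. apply trunc_qf_derive; [exact Hd | apply admissible_unit; lra].
      + intros s Hs. apply der_le; [lra|].
        apply (beta_CRInt_bound al be (qe s) Me d Hal Hbe Hd).
        * intros t Ht. apply (slice_cont qe s); [exact qe_cont | apply admissible_unit; lra | lra].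
        * intros t Ht. apply HMe; lra.
    - rewrite Rminus_0_r. apply Rle_trans with (K1 * s0); [|exact Hs0e].
      apply Rmult_le_compat_r; [lra|]. unfold K1.
      assert (M1 * edge_size d <= M1 * 1) by (apply Rmult_le_compat_l; lra). lra. }
  assert (V3 : trunc qf d 0 = Cmult (RtoC (/ (c - w * w))) (CRInt (beta_kernel al be) d (1 - d))).
  { rewrite <- CRInt_scal.
    - apply CRInt_ext. intros t. rewrite Rmin_left, Rmax_right by lra. intros Ht. rewrite qf_0 by lra. ring.
    - intros t. rewrite Rmin_left, Rmax_right by lra. intros Ht. apply beta_kernel_cont; lra. }
  assert (V4 : Cmod (Cminus (Cmult (RtoC (/ (c - w * w))) B) (trunc qf d 0)) <= eps).
  { rewrite V3.
    replace (Cminus (Cmult (RtoC (/ (c - w * w))) B) (Cmult (RtoC (/ (c - w * w))) (CRInt (beta_kernel al be) d (1 - d))))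
      with (Copp (Cmult (RtoC (/ (c - w * w))) (Cminus (CRInt (beta_kernel al be) d (1 - d)) B))) by ring.
    rewrite Cmod_opp, Cmod_mult, Cmod_R, Rabs_right by lra.
    apply Rle_trans with (/ (c - w * w) * beta_tail (Re al) (Re be) d); [apply Rmult_le_compat_l; lra|].
    apply big; [unfold D; lra | lra]. }
  assert (V5 : Mf * beta_tail (Re al) (Re be) d <= eps) by (apply big; [unfold D; lra | lra]).
  pose proof (Cmod_dist (Cmult (RtoC (/ (c - w * w))) B) (trunc qf d 0) l) as T1.
  pose proof (Cmod_dist (trunc qf d 0) (trunc qf d s0) l) as T2.
  rewrite (Cmod_minus_sym (trunc qf d 0) (trunc qf d s0)) in T2.
  pose proof (Cmod_dist (trunc qf d s0) (trunc qf d 1) l) as T3.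
  rewrite (Cmod_minus_sym (trunc qf d s0) (trunc qf d 1)) in T3.
  unfold eps in *. lra.
Qed.
End Deformation.

(** * The theorem *)

Lemma at_right_0_unit : at_right 0 (fun t => 0 < t < 1).
Proof.
  exists (mkposreal 1 Rlt_0_1). intros t Ht H0. change (Rabs (t - 0) < 1) in Ht.
  apply Rabs_def2 in Ht. lra.
Qed.

Lemma at_left_1_unit : at_left 1 (fun t => 0 < t < 1).
Proof.
  exists (mkposreal 1 Rlt_0_1). intros t Ht H0. change (Rabs (t - 1) < 1) in Ht.
  apply Rabs_def2 in Ht. lra.
Qed.

Lemma is_RInt_gen_unit_ext (u v : R -> C) (l : C) : (forall t, 0 < t < 1 -> u t = v t) ->
  is_RInt_gen (V := C_R_NormedModule) u (at_right 0) (at_left 1) l ->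
  is_RInt_gen (V := C_R_NormedModule) v (at_right 0) (at_left 1) l.
Proof.
  intros E. apply (is_RInt_gen_ext (V := C_R_NormedModule) u v).
  apply (Filter_prod _ _ _ (fun t => 0 < t < 1) (fun t => 0 < t < 1)).
  - apply at_right_0_unit.
  - apply at_left_1_unit.
  - intros x y Hx Hy t Ht. simpl in Ht. apply E.
    pose proof (Rmin_glb_lt x y 0). pose proof (Rmax_lub_lt x y 1). lra.
Qed.

Theorem theorem5p1 (alpha beta : C) (a c : R)
  (Halpha : 0 < Re alpha) (Hbeta : 0 < Re beta)
  (H1 : forall t : R, 0 <= t <= 1 -> c - a * (a + t) > 0)
  (H2 : forall t : R, 0 <= t <= 1 -> c - (a + 1) * (a + t) > 0)
  (H3 : forall t : R, 0 <= t <= 1 -> c - (a + t) ^ 2 > 0)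
  (F : C -> C)
  (HF : is_F21_continuation (Cminus (Cminus alpha beta) (RtoC 1)) (Copp beta) alpha F) :
  exists Ga Gb Gab I : C,
    is_Gamma alpha Ga /\ is_Gamma beta Gb /\ is_Gamma (Cplus alpha beta) Gab /\
    is_RInt_gen (V := C_R_NormedModule)
      (fun t : R =>
         Cmult (Cmult (Cmult
           (Cdiv (Cmult (cpow (c - a * (a + t)) beta)
                        (cpow (c - (a + 1) * (a + t)) (Cminus beta (RtoC 1))))
                 (cpow (c - (a + t) ^ 2) (Cmult (RtoC 2) beta)))
           (F (RtoC ((a + t) * t / (c - a * (a + t))))))
           (cpow t (Cminus alpha (RtoC 1))))
           (cpow (1 - t) (Cminus beta (RtoC 1))))
      (at_right 0) (at_left 1) I /\
    Cdiv (Cmult Ga Gb) Gab = Cmult (RtoC (c - (a + 1) ^ 2)) I.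
Proof.
  assert (Hab : 0 < Re (Cplus alpha beta)) by (simpl; unfold Re in *; lra).
  destruct (gamma_exists alpha Halpha) as [Ga [IGa TGa]].
  destruct (gamma_exists beta Hbeta) as [Gb [IGb TGb]].
  destruct (gamma_exists _ Hab) as [Gab [IGab TGab]].
  destruct (lower_gamma_exists alpha Ga Halpha TGa) as [la [la1 [la2 [la3 _]]]].
  destruct (lower_gamma_exists beta Gb Hbeta TGb) as [lb [lb1 [lb2 [lb3 _]]]].
  destruct (lower_gamma_exists _ Gab Hab TGab) as [lab [lab1 [lab2 [lab3 _]]]].
  destruct (beta_improper alpha beta (fun _ => RtoC 1) 1 Halpha Hbeta) as [B [_ HB0]].
  { intros t _. apply Ccont_const. }
  { intros t _. rewrite Cmod_1. lra. }
  assert (HB : forall d, 0 < d < 1 ->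
     Cmod (Cminus (CRInt (beta_kernel alpha beta) d (1 - d)) B) <= beta_tail (Re alpha) (Re beta) d).
  { intros d Hd. rewrite <- (Rmult_1_l (beta_tail _ _ _)).
    rewrite (CRInt_ext (beta_kernel alpha beta) (fun t => Cmult (beta_kernel alpha beta t) (RtoC 1))) by (intros; ring).
    now apply HB0. }
  pose proof (gamma_beta alpha beta Ga Gb Gab Halpha Hbeta la lb lab la1 la2 la3 lb1 lb2 lb3 lab1 lab2 lab3 B HB) as GB.
  pose proof (gamma_neq_0 _ Gab Hab TGab) as nGab.
  set (a1 := Cminus (Cminus alpha beta) (RtoC 1)) in *.
  set (u := hyp_coef a1 (Copp beta) alpha). set (v := hyp_companion a1 (Copp beta) alpha).
  pose proof (hyp_coef_bounded a1 (Copp beta) alpha Halpha) as Bu.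
  pose proof (companion_bounded a1 (Copp beta) alpha Halpha) as Bv.
  (* The two ends of the path: [H3] at t = 1 gives w^2 < c for s = 0, and at t = 0 it gives a^2 < c
     for s = 1. *)
  assert (Hw : (a + 1) * (a + 1) < c) by (specialize (H3 1 ltac:(lra)); simpl in H3; lra).
  assert (Ha : admissible (a + 1) c 1).
  { unfold admissible, da. specialize (H3 0 ltac:(lra)). simpl in H3. nra. }
  destruct (deformation alpha beta (a + 1) c (CPS u) (CPS v) (CPS (deriv_coef u)) (CPS (deriv_coef v)) Hw)
    as [l [Hl HlB]]; try assumption.
  - intros z Hz. now apply CPS_derive.
  - intros z Hz. now apply CPS_derive.
  - intros z Hz. eapply Cderive_Ccont, CPS_derive; [now apply deriv_coef_bounded | exact Hz].
  - intros z Hz. eapply Cderive_Ccont, CPS_derive; [now apply deriv_coef_bounded | exact Hz].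
  - intros z Hz. now apply hyp_relation_1.
  (* With b = - beta and c = alpha, the coefficients c - b and c - b x become alpha + beta and alpha
     + beta x. *)
  - intros z Hz. unfold u, v. rewrite hyp_relation_2 by assumption. ring.
  - rewrite CPS_0. unfold u, hyp_coef. simpl. field.
  - exists Ga, Gb, Gab, l. repeat (split; [assumption|]). split.
    + revert Hl. apply is_RInt_gen_unit_ext. intros t Ht. unfold qf, base, beta_kernel.
      assert (Ht' : 0 <= t <= 1) by lra.
      pose proof (dz_lt_1 (a + 1) c Hw 1 t Ha Ht') as Hz.
      assert (EX : dX (a + 1) c 1 t = c - a * (a + t)) by (unfold dX, da, dx; ring).
      assert (EW : dW (a + 1) c 1 t = c - (a + 1) * (a + t)) by (unfold dW, dx; ring).
      assert (EZ : dZ (a + 1) c 1 t = c - (a + t) ^ 2) by (unfold dZ, dx; ring).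
      assert (Ez : dz (a + 1) c 1 t = (a + t) * t / (c - a * (a + t))).
      { unfold dz. rewrite EX. unfold dx, Rdiv. f_equal. ring. }
      rewrite EX, EW, EZ. rewrite Ez in *.
      (* The argument lies in (-1, 1), where the continuation [F] is the sum of the power series. *)
      rewrite (F21_CPS a1 (Copp beta) alpha (F (RtoC ((a + t) * t / (c - a * (a + t))))) _ Halpha Hz).
      2:{ apply (proj2 HF). rewrite Cmod_R. exact Hz. }
      fold u. rewrite cpow_opp.
      replace (Cplus beta beta) with (Cmult (RtoC 2) beta).
      2:{ replace 2 with (1 + 1) by ring. rewrite RtoC_plus. ring. }
      unfold Cdiv. ring.
    + rewrite GB, (HlB B HB).
      replace ((a + 1) ^ 2) with ((a + 1) * (a + 1)) by ring. field. exact nGab.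
Qed.
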